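(* Let $\rho^d=(\rho_i^d)_i\in L^2(0,T;\mathbb{L}^2)$, $\rho^T=(\rho_i^T)_i\in\mathbb{L}^2$ and $\alpha_i>0$ for $i=1,\dots,N$. Then there exists at least one solution $\bar u\in\mathcal{U}_{ad}$ of the optimal control problem $$\inf_{u\in\mathcal{U}_{ad}}J(G(u),u),$$ i.e. there is $\bar u\in\mathcal{U}_{ad}$ with $J(G(\bar u),\bar u)=\inf_{u\in\mathcal{U}_{ad}}J(G(u),u)$.
   Context: Fix $N\ge 1$, $T>0$, lengths $l_i>0$ and constants $D_i>0$, $i=1,\dots,N$; set $Q_i=(0,l_i)\times(0,T)$. The star graph has $N$ edges $(0,l_i)$ joined at the common vertex $x=0$. Spaces: $\mathbb{L}^2=\prod_{i=1}^N L^2(0,l_i)$; $\mathbb{L}^\infty=\prod_{i=1}^N L^\infty(Q_i)$ with $\|u\|_{\mathbb{L}^\infty}=\sum_i\|u_i\|_{L^\infty(Q_i)}$; $\mathbb{H}^1=\prod_{i=1}^N H^1(0,l_i)$ with $\|v\|_{\mathbb{H}^1}^2=\sum_i\|v_i\|_{H^1(0,l_i)}^2$; $$\mathbb{V}=\{\varphi\in\mathbb{H}^1:\ \varphi_i(0)=\varphi_j(0)\ (i\ne j),\ \varphi_i(l_i)=0,\ i,j=1,\dots,N\}$$ with the $\mathbb{H}^1$ norm. $\mathbb{V}^\star$ is its dual, and $\mathbb{L}^2$ is identified with its dual so that $\mathbb{V}\hookrightarrow\mathbb{L}^2\hookrightarrow\mathbb{V}^\star$. $\mathbb{W}(0,T)=\{\rho\in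 L^2(0,T;\mathbb{V}):\rho_t\in L^2(0,T;\mathbb{V}^\star)\}$, which embeds continuously in $\mathcal{C}([0,T];\mathbb{L}^2)$. Fix $\rho^0\in\mathbb{L}^2$. For $u\in\mathbb{L}^\infty$, the state equation is, formally, for $i,j=1,\dots,N$ and $t\in(0,T)$: $\partial_t\rho_i-D_i\partial_x^2\rho_i-\partial_x(u_i\rho_i)=0$ in $Q_i$; $\rho_i(x,0)=\rho_i^0(x)$; $\sum_{i}[D_i\partial_x\rho_i(0,t)+u_i(0,t)\rho_i(0,t)]=0$; $\rho_i(0,t)=\rho_j(0,t)$ for $i\ne j$; $\rho_i(l_i,t)=0$. A weak solution is $\rho\in\mathbb{W}(0,T)$ with $\rho(\cdot,0)=\rho^0$ in $\mathbb{L}^2$ and, for all $\varphi\in\mathbb{V}$, $\sum_i\frac{d}{dt}(\rho_i,\varphi_i)_{L^2(0,l_i)}+\mathcal{F}[u](\rho,\varphi)=0$ in $\mathcal{D}'(0,T)$, where $\mathcal{F}[u](\rho,\varphi)=\sum_{i=1}^N\int_0^{l_i}(D_i\partial_x\rho_i+u_i\rho_i)\,\partial_x\varphi_i\,dx$ at a.e. time $t$. For every $u\in\mathbb{L}^\infty$ there is a unique weak solution; the control-to-state operator $G:\mathbb{L}^\infty\to\mathbb{W}(0,T)$ maps $u$ to this solution $\rho$. The cost functional is $$J(\rho,u)=\frac12\sum_{i=1}^N\int_{Q_i}|\rho_i-\rho_i^d|^2\,dx\,dt+\frac12\sum_{i=1}^N\int_0^{l_i}|\rho_i(T)-\rho_i^T|^2\,dx+\frac12\sum_{i=1}^N\alpha_i\int_{Q_i}|u_i|^2\,dx\,dt.$$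 Given fixed $u^{\min}=(u_i^{\min})_i,\ u^{\max}=(u_i^{\max})_i\in\mathbb{L}^\infty$ with $u_i^{\min}\le u_i^{\max}$ a.e. in $Q_i$ for every $i$, the admissible set is $$\mathcal{U}_{ad}=\{u=(u_i)_i\in\mathbb{L}^\infty:\ u_i^{\min}\le u_i\le u_i^{\max}\ \text{a.e. in }Q_i,\ i=1,\dots,N\}.$$ *)

(* Defs.v *)
From HB Require Import structures.
From mathcomp Require Import all_boot all_order all_algebra.
From mathcomp Require Import all_classical all_reals all_analysis.

Set Implicit Arguments.
Unset Strict Implicit.
Unset Printing Implicit Defensive.
Import Order.TTheory GRing.Theory Num.Theory.
Import numFieldNormedType.Exports.

Local Open Scope classical_set_scope.
Local Open Scope ring_scope.

(* Elements of L^p, H^1 and Bochner spaces are handled through representatives: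
   plain functions, of which only the values on the relevant interval (or
   rectangle), up to null sets, matter. *)

Notation leb := (@lebesgue_measure _).
Notation leb2 := (leb \x leb)%E.

Section Interval.
Variable R : realType.
Implicit Types (a b l : R) (v w psi : R -> R).

Definition test_function a b psi : Prop :=
  (forall n x, derivable (derive1n n psi) x 1) /\
  exists c d, [/\ a < c, d < b & forall x, x \notin `[c, d] -> psi x = 0].

Definition L2_itv l v : Prop := v \_ `]0, l[ \in Lfun (@lebesgue_measure R) 2%:E.

Definition is_weak_derivative l v w : Prop :=
  L2_itv l w /\
  forall psi, test_function 0 l psi ->
    \int[leb]_(x in `]0, l[) (v x * derive1 psi x) =
    - (\int[leb]_(x in `]0, l[) (w x * psi x)).

Definition H1_itv l v : Prop := L2_itv l v /\ exists w, is_weak_derivative l v w.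

(* A choice of the weak derivative, unique up to a null set of (0, l). *)
Definition weak_derivative l v : R -> R := get [set w | is_weak_derivative l v w].

End Interval.

(* L^2(0, T; X) for a space X whose elements are represented in E, with squared
   norm sqX: strongly measurable functions with square-integrable norm. *)
Section Bochner.
Variables (R : realType) (E : zmodType) (X : set E) (sqX : E -> \bar R) (T : R).

Definition simple_function (s : R -> E) : Prop :=
  [/\ finite_set (range s), range s `<=` X &
      forall e, measurable (s @^-1` [set e])].

Definition strongly_measurable (f : R -> E) : Prop :=
  exists2 s : nat -> R -> E, (forall k, simple_function (s k)) &
    {ae leb, forall t : R, t \in `]0, T[ ->
       sqX (s k t - f t) @[k --> \oo] --> 0%E}.

Definition L2_time (f : R -> E) : Prop :=
  [/\ {ae leb, forall t : R, t \in `]0, T[ -> X (f t)},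
      strongly_measurable f &
      (\int[leb]_(t in `]0%R, T[) sqX (f t) < +oo)%E].

End Bochner.

Definition network_fun (R : realType) (N : nat) := 'I_N -> R -> R.
HB.instance Definition _ (R : realType) (N : nat) :=
  GRing.Zmodule.on (network_fun R N).

Definition control (R : realType) (N : nat) := 'I_N -> R * R -> R.

Section StarGraph.
Variables (R : realType) (N : nat) (l : 'I_N -> R).

Local Notation network_fun := (network_fun R N).
Local Notation control := (control R N).
Implicit Types (v w phi : network_fun) (g : network_fun -> R).

Definition L2_graph : set network_fun := [set v | forall i, L2_itv (l i) (v i)].

Definition sqnorm_L2 v : \bar R :=
  (\sum_(i < N) \int[leb]_(x in `]0%R, l i[) ((v i x) ^+ 2)%:E)%E.

Definition dot_L2 v w : R :=
  \sum_(i < N) \int[leb]_(x in `]0, l i[) (v i x * w i x).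

Definition sqnorm_H1 v : \bar R :=
  (\sum_(i < N) ((\int[leb]_(x in `]0%R, l i[) ((v i x) ^+ 2)%:E) +
                 (\int[leb]_(x in `]0%R, l i[)
                   ((weak_derivative (l i) (v i) x) ^+ 2)%:E)))%E.

(* The values at the vertices are those of the continuous representative. *)
Definition V_graph : set network_fun :=
  [set v | [/\ forall i, H1_itv (l i) (v i),
               forall i, {within `[0, l i], continuous (v i)},
               forall i j, v i 0 = v j 0 &
               forall i, v i (l i) = 0]].

Definition V_dual : set (network_fun -> R) :=
  [set g | (forall (a : R) v w, V_graph v -> V_graph w ->
              g (fun i x => a * v i x + w i x) = a * g v + g w) /\
           exists C : R, forall v, V_graph v ->
              (((g v) ^+ 2)%:E <= C%:E * sqnorm_H1 v)%E].

Definition sqnorm_dual g : \bar R :=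
  ereal_sup [set ((g v) ^+ 2)%:E | v in
               [set v | V_graph v /\ (sqnorm_H1 v <= 1%:E)%E]].

Variable T : R.

(* L^2 is identified with its dual, so that an element v of L^2 acts on V as
   dot_L2 v. *)
Definition is_time_derivative (rho : R -> network_fun)
    (g : R -> network_fun -> R) : Prop :=
  forall phi psi, V_graph phi -> test_function 0 T psi ->
    \int[leb]_(t in `]0, T[) (dot_L2 (rho t) phi * derive1 psi t) =
    - (\int[leb]_(t in `]0, T[) (g t phi * psi t)).

(* C([0, T]; L^2) *)
Definition continuous_L2 (rho : R -> network_fun) : Prop :=
  (forall t, t \in `[0, T] -> L2_graph (rho t)) /\
  (forall t0, t0 \in `[0, T] ->
     sqnorm_L2 (rho t - rho t0) @[t --> within `[0, T] (nbhs t0)] --> 0%E).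

(* An element of W(0, T) is represented by its representative in
   C([0, T]; L^2), which gives a meaning to rho 0 and rho T. *)
Definition W_space (rho : R -> network_fun) : Prop :=
  [/\ L2_time V_graph sqnorm_H1 T rho,
      exists2 g : R -> network_fun -> R,
        L2_time V_dual sqnorm_dual T g & is_time_derivative rho g &
      continuous_L2 rho].

(* Q_i, with points (x, t). *)
Definition cylinder (i : 'I_N) : set (R * R) :=
  [set` `]0, l i[] `*` [set` `]0, T[].

Definition Linfty (u : control) : Prop :=
  forall i, u i \_ (cylinder i) \in
    Lfun (@lebesgue_measure R \x @lebesgue_measure R)%E +oo%E.

Variable D : 'I_N -> R.

Definition form_F (u : control) (t : R) v phi : R :=
  \sum_(i < N) \int[leb]_(x in `]0, l i[)
    ((D i * weak_derivative (l i) (v i) x + u i (x, t) * v i x) *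
     weak_derivative (l i) (phi i) x).

(* The equation in D'(0, T) is tested against psi in C_c^infty(0, T). *)
Definition weak_solution (rho0 : network_fun) (u : control)
    (rho : R -> network_fun) : Prop :=
  [/\ W_space rho,
      forall i, {ae leb, forall x : R, x \in `]0, l i[ -> rho 0 i x = rho0 i x} &
      forall phi psi, V_graph phi -> test_function 0 T psi ->
        - (\int[leb]_(t in `]0, T[) (dot_L2 (rho t) phi * derive1 psi t)) +
        (\int[leb]_(t in `]0, T[) (form_F u t (rho t) phi * psi t)) = 0].

(* G picks a weak solution for every control; weak solutions being unique, this
   determines G u as an element of W(0, T). *)
Definition control_to_state (rho0 : network_fun)
    (G : control -> R -> network_fun) : Prop :=
  forall u, Linfty u -> weak_solution rho0 u (G u).

Definition admissible (umin umax : control) : set control :=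
  [set u | Linfty u /\
     forall i, {ae leb2, forall z : R * R, z \in cylinder i ->
       umin i z <= u i z <= umax i z}].

(* For functions of L^2(0, T; L^2), seen as functions of t, the integral over
   Q_i is the integral in t of the integral in x. *)
Definition cost (rhod : R -> network_fun) (rhoT : network_fun)
    (alpha : 'I_N -> R) (rho : R -> network_fun) (u : control) : \bar R :=
  ((2^-1)%:E * (\sum_(i < N) \int[leb]_(t in `]0%R, T[)
       \int[leb]_(x in `]0%R, l i[) ((rho t i x - rhod t i x) ^+ 2)%:E) +
   (2^-1)%:E * (\sum_(i < N)
       \int[leb]_(x in `]0%R, l i[) ((rho T i x - rhoT i x) ^+ 2)%:E) +
   (2^-1)%:E * (\sum_(i < N) (alpha i)%:E *
       \int[leb2]_(z in cylinder i) ((u i z) ^+ 2)%:E))%E.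

End StarGraph.

(* Main.v *)
(** The control enters the equation through the product [u rho], so that weak
    limits of controls can be used only if the states converge strongly.  Strong
    convergence is obtained without Aubin-Lions compactness.  Let [K] be the
    inverse of [- D dxx] with the vertex conditions and [P v] the derivative of
    [K v].  Testing the equation with [K v] removes all derivatives of [rho], and
    [E(v) = (v, K v)], which dominates [|P v|^2], satisfies an energy identity.
    For the difference [z] of two states,
      [E(z(t)) + int_0^t |z|^2 <= C (E(z(0)) + sup_s |int_0^s (w rho, P z)|]),
    [w] being the difference of the controls.  Along an ultrafilter the controls
    of a minimizing sequence have weak limits, given by Radon-Nikodym densities of
    the limits of their integrals over measurable sets.  On a grid of time cells
    [P z] may be replaced by its value at the time of the cell where [|z|] is
    minimal, because [E(z(t) - z(s))] is small for close times; this value is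
    Hoelder continuous in space, and the remainder [int (w rho, P z)] becomes a
    finite sum of integrals of [w] against fixed functions.  Hence [z] tends to 0
    in [L^2], [z(T)] tends to 0 weakly, and the cost is lower semicontinuous. *)
Require Import Defs.
From HB Require Import structures.
From mathcomp Require Import all_boot all_order all_algebra.
From mathcomp Require Import all_classical all_reals all_analysis.
From mathcomp Require Import measurable_realfun ess_sup_inf lra ring.

Set Implicit Arguments.
Unset Strict Implicit.
Unset Printing Implicit Defensive.
Import Order.TTheory GRing.Theory Num.Theory.
Import numFieldNormedType.Exports.

Local Open Scope classical_set_scope.
Local Open Scope ring_scope.

(** * Integrable and square integrable functions *)

Section Integrable.
Context d {T : measurableType d} {R : realType} (mu : {measure set T -> \bar R}).
Variables (D : set T) (mD : measurable D).
Implicit Types f g h : T -> R.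

(** The state equation is known only as a distribution in time, for fixed test functions, and the
    controls are merely bounded and measurable. The equation is therefore used integrated in time,
    which gives every energy relation without a chain rule in the dual of V. There E is the squared
    dual norm: the dissipation is then the plain L^2 norm, large enough to absorb the control term
    by Young's inequality, and what is left is a multiple of E, suited to Gronwall's lemma. The
    remainder (w rho, P z) is delicate because z varies with the same index as w, so that weak
    convergence of w does not apply to it. The time s of minimal |z| in a cell serves twice:
    |z(s)|^2 is at most its mean over the cell, and |z(r) - z(s)| <= 2 |z(r)| for all r in the cell.
    At the final time only E(z(T)) tends to 0. The L^2 bound that turns this into weak convergence
    is supplied by the cost, bounded along the minimizing sequence. *)

Definition intble f := mu.-integrable D (EFin \o f).

Lemma intble_measurable f : intble f -> measurable_fun D f.
Proof. by move=> /integrableP[/measurable_EFinP]. Qed.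

Lemma intbleD f g : intble f -> intble g -> intble (fun x => f x + g x).
Proof. by move=> fi gi; have := integrableD mD fi gi. Qed.

Lemma intbleZ f k : intble f -> intble (fun x => k * f x).
Proof. by move=> fi; have := integrableZl mD k fi. Qed.

Lemma intbleZr f k : intble f -> intble (fun x => f x * k).
Proof. by move=> /(intbleZ k); under eq_fun do rewrite mulrC. Qed.

Lemma intbleB f g : intble f -> intble g -> intble (fun x => f x - g x).
Proof. by move=> fi gi; have := integrableB mD fi gi. Qed.

Lemma intbleN f : intble f -> intble (fun x => - f x).
Proof.
move=> /(intbleZ (-1)); rewrite /intble; congr (_.-integrable _ _).
by apply/funext => x /=; rewrite mulN1r.
Qed.

Lemma intble0 : intble (fun=> 0).
Proof. exact: integrable0. Qed.

Lemma intble_sum (I : Type) (r : seq I) (F : I -> T -> R) :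
  (forall i, intble (F i)) -> intble (fun x => \sum_(i <- r) F i x).
Proof.
move=> iF; elim: r => [|i r IH].
  rewrite (_ : (fun x => _) = fun=> 0); first exact: intble0.
  by apply/funext => x; rewrite big_nil.
rewrite (_ : (fun x => _) = fun x => F i x + \sum_(j <- r) F j x).
  exact: intbleD.
by apply/funext => x; rewrite big_cons.
Qed.

Lemma intble_le f g : measurable_fun D f -> (forall x, D x -> `|f x| <= g x) ->
  intble g -> intble f.
Proof.
move=> mf fg; apply: le_integrable => //; first exact/measurable_EFinP.
by move=> x Dx /=; rewrite lee_fin (le_trans (fg x Dx))// ler_norm.
Qed.

Lemma intble_norm f : intble f -> intble (fun x => `|f x|).
Proof.
move=> fi; apply: (@intble_le _ (fun x => `|f x|)).
- by apply: measurableT_comp => //; exact: intble_measurable.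
- by move=> x _; rewrite normr_id.
- by have := integrable_norm fi.
Qed.

Lemma Rintegral_sum (I : Type) (r : seq I) (F : I -> T -> R) :
  (forall i, intble (F i)) ->
  \int[mu]_(x in D) (\sum_(i <- r) F i x) = \sum_(i <- r) \int[mu]_(x in D) F i x.
Proof.
move=> iF; elim: r => [|i r IH].
  rewrite big_nil; under eq_Rintegral do rewrite big_nil.
  by rewrite /Rintegral integral0_eq.
rewrite big_cons -IH -RintegralD//; [|exact: iF|exact: intble_sum].
by apply: eq_Rintegral => x _; rewrite big_cons.
Qed.

Lemma RintegralN f : intble f -> \int[mu]_(x in D) (- f x) = - \int[mu]_(x in D) f x.
Proof.
move=> fi; rewrite -mulN1r -RintegralZl//.
by apply: eq_Rintegral => x _; rewrite mulN1r.
Qed.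

Lemma EFin_Rintegral f : intble f ->
  (\int[mu]_(x in D) f x)%:E = (\int[mu]_(x in D) (f x)%:E)%E.
Proof. by move=> fi; rewrite /Rintegral fineK//; exact: integrable_fin_num. Qed.

Lemma intble_indic f A : measurable A -> intble f ->
  intble (fun x => f x * \1_A x).
Proof.
move=> mA fi; apply: (@intble_le _ (fun x => `|f x|)); last exact: intble_norm.
- apply: measurable_funM; first exact: intble_measurable.
  exact: measurable_indic.
- move=> x _; rewrite indicE normrM.
  by case: (_ \in _); rewrite ?normr1 ?normr0 ?mulr1 ?mulr0.
Qed.

Lemma Rintegral_indic f A : measurable A -> A `<=` D ->
  \int[mu]_(x in D) (f x * \1_A x) = \int[mu]_(x in A) f x.
Proof.
move=> mA AD; rewrite -[in RHS](setIidr AD) Rintegral_mkcondr.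
apply: eq_Rintegral => x _; rewrite patchE indicE.
by case: ifP; rewrite ?mulr1 ?mulr0.
Qed.

Lemma intble_sub f A : measurable A -> A `<=` D -> intble f ->
  mu.-integrable A (EFin \o f).
Proof. by move=> mA AD; exact: integrableS. Qed.

Lemma intble_patch f : intble f <-> mu.-integrable setT (EFin \o (f \_ D)).
Proof.
rewrite /intble -restrict_EFin; split => [fi|/integrable_restrict].
  by apply/integrable_restrict => //; rewrite setTI.
by rewrite setTI; apply.
Qed.

Definition L2on f := measurable_fun D f /\ intble (fun x => f x ^+ 2).

Lemma intble_mul f g : L2on f -> L2on g -> intble (fun x => f x * g x).
Proof.
move=> [mf if2] [mg ig2].
apply: (@intble_le _ (fun x => f x ^+ 2 + g x ^+ 2)); first exact: measurable_funM.
- move=> x _; rewrite ler_norml; apply/andP; split; nra.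
- exact: intbleD.
Qed.

Lemma L2on_norm f : L2on f -> L2on (fun x => `|f x|).
Proof.
move=> [mf if2]; split; first exact: measurableT_comp.
by under eq_fun do rewrite real_normK ?num_real//.
Qed.

Lemma L2onZ f k : L2on f -> L2on (fun x => k * f x).
Proof.
move=> [mf if2]; split; first exact: measurable_funM.
by under eq_fun do rewrite exprMn; exact: intbleZ.
Qed.

Lemma L2on_le f g : measurable_fun D f -> (forall x, D x -> `|f x| <= `|g x|) ->
  L2on g -> L2on f.
Proof.
move=> mf fg [mg g2]; split => //; apply: (@intble_le _ (fun x => g x ^+ 2)) => //.
  exact: measurable_funX.
move=> x Dx; rewrite normrX -[leRHS]real_normK ?num_real//.
by rewrite lerXn2r ?nnegrE//; exact: fg.
Qed.

Lemma L2onD f g : L2on f -> L2on g -> L2on (fun x => f x + g x).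
Proof.
move=> [mf if2] [mg ig2]; split; first exact: measurable_funD.
apply: (@intble_le _ (fun x => 2 * f x ^+ 2 + 2 * g x ^+ 2)).
- by apply: measurable_funX; exact: measurable_funD.
- by move=> x _; rewrite ger0_norm ?sqr_ge0//; have := sqr_ge0 (f x - g x); nra.
- by apply: intbleD; exact: intbleZ.
Qed.

Lemma L2onN f : L2on f -> L2on (fun x => - f x).
Proof. by move=> /(L2onZ (-1)); under eq_fun do rewrite mulN1r. Qed.

Lemma L2onB f g : L2on f -> L2on g -> L2on (fun x => f x - g x).
Proof. by move=> fi /L2onN; exact: L2onD. Qed.

Lemma L2on_sum (I : Type) (r : seq I) (F : I -> T -> R) :
  (forall i, L2on (F i)) -> L2on (fun x => \sum_(i <- r) F i x).
Proof.
move=> iF; elim: r => [|i r IH].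
  rewrite (_ : (fun x => _) = fun=> 0); last by apply/funext => x; rewrite big_nil.
  split; first exact: measurable_cst.
  by under eq_fun do rewrite expr0n; exact: intble0.
rewrite (_ : (fun x => _) = fun x => F i x + \sum_(j <- r) F j x).
  exact: L2onD.
by apply/funext => x; rewrite big_cons.
Qed.

Lemma L2on_mulb f g (M : R) : measurable_fun D g -> (forall x, D x -> `|g x| <= M) ->
  L2on f -> L2on (fun x => g x * f x).
Proof.
move=> mg gM Lf; apply: (@L2on_le _ (fun x => M * f x)).
- by apply: measurable_funM => //; case: Lf.
- move=> x Dx; rewrite !normrM ler_wpM2r//.
  by rewrite (le_trans (gM x Dx))// ler_norm.
- exact: L2onZ.
Qed.

Hypothesis fD : (mu D < +oo)%E.

Lemma intble_bounded f (M : R) : measurable_fun D f ->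
  (forall x, D x -> `|f x| <= M) -> intble f.
Proof.
move=> mf fM; apply: (@intble_le _ (fun=> M)) => //.
apply/integrableP; split; first exact: measurable_cst.
by rewrite integral_cst//= lte_mul_pinfty.
Qed.

Lemma L2on_bounded f (M : R) : measurable_fun D f ->
  (forall x, D x -> `|f x| <= M) -> L2on f.
Proof.
move=> mf fM; split => //; apply: (@intble_bounded _ (M ^+ 2)).
- exact: measurable_funX.
- move=> x Dx; rewrite normrX lerXn2r ?nnegrE//; first exact: le_trans (fM x Dx).
  exact: fM.
Qed.

Lemma L2on_cst k : L2on (fun=> k).
Proof. by apply: (@L2on_bounded _ `|k|). Qed.

Lemma L2on_intble f : L2on f -> intble f.
Proof.
move=> /(intble_mul (L2on_cst 1)); by under eq_fun do rewrite mul1r.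
Qed.

End Integrable.

(** * Comparison of integrals without measurability *)

Section LowerIntegral.
Context d {T : measurableType d} {R : realType} (mu : {measure set T -> \bar R}).
Variables (D : set T) (mD : measurable D).
Local Open Scope ereal_scope.
Import HBNNSimple.

Lemma le_integral_nonmeasurable (f g : T -> \bar R) :
  (forall x, D x -> 0 <= f x) -> (forall x, D x -> f x <= g x) ->
  \int[mu]_(x in D) f x <= \int[mu]_(x in D) g x.
Proof.
move=> f0 fg; rewrite integral_mkcond [leRHS]integral_mkcond.
rewrite !ge0_integralTE; first last.
- by apply: erestrict_ge0.
- by apply: erestrict_ge0 => x Dx; exact: le_trans (f0 x Dx) (fg x Dx).
apply: le_ereal_sup => _ [h hf <-]; exists h => // x; apply: le_trans (hf x) _.
by rewrite !patchE; case: ifPn => // /set_mem; exact: fg.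
Qed.

(* The integral of a nonnegative function is a supremum over simple functions
   below it, so that only the summand [k] has to be measurable.  The cost contains
   integrals whose integrand is not known to be measurable in time. *)
Lemma le_integralD_nonmeasurable (f g : T -> \bar R) (k : T -> R) (N : set T) :
  measurable N -> mu N = 0 ->
  measurable_fun D k -> (forall x, D x -> (0 <= k x)%R) ->
  (forall x, D x -> 0 <= f x) -> (forall x, D x -> 0 <= g x) ->
  (forall x, D x -> ~ N x -> f x <= g x + (k x)%:E) ->
  \int[mu]_(x in D) f x <= \int[mu]_(x in D) g x + \int[mu]_(x in D) (k x)%:E.
Proof.
move=> mN N0 mk k0 f0 g0 fgk.
rewrite [leLHS]integral_mkcond ge0_integralTE; last exact: erestrict_ge0.
apply: ge_ereal_sup => _ [h hf <-]; rewrite -integralT_nnsfun.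
(* [h'] is the positive part of [h - k], set to 0 on the exceptional set: a measurable function
   below [g] on [D], with [h <= h' + k] off [N]. *)
pose h' x := (Order.max (h x - k x) 0 * \1_(~` N) x)%R.
have mh : measurable_fun D h by apply: measurable_funTS.
have mh' : measurable_fun D h'.
  apply: measurable_funM; last exact/measurable_indic/measurableC.
  by apply: measurable_maxr => //; exact: measurable_funB.
have h'0 x : (0 <= h' x)%R.
  by rewrite mulr_ge0// le_max lexx orbT.
have hD x : ~ D x -> h x = 0%R.
  move=> Dx; have := hf x; rewrite patchE memNset// lee_fin => hx.
  by apply/eqP; rewrite eq_le hx/=.
have -> : \int[mu]_x (h x)%:E = \int[mu]_(x in D) (h x)%:E.
  rewrite [RHS]integral_mkcond; apply: eq_integral => x _.
  by rewrite patchE; case: ifPn => // /negP; rewrite inE => /hD ->.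
apply: (@le_trans _ _ (\int[mu]_(x in D) ((h' x)%:E + (k x)%:E))).
  apply: ae_ge0_le_integral => //.
  - by move=> x _; rewrite lee_fin.
  - exact/measurable_EFinP.
  - by move=> x Dx; rewrite adde_ge0// lee_fin// k0.
  - by apply: emeasurable_funD; exact/measurable_EFinP.
  - exists N; split => // x /= /not_implyP[Dx]; apply: contra_notP => Nx.
    rewrite lee_fin /h' indicE mem_set// mulr1.
    by rewrite -lerBlDr le_max lexx.
rewrite ge0_integralD//; first last.
- exact/measurable_EFinP.
- exact/measurable_EFinP.
- by move=> x _; rewrite lee_fin.
apply: leeD => //; apply: le_integral_nonmeasurable => x Dx; first by rewrite lee_fin.
rewrite /h' indicE; case: (boolP (x \in ~` N)) => [/set_mem /= Nx|_]; last first.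
  by rewrite mulr0 g0.
rewrite mulr1 EFin_max; have := hf x; rewrite patchE mem_set// => hfx.
rewrite ge_max g0// andbT EFinB leeBlDr//.
by apply: le_trans hfx _; exact: fgk.
Qed.

Lemma integral_ae_nonmeasurable (f g : T -> \bar R) :
  (forall x, D x -> 0 <= f x) -> (forall x, D x -> 0 <= g x) ->
  {ae mu, forall x, D x -> f x = g x} ->
  \int[mu]_(x in D) f x = \int[mu]_(x in D) g x.
Proof.
move=> f0 g0 [N [mN N0 fgN]].
have le (p q : T -> \bar R) : (forall x, D x -> 0 <= p x) ->
    (forall x, D x -> 0 <= q x) -> (forall x, D x -> ~ N x -> p x = q x) ->
    \int[mu]_(x in D) p x <= \int[mu]_(x in D) q x.
  move=> p0 q0 pq.
  have := @le_integralD_nonmeasurable p q (fun=> 0%R) N mN N0.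
  rewrite integral0 adde0; apply => // x Dx Nx; rewrite adde0 pq//.
have fg x : D x -> ~ N x -> f x = g x.
  by move=> Dx Nx; apply: contrapT => fgx; apply: Nx; apply: fgN => /= /(_ Dx).
by apply/eqP; rewrite eq_le !le// => x Dx Nx; rewrite fg.
Qed.

(** This permits replacing a control by its truncation, or the chosen [weak_derivative] by an
    explicit one, under an integral whose integrand has not been shown to be measurable. *)
Lemma Rintegral_ae_nonmeasurable (f g : T -> R) :
  {ae mu, forall x, D x -> f x = g x} ->
  (\int[mu]_(x in D) f x = \int[mu]_(x in D) g x)%R.
Proof.
move=> fg; rewrite /Rintegral; congr fine; rewrite integralE [RHS]integralE.
congr (_ - _).
- apply: integral_ae_nonmeasurable; [by move=> ? _; exact: funepos_ge0..|].
  by apply: filterS fg => x fgx Dx; rewrite !funeposE fgx.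
- apply: integral_ae_nonmeasurable; [by move=> ? _; exact: funeneg_ge0..|].
  by apply: filterS fg => x fgx Dx; rewrite !funenegE fgx.
Qed.
End LowerIntegral.

(** * Cauchy-Schwarz inequality *)

(** For c > 0 evaluate at the minimum - b / c. For c <= 0 and b nonzero, the point - (a + 1) / b
    makes the affine part equal to - a - 2, a contradiction. *)
Lemma discriminant_le0 (R : realType) (a b c : R) : 0 <= a ->
  (forall x, 0 <= a + 2 * b * x + c * x ^+ 2) -> b ^+ 2 <= a * c.
Proof.
move=> a0 H.
have [c0|c0|c0] := ltgtP c 0.
- have [b0|b0] := eqVneq b 0.
    have := H (1 + a / (- c)); have e : c * (a / (- c)) = - a by field; lra.
    have : 0 <= a / (- c) by rewrite divr_ge0; lra.
    by rewrite b0; set y := a / _ in e *; nra.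
  have := H (- (a + 1) / b * 1).
  have -> : a + 2 * b * (- (a + 1) / b * 1) = - a - 2 by field.
  by set y := (_ / _ * 1); have := sqr_ge0 y; nra.
- have := H (- b / c); have -> : a + 2 * b * (- b / c) + c * (- b / c) ^+ 2 = a - b ^+ 2 / c.
    by field; lra.
  by rewrite subr_ge0 ler_pdivrMr.
- have [->|b0] := eqVneq b 0; first by rewrite expr0n c0 mulr0.
  have := H (- (a + 1) / b); have -> : a + 2 * b * (- (a + 1) / b) = - a - 2 by field.
  by rewrite c0 mul0r; lra.
Qed.

Section CauchySchwarz.
Context d {T : measurableType d} {R : realType} (mu : {measure set T -> \bar R}).
Variables (D : set T) (mD : measurable D).

Lemma Rintegral_sqrDZ (f g : T -> R) k : L2on mu D f -> L2on mu D g ->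
  \int[mu]_(x in D) (f x + k * g x) ^+ 2 = \int[mu]_(x in D) f x ^+ 2 +
    2 * \int[mu]_(x in D) (f x * g x) * k + \int[mu]_(x in D) g x ^+ 2 * k ^+ 2.
Proof.
move=> Lf Lg; have fg := intble_mul mD Lf Lg; case: Lf Lg => mf f2 [mg g2].
rewrite mulrAC -RintegralZl// [_ * k ^+ 2]mulrC -RintegralZl//.
rewrite -RintegralD//; last exact: intbleZ.
rewrite -RintegralD//; [|apply: intbleD => //; exact: intbleZ|exact: intbleZ].
by apply: eq_Rintegral => x _; ring.
Qed.

Lemma Rintegral_CauchySchwarz (f g : T -> R) : L2on mu D f -> L2on mu D g ->
  (\int[mu]_(x in D) (f x * g x)) ^+ 2 <=
  \int[mu]_(x in D) f x ^+ 2 * \int[mu]_(x in D) g x ^+ 2.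
Proof.
move=> Lf Lg; apply: discriminant_le0.
  by apply: Rintegral_ge0 => x _; exact: sqr_ge0.
move=> k; rewrite -Rintegral_sqrDZ//.
by apply: Rintegral_ge0 => x _; exact: sqr_ge0.
Qed.

End CauchySchwarz.

(** * Fubini for a bounded kernel times a product of functions of one variable *)

Section ProductFubini.
Context d1 d2 {T1 : measurableType d1} {T2 : measurableType d2} {R : realType}.
Variables (m1 : {sigma_finite_measure set T1 -> \bar R})
          (m2 : {sigma_finite_measure set T2 -> \bar R}).
Variables (A : set T1) (B : set T2) (c : T1 -> R) (e : T2 -> R) (u : T1 * T2 -> R) (M : R).
Hypotheses (mA : measurable A) (mB : measurable B).
Hypotheses (ci : intble m1 A c) (ei : intble m2 B e).
Hypotheses (mu : measurable_fun setT u) (uM : forall z, `|u z| <= M).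

(** Everything is extended by zero, so that the theorems of Fubini and Tonelli are applied to [phi]
    on the whole product space. *)
Let cA := c \_ A.
Let eB := e \_ B.
Let phi z := u z * (cA z.1 * eB z.2).

Let cAi : intble m1 setT cA.
Proof.
by rewrite /intble /cA -restrict_EFin; apply/integrable_restrict => //; rewrite setTI.
Qed.

Let eBi : intble m2 setT eB.
Proof.
by rewrite /intble /eB -restrict_EFin; apply/integrable_restrict => //; rewrite setTI.
Qed.

Let mphi : measurable_fun setT phi.
Proof.
apply: measurable_funM => //; apply: measurable_funM.
- by apply: (measurableT_comp (intble_measurable cAi)); exact: measurable_fst.
- by apply: (measurableT_comp (intble_measurable eBi)); exact: measurable_snd.
Qed.

Let mphi1 x : measurable_fun setT (fun y => phi (x, y)).
Proof. by apply: (measurableT_comp mphi); exact: measurable_pair1. Qed.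

Let mphi2 y : measurable_fun setT (fun x => phi (x, y)).
Proof. by apply: (measurableT_comp mphi); exact: measurable_pair2. Qed.

Let phi1i x : intble m2 setT (fun y => phi (x, y)).
Proof.
apply: (@intble_le _ _ _ _ _ measurableT _ (fun y => (M * `|cA x|) * `|eB y|)) => //.
- by move=> y _; rewrite /phi/= !normrM mulrA !ler_wpM2r.
- by apply: intbleZ => //; exact: intble_norm.
Qed.

Let phi2i y : intble m1 setT (fun x => phi (x, y)).
Proof.
apply: (@intble_le _ _ _ _ _ measurableT _ (fun x => (M * `|eB y|) * `|cA x|)) => //.
- by move=> x _; rewrite /phi/= !normrM mulrA mulrAC !ler_wpM2r.
- by apply: intbleZ => //; exact: intble_norm.
Qed.

Let phii : (m1 \x m2)%E.-integrable setT (EFin \o phi).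
Proof.
apply/integrable12ltyP; first exact/measurable_EFinP.
apply: (@le_lt_trans _ _ (\int[m1]_x ((M * \int[m2]_y `|eB y|) * `|cA x|)%:E)%E).
  apply: ge0_le_integral => //.
  - by move=> x _; apply: integral_ge0.
  - by apply: (@measurable_fun_fubini_tonelli_F _ _ _ _ _ _ (abse \o EFin \o phi)) => //=;
      do 2 apply: measurableT_comp => //.
  - apply/measurable_EFinP; apply: measurable_funM => //.
    by apply: measurableT_comp => //; exact: intble_measurable cAi.
  - move=> x _.
    have h : \int[m2]_y `|phi (x, y)| <= (M * \int[m2]_y `|eB y|) * `|cA x|.
      rewrite mulrAC -RintegralZl//; last exact: (intble_norm measurableT eBi).
      apply: le_Rintegral => //.
      + exact: (intble_norm measurableT (phi1i x)).
      + by apply: intbleZ => //; exact: intble_norm.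
      + by move=> y _; rewrite /phi/= !normrM mulrA !ler_wpM2r.
    by move: h; rewrite -lee_fin EFin_Rintegral//; exact: intble_norm.
have : intble m1 setT (fun x => (M * \int[m2]_y `|eB y|) * `|cA x|).
  by apply: intbleZ => //; exact: intble_norm.
move=> /integrableP[_]; apply: le_lt_trans; apply: ge0_le_integral => //.
- by move=> x _; rewrite lee_fin !mulr_ge0// ?(le_trans _ (uM point))// Rintegral_ge0.
- apply/measurable_EFinP; apply: measurable_funM => //.
  by apply: measurableT_comp => //; exact: intble_measurable cAi.
- apply: measurableT_comp => //; apply/measurable_EFinP; apply: measurable_funM => //.
  by apply: measurableT_comp => //; exact: intble_measurable cAi.
- by move=> x _; rewrite lee_fin ler_norm.
Qed.

Let phi1E x : \int[m2]_y phi (x, y) = cA x * \int[m2]_(y in B) (u (x, y) * e y).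
Proof.
rewrite [X in _ * X]Rintegral_mkcond.
have : intble m2 setT ((fun y => u (x, y) * e y) \_ B).
  apply: (@intble_le _ _ _ _ _ measurableT _ (fun y => M * `|eB y|)) => //.
  - rewrite (_ : _ \_ B = fun y => u (x, y) * eB y); last first.
      by apply/funext => y; rewrite /eB !patchE; case: ifP; rewrite ?mulr0.
    apply: measurable_funM; last exact: intble_measurable eBi.
    by apply: measurableT_comp => //; exact: measurable_pair1.
  - move=> y _; rewrite /eB !patchE; case: ifP => _.
      by rewrite normrM ler_wpM2r.
    by rewrite normr0 mulr0.
  - by apply: intbleZ => //; exact: intble_norm.
move=> h; rewrite -RintegralZl//; apply: eq_Rintegral => y _.
by rewrite /phi/= /eB !patchE; case: ifP => _; rewrite ?mulr0// mulrCA.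
Qed.

Let phi2E y : \int[m1]_x phi (x, y) = eB y * \int[m1]_(x in A) (u (x, y) * c x).
Proof.
rewrite [X in _ * X]Rintegral_mkcond.
have : intble m1 setT ((fun x => u (x, y) * c x) \_ A).
  apply: (@intble_le _ _ _ _ _ measurableT _ (fun x => M * `|cA x|)) => //.
  - rewrite (_ : _ \_ A = fun x => u (x, y) * cA x); last first.
      by apply/funext => x; rewrite /cA !patchE; case: ifP; rewrite ?mulr0.
    apply: measurable_funM; last exact: intble_measurable cAi.
    by apply: measurableT_comp => //; exact: measurable_pair2.
  - move=> x _; rewrite /cA !patchE; case: ifP => _.
      by rewrite normrM ler_wpM2r.
    by rewrite normr0 mulr0.
  - by apply: intbleZ => //; exact: intble_norm.
move=> h; rewrite -RintegralZl//; apply: eq_Rintegral => x _.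
rewrite /phi/= /cA !patchE; case: ifP => _; rewrite ?mul0r ?mulr0//; ring.
Qed.

Lemma intble_sectionl : intble m2 B (fun y => e y * \int[m1]_(x in A) (u (x, y) * c x)).
Proof.
rewrite /intble -(setTI B); apply/integrable_restrict => //.
have -> : (EFin \o (fun y => e y * \int[m1]_(x in A) (u (x, y) * c x))) \_ B =
    fubini_G m1 (EFin \o phi).
  apply/funext => y; rewrite /fubini_G/=.
  have := phi2i y => /EFin_Rintegral <-//; rewrite phi2E /eB !patchE.
  by case: ifP => //= _; rewrite mul0r.
have mE : measurable_fun setT (EFin \o phi) by exact/measurable_EFinP.
apply/integrableP; split; first exact: (measurable_fubini_G phii).
apply: le_lt_trans ((integrable21ltyP m1 m2 mE).1 phii).
apply: ge0_le_integral => //.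
- by apply: measurableT_comp => //; exact: (measurable_fubini_G phii).
- by apply: (@measurable_fun_fubini_tonelli_G _ _ _ _ _ _ (abse \o EFin \o phi)) => //=;
    do 2 apply: measurableT_comp => //.
- move=> y _; apply: le_abse_integral => //.
  exact/measurable_EFinP.
Qed.

Let phi_patch : phi = (fun z => u z * (c z.1 * e z.2)) \_ (A `*` B).
Proof.
apply/funext => -[x y]; rewrite /phi /cA /eB !patchE/=.
have [Ax|Ax] := boolP (x \in A); have [By|By] := boolP (y \in B).
- by rewrite mem_set//; move: Ax By; rewrite !inE.
- by rewrite memNset ?mulr0//= => -[_ /mem_set]; rewrite (negbTE By).
- by rewrite memNset ?mul0r ?mulr0//= => -[/mem_set]; rewrite (negbTE Ax).
- by rewrite memNset ?mulr0//= => -[_ /mem_set]; rewrite (negbTE By).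
Qed.

Lemma intble_section_prod :
  intble (m1 \x m2)%E (A `*` B) (fun z => u z * (c z.1 * e z.2)).
Proof. by apply/intble_patch; [exact: measurableX|rewrite -phi_patch; exact: phii]. Qed.

Lemma Rintegral_prod_sectionl :
  \int[m2]_(y in B) (e y * \int[m1]_(x in A) (u (x, y) * c x)) =
  \int[(m1 \x m2)%E]_(z in A `*` B) (u z * (c z.1 * e z.2)).
Proof.
rewrite Rintegral_mkcond [RHS]Rintegral_mkcond -phi_patch /Rintegral; congr fine.
rewrite -integral21_prod_meas1//; apply: eq_integral => y _; rewrite /fubini_G/=.
have := phi2i y => /EFin_Rintegral <-//; rewrite phi2E /eB !patchE.
by case: ifP => //= _; rewrite mul0r.
Qed.

Lemma Rintegral_prod_sectionr :
  \int[m1]_(x in A) (c x * \int[m2]_(y in B) (u (x, y) * e y)) =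
  \int[m2]_(y in B) (e y * \int[m1]_(x in A) (u (x, y) * c x)).
Proof.
rewrite Rintegral_mkcond [RHS]Rintegral_mkcond /Rintegral; congr fine.
have := Fubini phii => /=; rewrite (_ : (\int[m1]_x _)%E =
    (\int[m1]_x (((fun x => c x * \int[m2]_(y in B) (u (x, y) * e y)) \_ A) x)%:E)%E);
  last first.
  apply: eq_integral => x _; have := phi1i x => /EFin_Rintegral <-//.
  by rewrite phi1E /cA !patchE; case: ifP => //= _; rewrite mul0r.
move=> ->; apply: eq_integral => y _; have := phi2i y => /EFin_Rintegral <-//.
by rewrite phi2E /eB !patchE; case: ifP => //= _; rewrite mul0r.
Qed.

End ProductFubini.

(** * Smooth bump functions *)

Section FlatFunctions.
Variable R : realType.
Implicit Types (x c : R) (f g : R -> R) (k n : nat).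

(** The function x^-k exp (- 1 / x), extended by 0. The power is part of the family because the
    derivative of [flat k] is a combination of [flat k.+1] and [flat k.+2]: smoothness at 0 then
    follows for all orders at once. *)
Definition flat k x := if 0 < x then x^-1 ^+ k * expR (- x^-1) else 0.

Lemma flat_ge0 k x : 0 <= flat k x.
Proof. by rewrite /flat; case: ifPn => // x0; rewrite mulr_ge0 ?expR_ge0// exprn_ge0// invr_ge0 ltW. Qed.

(** From exp y >= y^(k+2) / (k+2)! at y = 1 / x. For x > 0, [flat k.+1 x] is the difference quotient
    of [flat k] at 0, so this bound gives the derivative there. *)
Lemma flat_le k x : 0 <= x -> flat k.+1 x <= (k.+2)`!%:R * x.
Proof.
rewrite /flat; case: ifPn => [x0 _|_ x0]; last by rewrite mulr_ge0.
have := @expR_ge1Dxn R x^-1 k.+1; rewrite invr_ge0 => /(_ (ltW x0)) h.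
have f0 : 0 < (k.+2)`!%:R :> R by rewrite ltr0n fact_gt0.
have {}h : x^-1 ^+ k.+2 <= (k.+2)`!%:R * expR x^-1.
  by rewrite -ler_pdivrMl// mulrC (le_trans _ h)// lerDr.
rewrite expRN ler_pdivrMr ?expR_gt0// mulrAC -ler_pdivrMr//.
by rewrite -exprSr.
Qed.

Lemma is_derive_flat k x :
  is_derive x 1 (flat k) (- k%:R * flat k.+1 x + flat k.+2 x).
Proof.
have [x0|x0|->] := ltgtP x 0.
- rewrite /flat !(ltNge 0) (ltW x0)/= mulr0 addr0.
  apply: (@near_eq_is_derive _ _ _ (cst 0)) => //.
  near=> y; rewrite /flat ltNge; suff -> : y <= 0 by [].
  by apply/ltW; near: y; exact: lt_nbhsl.
- rewrite /flat x0.
  apply: (@near_eq_is_derive _ _ _ (fun x => x^-1 ^+ k * expR (- x^-1))).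
    near=> y; rewrite /flat; suff -> : 0 < y by [].
    by near: y; exact: lt_nbhsr.
  have xn0 : x != 0 by rewrite gt_eqF.
  have dV : is_derive x 1 (fun y : R => y^-1) (- x ^- 2).
    by apply: is_derive_eq; [exact: is_deriveV|rewrite scaler1].
  have dh : is_derive x^-1 1 (fun y : R => y ^+ k * expR (- y))
      (k%:R * x^-1 ^+ k.-1 * expR (- x^-1) - x^-1 ^+ k * expR (- x^-1)).
    have d1 : is_derive x^-1 1 (fun y : R => expR (- y)) (- expR (- x^-1)).
      have h1 := is_derive_expR (- x^-1).
      have h2 : is_derive x^-1 1 (fun y => - y) (-1).
        by have := is_deriveN (is_derive_id x^-1 1).
      by have := is_derive1_comp h1 h2; rewrite mulrN1.
    have h3 := is_deriveM (is_deriveX k (is_derive_id x^-1 1)) d1.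
    rewrite exprfctE in h3.
    by apply: is_derive_eq; rewrite /GRing.scale/=; ring.
  apply: is_derive_eq; first exact: (is_derive1_comp dh dV).
  case: k {dh} => [|k]; rewrite /= ?exprS; set E := expR _; first by field.
  by set P := x^-1 ^+ k; field.
- rewrite /flat ltxx mulr0 addr0.
  have H : h^-1 *: ((flat k \o shift 0) (h *: 1) - flat k 0) @[h --> 0^'] --> (0 : R).
    apply/cvgrPdist_le => e e0; near=> h.
    rewrite /= sub0r normrN addr0 scaler1 [flat k 0]/flat ltxx subr0.
    have h0 : h != 0 by near: h; exact: nbhs_dnbhs_neq.
    have [hp|hn] := ltP 0 h; last first.
      by rewrite /flat ltNge hn/= scaler0 normr0 ltW.
    rewrite (_ : h^-1 *: flat k h = flat k.+1 h); last first.
      by rewrite /flat hp /GRing.scale/= mulrA exprS.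
    rewrite ger0_norm ?flat_ge0// (le_trans (flat_le _ (ltW hp)))//.
    have f0 : 0 < (k.+2)`!%:R :> R by rewrite ltr0n fact_gt0.
    rewrite -ler_pdivlMl// mulrC; apply/ltW; rewrite (le_lt_trans (ler_norm _))//.
    near: h; apply: dnbhs0_lt; exact: divr_gt0.
  by apply: DeriveDef; [apply/cvg_ex; exists 0|exact: cvg_lim].
Unshelve. all: by end_near. Qed.

(** A class of functions that contains the bumps and a derivative of each of its members;
    derivability to all orders becomes an induction on the order. *)
Inductive smooth_flat : (R -> R) -> Prop :=
| smooth_flatl k c : smooth_flat (fun x => flat k (x - c))
| smooth_flatr k c : smooth_flat (fun x => flat k (c - x))
| smooth_flatD f g : smooth_flat f -> smooth_flat g -> smooth_flat (fun x => f x + g x)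
| smooth_flatM f g : smooth_flat f -> smooth_flat g -> smooth_flat (fun x => f x * g x)
| smooth_flatZ r f : smooth_flat f -> smooth_flat (fun x => r * f x).

Lemma smooth_flat_derive f : smooth_flat f ->
  exists2 g, smooth_flat g & forall x, is_derive x 1 f (g x).
Proof.
elim=> {f} [k c|k c|f g sf [f' sf' ff'] sg [g' sg' gg']|
            f g sf [f' sf' ff'] sg [g' sg' gg']|r f sf [f' sf' ff']].
- exists (fun x => - k%:R * flat k.+1 (x - c) + flat k.+2 (x - c)).
    by apply: smooth_flatD; [apply: smooth_flatZ|]; exact: smooth_flatl.
  move=> x; have := is_derive_flat k (x - c) => h.
  by apply: is_derive_eq; rewrite subr0 mulr1.
- exists (fun x => -1 * (- k%:R * flat k.+1 (c - x) + flat k.+2 (c - x))).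
    by apply: smooth_flatZ; apply: smooth_flatD; [apply: smooth_flatZ|];
       exact: smooth_flatr.
  move=> x; have := is_derive_flat k (c - x) => h.
  have h2 : is_derive x 1 (fun x => c - x) (-1).
    by have := is_deriveB (is_derive_cst c x 1) (is_derive_id x 1); rewrite sub0r.
  by apply: is_derive_eq; rewrite mulrC.
- exists (fun x => f' x + g' x); first exact: smooth_flatD.
  by move=> x; exact: is_deriveD.
- exists (fun x => f x * g' x + g x * f' x).
    by apply: smooth_flatD; exact: smooth_flatM.
  by move=> x; exact: is_deriveM.
- exists (fun x => r * f' x); first exact: smooth_flatZ.
  by move=> x; exact: is_deriveZ.
Qed.

Lemma smooth_flat_derivable f n x : smooth_flat f -> derivable (derive1n n f) x 1.
Proof.
elim: n f => [|n IH] f sf.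
  by have [g _ fg] := smooth_flat_derive sf; have [] := fg x.
rewrite derive1Sn; apply: IH; have [g sg fg] := smooth_flat_derive sf.
suff -> : f^`()%classic = g by [].
by apply/funext => y; rewrite derive1E; have [_] := fg y.
Qed.

Definition bump (a e x : R) := flat 0 (x - (a - e)) * flat 0 (a + e - x).

Lemma smooth_bump a e : smooth_flat (bump a e).
Proof. by apply: smooth_flatM; [exact: smooth_flatl|exact: smooth_flatr]. Qed.

Lemma bump_ge0 a e x : 0 <= bump a e x.
Proof. by rewrite mulr_ge0// flat_ge0. Qed.

Lemma bump_eq0 a e x : e <= `|x - a| -> bump a e x = 0.
Proof.
rewrite /bump /flat ler_normr => /orP[h|h].
  by rewrite [X in _ * X]ifF ?mulr0//; apply/negbTE; rewrite -leNgt; lra.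
by rewrite ifF ?mul0r//; apply/negbTE; rewrite -leNgt; lra.
Qed.

Lemma bump_gt0 a e x : `|x - a| < e -> 0 < bump a e x.
Proof.
rewrite ltr_norml => /andP[h1 h2]; rewrite /bump /flat.
have -> : 0 < x - (a - e) by lra.
have -> : 0 < a + e - x by lra.
by rewrite !expr0 !mul1r mulr_gt0// expR_gt0.
Qed.

End FlatFunctions.

(** * Continuity and integration on intervals *)

Section EpsDelta.
Variable R : realType.
Implicit Types (a b x y e : R) (f : R -> R).

Lemma within_itvP a b f : {within `[a, b], continuous f} <->
  forall x, a <= x <= b -> forall e, 0 < e -> exists2 d : R, 0 < d &
    forall y, a <= y <= b -> `|y - x| < d -> `|f y - f x| < e.
Proof.
split=> [/subspace_continuousP cf x xab e e0|H].
  have := cf x; rewrite /= in_itv => /(_ xab)/cvgrPdist_lt /(_ e e0).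
  rewrite near_withinE => /nbhs_ballP[d /= d0 H]; exists d => // y yab yx.
  have := H y; rewrite /ball/= distrC => /(_ yx); rewrite distrC; apply.
  by rewrite in_itv.
apply/subspace_continuousP => x; rewrite /= in_itv/= => xab.
apply/cvgrPdist_lt => e e0; have [d d0 {}H] := H x xab e e0.
rewrite near_withinE; apply/nbhs_ballP; exists d => //= y yx.
by rewrite in_itv/= => yab; rewrite distrC; apply: H => //; rewrite distrC.
Qed.

(** Heine's theorem, stated for a pseudo-distance [d] between parameters so that it serves for real
    functions and for curves with values in L^2. *)
Lemma uniform_modulus (d : R -> R -> R) a b :
  (forall x y, d x y = d y x) -> (forall x y z, d x z <= d x y + d y z) ->
  (forall x, a <= x <= b -> forall e, 0 < e -> exists2 r : R, 0 < r &
     forall y, a <= y <= b -> `|y - x| < r -> d x y < e) ->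
  forall e, 0 < e -> exists2 r : R, 0 < r & forall x y, a <= x <= b -> a <= y <= b ->
    `|y - x| < r -> d x y < e.
Proof.
move=> dC dT H e e0.
have hx (x : R) : `[a, b]%classic x -> \forall x' \near x & i \near 0^'+,
    a <= x' <= b -> forall y, a <= y <= b -> `|y - x'| < i -> d x' y < e.
  rewrite /= in_itv/= => xab; have e2 : 0 < e / 2 by rewrite divr_gt0.
  have [r r0 Hr] := H x xab (e / 2) e2.
  near=> x' i => x'ab y yab yx'.
  have xx' : `|x' - x| < r / 2.
    by rewrite distrC; near: x'; apply: cvgr_dist_lt => //; exact: divr_gt0.
  have ir : i < r / 2 by near: i; apply: nbhs_right_lt; exact: divr_gt0.
  rewrite (le_lt_trans (dT x' x y))// (splitr e) ltrD// ?Hr//.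
    by rewrite dC Hr// (lt_trans xx')// gtr_pMr// invf_lt1// ltr1n.
  rewrite -(subrKA x') (le_lt_trans (ler_normD _ _))// (splitr r) ltrD//.
  exact: lt_trans ir.
have := (compact_near_coveringP _).1 (@segment_compact _ a b) R 0^'+ _ _ hx.
move=> HH; have [r [r0 Hr]] := filter_ex (filterI (nbhs_right_gt 0) (HH _)).
exists r => // x y xab yab; apply: Hr => //.
Unshelve. all: by end_near. Qed.

Lemma within_itv_unif a b f : {within `[a, b], continuous f} ->
  forall e, 0 < e -> exists2 r : R, 0 < r & forall x y, a <= x <= b -> a <= y <= b ->
    `|y - x| < r -> `|f y - f x| < e.
Proof.
move=> /within_itvP cf; apply: (@uniform_modulus (fun x y => `|f y - f x|)) => //.
- by move=> x y; rewrite distrC.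
- by move=> x y z; rewrite -(subrKA (f y)) addrC (le_trans (ler_normD _ _))// addrC.
Qed.

Lemma intble_cont a b f : {within `[a, b], continuous f} -> intble leb `]a, b[ f.
Proof.
move=> cf; rewrite /intble.
have := @continuous_compact_integrable R f _ (@segment_compact _ a b) cf.
by apply: integrableS => //; exact: subset_itv_oo_cc.
Qed.

Lemma intble_cst a b (k : R) : intble leb `]a, b[ (fun=> k).
Proof. by apply: intble_cont; apply: continuous_subspaceT => x; exact: cst_continuous. Qed.

Lemma cont_bounded a b f : {within `[a, b], continuous f} ->
  exists2 M, 0 < M & forall x, a <= x <= b -> `|f x| <= M.
Proof.
move=> cf; have [ab|ba] := leP a b; last first.
  by exists 1 => // x /andP[ax xb]; have := le_trans ax xb; rewrite leNgt ba.
have [c _ cM] := @EVT_max _ (fun x => `|f x|) _ _ ab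
   (fun x => continuous_comp (cf x) (@norm_continuous _ _ _)).
exists (`|f c| + 1); first by rewrite ltr_wpDl.
by move=> x xab; rewrite (le_trans (cM x _)) ?in_itv// lerDl.
Qed.

Lemma lebesgue_itv_lty a b : ((@lebesgue_measure R) `]a, b[ < +oo)%E.
Proof. by rewrite lebesgue_measure_itv; case: ifP => // _; rewrite -EFinB ltry. Qed.

Lemma Rintegral_cst_itv a b k : a <= b -> \int[leb]_(x in `]a, b[) k = k * (b - a).
Proof.
move=> ab; rewrite Rintegral_cst//= lebesgue_measure_itv/= lte_fin.
move: ab; rewrite le_eqVlt => /predU1P[->|->//]; by rewrite ltxx subrr.
Qed.

Lemma Rintegral_itv0 a b f : b <= a -> \int[leb]_(x in `]a, b[) f x = 0.
Proof. by move=> ba; rewrite set_itv_ge ?Rintegral_set0// bnd_simp -leNgt. Qed.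

Lemma intble_itvS (i j : interval R) f : [set` j] `<=` [set` i] ->
  intble leb [set` i] f -> intble leb [set` j] f.
Proof. by move=> ij; apply: integrableS. Qed.

Lemma Rintegral_chasles a c b f : a <= c -> c <= b -> intble leb `]a, b[ f ->
  \int[leb]_(x in `]a, b[) f x = \int[leb]_(x in `]a, c[) f x + \int[leb]_(x in `]c, b[) f x.
Proof.
move=> ac cb fi.
move: ac; rewrite le_eqVlt => /predU1P[<-|ac].
  by rewrite [X in _ = X + _]Rintegral_itv0// add0r.
move: cb; rewrite le_eqVlt => /predU1P[<-|cb].
  by rewrite [X in _ = _ + X]Rintegral_itv0// addr0.
rewrite -(@Rintegral_itvB _ f (BRight a) (BLeft b) c)//.
  rewrite -(@Rintegral_itv_bndo_bndc _ (BRight a) c f) ?subrKC//.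
  by apply: intble_itvS fi; apply: subset_itvl; rewrite bnd_simp ltW.
by rewrite bnd_simp ltW.
Qed.

Lemma intble_itv a b a' b' f : a <= a' -> b' <= b -> intble leb `]a, b[ f -> intble leb `]a', b'[ f.
Proof.
by move=> aa bb; apply: intble_itvS; apply: subset_itv; rewrite bnd_simp.
Qed.

Lemma primitive_cont a b f : a <= b -> intble leb `]a, b[ f ->
  {within `[a, b], continuous (fun x => \int[leb]_(y in `]a, x[) f y)}.
Proof.
move=> ab fi; have fi' : intble leb `[a, b] (f \_ `]a, b[).
  apply: (@intble_sub _ _ _ _ setT) => //.
  by rewrite /intble -restrict_EFin; apply/integrable_restrict => //; rewrite setTI.
have /within_itvP H := parameterized_integral_continuous ab fi'.
have E x : a <= x <= b ->
    parameterized_integral leb a x (f \_ `]a, b[) = \int[leb]_(y in `]a, x[) f y.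
  move=> /andP[ax xb]; rewrite /parameterized_integral.
  rewrite -Rintegral_itv_obnd_cbnd; last first.
    by apply: intble_itvS fi'; apply: subset_itv; rewrite bnd_simp.
  rewrite -Rintegral_itv_bndo_bndc; last first.
    by apply: intble_itvS fi'; apply: subset_itv; rewrite bnd_simp.
  apply: eq_Rintegral => y; rewrite inE/= in_itv/= => /andP[ay yx].
  by rewrite patchE mem_set//= in_itv/= ay (lt_le_trans yx).
apply/within_itvP => x xab e e0; have [d d0 Hd] := H x xab e e0.
by exists d => // y yab yx; rewrite -!E//; exact: Hd.
Qed.
End EpsDelta.

Section IntervalIntegral.
Variables (R : realType) (a b : R).
Implicit Types (f g : R -> R) (k M : R).
Local Notation ib f := (intble leb `]a, b[ f).
Local Notation I f := (\int[leb]_(x in `]a, b[) f x).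

Lemma itvD f g : ib f -> ib g -> \int[leb]_(x in `]a, b[) (f x + g x) = I f + I g.
Proof. by move=> fi gi; exact: RintegralD. Qed.

Lemma itvB f g : ib f -> ib g -> \int[leb]_(x in `]a, b[) (f x - g x) = I f - I g.
Proof. by move=> fi gi; exact: RintegralB. Qed.

Lemma itvZ f k : ib f -> \int[leb]_(x in `]a, b[) (k * f x) = k * I f.
Proof. by move=> fi; exact: RintegralZl. Qed.

Lemma itvZr f k : ib f -> \int[leb]_(x in `]a, b[) (f x * k) = I f * k.
Proof. by move=> fi; exact: RintegralZr. Qed.

Lemma itvN f : ib f -> \int[leb]_(x in `]a, b[) (- f x) = - I f.
Proof. by move=> fi; exact: RintegralN. Qed.

Lemma itv_sum (J : Type) (r : seq J) (F : J -> R -> R) : (forall j, ib (F j)) ->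
  \int[leb]_(x in `]a, b[) (\sum_(j <- r) F j x) = \sum_(j <- r) I (F j).
Proof. by move=> fi; exact: Rintegral_sum. Qed.

Lemma itv_le f g : ib f -> ib g -> (forall x, a < x < b -> f x <= g x) -> I f <= I g.
Proof.
move=> fi gi fg; apply: le_Rintegral => // x; rewrite /= in_itv/=; exact: fg.
Qed.

Lemma itv_eq f g : (forall x, a < x < b -> f x = g x) -> I f = I g.
Proof. by move=> fg; apply: eq_Rintegral => x; rewrite inE/= in_itv/=; exact: fg. Qed.

Lemma itv_norm f : ib f -> `|I f| <= \int[leb]_(x in `]a, b[) `|f x|.
Proof. by move=> fi; exact: le_normr_Rintegral. Qed.

Lemma itv_ge0 f : (forall x, a < x < b -> 0 <= f x) -> 0 <= I f.
Proof. by move=> f0; apply: Rintegral_ge0 => x; rewrite /= in_itv/=; exact: f0. Qed.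

Lemma ibD f g : ib f -> ib g -> ib (fun x => f x + g x).
Proof. by move=> fi gi; exact: intbleD. Qed.

Lemma ibB f g : ib f -> ib g -> ib (fun x => f x - g x).
Proof. by move=> fi gi; exact: intbleB. Qed.

Lemma ibZ f k : ib f -> ib (fun x => k * f x).
Proof. by move=> fi; exact: intbleZ. Qed.

Lemma ibN f : ib f -> ib (fun x => - f x).
Proof. by move=> fi; exact: intbleN. Qed.

Lemma ib_norm f : ib f -> ib (fun x => `|f x|).
Proof. by move=> fi; exact: intble_norm. Qed.

Lemma ib_sum (J : Type) (r : seq J) (F : J -> R -> R) : (forall j, ib (F j)) ->
  ib (fun x => \sum_(j <- r) F j x).
Proof. by move=> fi; exact: intble_sum. Qed.

Lemma ib_le f g : measurable_fun `]a, b[ f ->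
  (forall x, a < x < b -> `|f x| <= g x) -> ib g -> ib f.
Proof.
by move=> mf fg gi; apply: (@intble_le _ _ _ leb _ _ _ g).
Qed.

Lemma ib_eq f g : (forall x, a < x < b -> f x = g x) -> ib f -> ib g.
Proof.
by move=> fg; apply: eq_integrable => // x; rewrite inE/= in_itv/= => /fg ->.
Qed.

Lemma ib_bounded f M : measurable_fun `]a, b[ f ->
  (forall x, a < x < b -> `|f x| <= M) -> ib f.
Proof. by move=> mf fM; apply: (ib_le mf fM); exact: intble_cst. Qed.

Lemma ib_mulb f g M : measurable_fun `]a, b[ g ->
  (forall x, a < x < b -> `|g x| <= M) -> ib f -> ib (fun x => g x * f x).
Proof.
move=> mg gM fi; apply: (@ib_le _ (fun x => M * `|f x|)).
- by apply: measurable_funM => //; exact: intble_measurable fi.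
- by move=> x xab; rewrite normrM ler_wpM2r// gM.
- exact/ibZ/ib_norm.
Qed.

Lemma ib_patch f : ib f <-> intble leb setT (f \_ `]a, b[).
Proof. by have := @intble_patch _ _ R leb `]a, b[ (measurable_itv _) f. Qed.

End IntervalIntegral.

(** * Weak derivatives *)

Section WeakDerivative.
Variable R : realType.
Implicit Types (a b x y e L : R) (f g psi : R -> R).

(* Fubini on the two triangles of the square. *)
Lemma integration_by_parts_primitive L f g : 0 <= L ->
  intble leb `]0, L[ f -> intble leb `]0, L[ g ->
  \int[leb]_(x in `]0, L[) (f x * \int[leb]_(y in `]0, x[) g y) +
  \int[leb]_(y in `]0, L[) (g y * \int[leb]_(x in `]0, y[) f x) =
  (\int[leb]_(x in `]0, L[) f x) * \int[leb]_(y in `]0, L[) g y.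
Proof.
move=> L0 fi gi; pose u (z : R * R) : R := (z.2 < z.1)%R%:R.
have mu : measurable_fun setT u.
  rewrite (_ : u = \1_[set z : R * R | (z.2 < z.1)%R]); last first.
    apply/funext => z; rewrite indicE /u.
    have [h|/negP h] := boolP (z.2 < z.1)%R; first by rewrite mem_set.
    by rewrite memNset.
  apply: measurable_indic.
  have mlt : measurable_fun setT (fun z : R * R => (z.2 < z.1)%R).
    by apply: measurable_fun_ltr; [exact: measurable_snd|exact: measurable_fst].
  have := mlt measurableT [set true] I; rewrite setTI.
  by congr (measurable _); apply/seteqP; split => z.
have uM z : `|u z| <= 1 by rewrite /u; case: (_ < _); rewrite ?normr1 ?normr0.
have m := @measurable_itv R `]0, L[.
have -> : \int[leb]_(x in `]0, L[) (f x * \int[leb]_(y in `]0, x[) g y) =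
          \int[leb]_(x in `]0, L[) (f x * \int[leb]_(y in `]0, L[) (u (x, y) * g y)).
  apply: eq_Rintegral => x; rewrite inE/= in_itv/= => /andP[x0 xL]; congr (_ * _).
  rewrite -(@Rintegral_indic _ _ _ leb `]0, L[ g `]0, x[)//; last first.
    by apply: subset_itvl; rewrite bnd_simp ltW.
  apply: eq_Rintegral => y; rewrite inE/= in_itv/= => /andP[y0 yL].
  rewrite mulrC; congr (_ * _); rewrite indicE /u/=; congr (nat_of_bool _)%:R.
  by apply/idP/idP; rewrite inE/= in_itv/= y0.
rewrite (@Rintegral_prod_sectionr _ _ _ _ R leb leb _ _ _ _ _ _ m m fi gi mu uM).
have -> : \int[leb]_(y in `]0, L[) (g y * \int[leb]_(x in `]0, y[) f x) =
  \int[leb]_(y in `]0, L[) (g y * \int[leb]_(x in `]0, L[) f x) -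
  \int[leb]_(y in `]0, L[) (g y * \int[leb]_(x in `]0, L[) (u (x, y) * f x)).
  rewrite -RintegralB//; first last.
  - exact: (@intble_sectionl _ _ _ _ R leb leb _ _ _ _ _ _ m m fi gi mu uM).
  - exact: intbleZr.
  apply: eq_Rintegral => y; rewrite inE/= in_itv/= => /andP[y0 yL].
  rewrite -mulrBr; congr (_ * _).
  have yi : intble leb `]0, L[ (fun x => u (x, y) * f x).
    apply: (@ib_mulb _ _ _ _ _ 1) => //.
    by apply: measurable_funTS; apply: measurableT_comp => //; exact: pair2_measurable.
  rewrite -itvB//.
  transitivity (\int[leb]_(x in `]0, y]) f x).
    apply: Rintegral_itv_bndo_bndc; apply: intble_itvS fi.
    by apply: subset_itvl; rewrite bnd_simp ltW.
  rewrite -(@Rintegral_indic _ _ _ leb `]0, L[ f `]0, y])//; last first.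
    by apply: subset_itvl; rewrite bnd_simp.
  apply: eq_Rintegral => x; rewrite inE/= in_itv/= => /andP[x0 xL].
  rewrite indicE /u/= -{2}[f x]mul1r -mulrBl mulrC; congr (_ * _).
  case: (ltP y x) => yx; rewrite ?subr0 ?subrr.
    by rewrite memNset//= in_itv/= x0/= => xy; move: yx; rewrite ltNge xy.
  by rewrite mem_set//= in_itv/= x0.
rewrite addrC subrK; under eq_Rintegral do rewrite mulrC.
by rewrite RintegralZl.
Qed.

(** The primitive from 0 vanishes to the left of both bumps, and to the right of them because the
    mean is zero; its support is thus compact in ]0, L[. *)
Lemma bump_test_function L a b e r s : 0 < e -> 0 < a - e -> a + e < L ->
  0 < b - e -> b + e < L ->
  let beta x := r * bump a e x + s * bump b e x in
  \int[leb]_(x in `]0, L[) beta x = 0 ->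
  exists2 psi, test_function 0 L psi & derive1 psi = beta.
Proof.
move=> e0 ae aL be bL beta B0.
have L0 : 0 < L by lra.
have sb : smooth_flat beta.
  by apply: smooth_flatD; apply: smooth_flatZ; exact: smooth_bump.
have cb : continuous beta.
  move=> x; apply: differentiable_continuous; apply/derivable1_diffP.
  by have [g _ bg] := smooth_flat_derive sb; have [] := bg x.
have ib x y : leb.-integrable `[x, y] (EFin \o beta).
  apply: continuous_compact_integrable; first exact: segment_compact.
  exact: continuous_subspaceT.
pose m := Num.min (a - e) (b - e); pose M := Num.max (a + e) (b + e).
have m0 : 0 < m by rewrite lt_min ae.
have ML : M < L by rewrite gt_max aL.
have b0 x : x <= m \/ M <= x -> beta x = 0.
  rewrite le_min ge_max => -[/andP[h1 h2]|/andP[h1 h2]]; rewrite /beta !bump_eq0 ?mulr0 ?addr0//.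
  - by rewrite ler_normr; apply/orP; right; lra.
  - by rewrite ler_normr; apply/orP; right; lra.
  - by rewrite ler_normr; apply/orP; left; lra.
  - by rewrite ler_normr; apply/orP; left; lra.
pose psi x := \int[leb]_(y in `[0, x]) beta y.
have psi0 x : x <= m -> psi x = 0.
  move=> xm; transitivity (\int[leb]_(y in `[0, x]) (0 : R)); last first.
    by rewrite Rintegral_cst// mul0r.
  apply: eq_Rintegral => y; rewrite inE/= in_itv/= => /andP[_ yx]; apply: b0; left; exact: le_trans yx xm.
have psiM x : M <= x -> psi x = 0.
  have psiE y : 0 <= y -> psi y = \int[leb]_(z in `]0, y[) beta z.
    move=> y0; rewrite /psi -Rintegral_itv_obnd_cbnd; last first.
      by apply: intble_itvS (ib 0 y); apply: subset_itv; rewrite bnd_simp.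
    by rewrite -Rintegral_itv_bndo_bndc//; apply: intble_itvS (ib 0 y);
      apply: subset_itv; rewrite bnd_simp.
  have M0 : 0 <= M by rewrite le_max; apply/orP; left; lra.
  have psiM y : M <= y -> psi y = psi M.
    move=> My; rewrite !psiE ?(le_trans M0)//.
    rewrite (Rintegral_chasles M0 My); last first.
      by apply: intble_itvS (ib 0 y); apply: subset_itv; rewrite bnd_simp.
    rewrite -[RHS]addr0; congr (_ + _).
    transitivity (\int[leb]_(z in `]M, y[) (0 : R)); last first.
      by rewrite Rintegral_cst// mul0r.
    apply: eq_Rintegral => z; rewrite inE/= in_itv/= => /andP[Mz _]; apply: b0; right; exact: ltW.
  by move=> Mx; rewrite psiM// -(psiM L) ?ltW// psiE// ltW.
have dpsi x : is_derive x 1 psi (beta x).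
  have [x0|x0] := ltP 0 x.
    have x1 : x < x + 1 by lra.
    have [d1 d2] := @continuous_FTC1_closed _ beta 0 x (x + 1) x1 (ib _ _) x0 (cb x).
    by apply: DeriveDef; [exact: d1|rewrite -derive1E].
  rewrite b0; last by left; rewrite (le_trans x0)// ltW.
  apply: (@near_eq_is_derive _ _ _ (cst 0)) => //.
  near=> y; rewrite psi0//; apply/ltW; near: y; apply: lt_nbhsl.
  by rewrite (le_lt_trans x0).
have dE : psi^`()%classic = beta.
  by apply/funext => x; rewrite derive1E; have [] := dpsi x.
exists psi => //; split.
  move=> [|n] x; first by have [] := dpsi x.
  by rewrite derive1Sn dE; exact: smooth_flat_derivable.
exists (m / 2), ((M + L) / 2); split; [lra|lra|move=> x].
rewrite in_itv/= negb_and -!ltNge => /orP[xm|Mx].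
  by apply: psi0; lra.
by apply: psiM; lra.
Unshelve. all: by end_near. Qed.
(** The lemma of du Bois-Reymond. If f a > f b, test with the zero-mean combination c_b bump_a - c_a
    bump_b, where c is the mass of a bump: this gives c_a c_b (f a - f b - 2 eta) <= 0, with eta a
    third of the gap. *)
Lemma constant_of_weak L f : {within `[0, L], continuous f} ->
  (forall psi, test_function 0 L psi -> \int[leb]_(x in `]0, L[) (f x * derive1 psi x) = 0) ->
  forall a b, 0 < a < L -> 0 < b < L -> f a <= f b.
Proof.
move=> cf H a b /andP[a0 aL] /andP[b0 bL]; rewrite leNgt; apply/negP => fab.
have L0 : 0 <= L by lra.
pose eta := (f a - f b) / 3; have eta0 : 0 < eta by rewrite divr_gt0// subr_gt0.
have [d d0 Hd] := within_itv_unif cf eta0.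
(* The radius of the bumps stays below the modulus of continuity for [eta] and keeps both supports
   inside ]0, L[. *)
pose e := Num.min (d / 2) (Num.min (Num.min (a / 2) ((L - a) / 2)) (Num.min (b / 2) ((L - b) / 2))).
have e0 : 0 < e by rewrite !lt_min; repeat (apply/andP; split); lra.
have ed : e < d.
  by apply: (@le_lt_trans _ _ (d / 2)); [rewrite ge_min lexx|lra].
have [ea eLa] : e < a /\ e < L - a.
  by split; [apply: (@le_lt_trans _ _ (a / 2))|apply: (@le_lt_trans _ _ ((L - a) / 2))];
    rewrite ?ge_min ?lexx ?orbT//; lra.
have [eb eLb] : e < b /\ e < L - b.
  by split; [apply: (@le_lt_trans _ _ (b / 2))|apply: (@le_lt_trans _ _ ((L - b) / 2))];
    rewrite ?ge_min ?lexx ?orbT//; lra.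
have cbump c u v : {within `[u, v], continuous (bump c e)}.
  apply: continuous_subspaceT => x; apply: differentiable_continuous; apply/derivable1_diffP.
  by have [g _ bg] := smooth_flat_derive (smooth_bump c e); have [] := bg x.
pose c a := \int[leb]_(x in `]0, L[) bump a e x.
have ib a' : intble leb `]0, L[ (bump a' e) by exact: intble_cont.
have m := @measurable_itv R `]0, L[.
have ifb a' : intble leb `]0, L[ (fun x => f x * bump a' e x).
  by apply: intble_cont => x; apply: cvgM; [exact: cf|exact: cbump].
have c0 a' : 0 < a' -> e < a' -> e < L - a' -> 0 < c a'.
  move=> a'0 ea' eLa'; have h : a' - e / 2 <= a' + e / 2 by lra.
  have [x0 x0i x0m] := @EVT_min _ (bump a' e) _ _ h (cbump _ _ _).
  set k := bump a' e x0 in x0m.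
  have k0 : 0 < k.
    apply: bump_gt0; move: x0i; rewrite in_itv/= ltr_norml => /andP[]; lra.
  have kA : leb.-integrable `]0, L[ (EFin \o (fun x => k * \1_(`]a' - e / 2, a' + e / 2[) x)).
    by apply: intble_indic => //; exact: intble_cst.
  apply: (@lt_le_trans _ _ (\int[leb]_(x in `]0, L[) (k * \1_(`]a' - e / 2, a' + e / 2[) x))).
    rewrite (@Rintegral_indic _ _ _ leb `]0, L[ (fun=> k) `]a' - e / 2, a' + e / 2[)//; last first.
      by apply: subset_itv; rewrite bnd_simp; lra.
    by rewrite Rintegral_cst_itv//; nra.
  apply: le_Rintegral; [exact: m|exact: kA|exact: ib|move=> x _; rewrite indicE].
  have [xi|_] := boolP (_ \in _); last by rewrite mulr0 bump_ge0.
  by rewrite mulr1 x0m//; move: xi; rewrite inE => /subset_itv_oo_cc.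
have [psi tpsi dpsi] : exists2 psi, test_function 0 L psi &
    derive1 psi = (fun x => c b * bump a e x + (- c a) * bump b e x).
  apply: bump_test_function; try lra.
  rewrite itvD; [|exact/ibZ/ib|exact/ibZ/ib].
  by rewrite !itvZ// -/(c a) -/(c b) mulNr mulrC subrr.
have := H psi tpsi; rewrite dpsi.
have -> : \int[leb]_(x in `]0, L[) (f x * (c b * bump a e x + - c a * bump b e x)) =
   c b * \int[leb]_(x in `]0, L[) (f x * bump a e x) -
   c a * \int[leb]_(x in `]0, L[) (f x * bump b e x).
  rewrite -!itvZ// -itvB//; [|exact/ibZ/ifb|exact/ibZ/ifb].
  by apply: eq_Rintegral => x _; ring.
have ha : (f a - eta) * c a <= \int[leb]_(x in `]0, L[) (f x * bump a e x).
  rewrite -itvZ//; apply: itv_le; [exact/ibZ/ib|exact: ifb|].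
  move=> x /andP[x0 xL].
  have [xa|xa] := ltP `|x - a| e; last by rewrite bump_eq0// !mulr0.
  have : `|f x - f a| < eta by apply: Hd; [rewrite !ltW|rewrite !ltW|exact: lt_trans ed].
  by rewrite ltr_norml => /andP[h1 h2]; apply: ler_wpM2r; [exact: bump_ge0|lra].
have hb : \int[leb]_(x in `]0, L[) (f x * bump b e x) <= (f b + eta) * c b.
  rewrite -itvZ//; apply: itv_le; [exact: ifb|exact/ibZ/ib|].
  move=> x /andP[x0 xL].
  have [xa|xa] := ltP `|x - b| e; last by rewrite bump_eq0// !mulr0.
  have : `|f x - f b| < eta by apply: Hd; [rewrite !ltW|rewrite !ltW|exact: lt_trans ed].
  by rewrite ltr_norml => /andP[h1 h2]; apply: ler_wpM2r; [exact: bump_ge0|lra].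
move: (\int[leb]_(x in `]0, L[) (f x * bump a e x)) (\int[leb]_(x in `]0, L[) (f x * bump b e x)) ha hb.
move: (c0 a a0 ea eLa) (c0 b b0 eb eLb).
move: (c a) (c b) => ca cb ca0 cb0 A B hA hB AB.
have : cb * A >= cb * ((f a - eta) * ca) by rewrite ler_pM2l.
have : ca * B <= ca * ((f b + eta) * cb) by rewrite ler_pM2l.
have : 0 < ca * cb * eta by apply: mulr_gt0 => //; exact: mulr_gt0.
have : f a = f b + 3 * eta by rewrite /eta; field.
move=> -> h1 h2 h3; clear -AB h1 h2 h3; lra.
Qed.

Lemma test_function_continuous a b psi n : test_function a b psi ->
  continuous (derive1n n psi).
Proof.
move=> [tp _] x; apply: differentiable_continuous; apply/derivable1_diffP; exact: tp.
Qed.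

Lemma test_function_cont a b x y psi n : test_function a b psi ->
  {within `[x, y], continuous (derive1n n psi)}.
Proof. by move=> tp; apply: continuous_subspaceT; exact: test_function_continuous tp. Qed.
Arguments test_function_cont {a b} x y {psi} n _ _.

Lemma test_function_end L psi : test_function 0 L psi -> psi L = 0.
Proof.
move=> [_ [c [d [_ dL z]]]]; apply: z.
by rewrite in_itv/= negb_and -!ltNge dL orbT.
Qed.

Lemma test_function_primitive L psi x : test_function 0 L psi -> 0 <= x ->
  \int[leb]_(s in `]0, x[) derive1 psi s = psi x.
Proof.
move=> tpsi.
have p0 : psi 0 = 0.
    have [_ [c [d [c0 dL z]]]] := tpsi; apply: z.
    by rewrite in_itv/= negb_and -!ltNge c0.
  rewrite le_eqVlt => /predU1P[<-|x0]; first by rewrite Rintegral_itv0.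
  have cx : {within `[0, x], continuous (derive1 psi)}.
    exact: (test_function_cont 0 x 1 tpsi).
  have := @continuous_FTC2 _ (derive1 psi) psi 0 x x0 cx.
  rewrite p0 sube0 => FTC.
  rewrite Rintegral_itv_bndo_bndc; last exact: intble_cont cx.
  rewrite Rintegral_itv_obnd_cbnd; last first.
    rewrite -/(intble _ _ _); have := @continuous_compact_integrable R _ _ (@segment_compact _ 0 x) cx.
    by apply: intble_itvS; apply: subset_itv; rewrite bnd_simp.
  rewrite /Rintegral.
  rewrite FTC//; split.
  - by move=> y _; have [h' _] := tpsi; exact: (h' 0%N).
  - exact/cvg_at_right_filter/(test_function_continuous (n := 0) tpsi).
  - exact/cvg_at_left_filter/(test_function_continuous (n := 0) tpsi).
Qed.

(** After subtraction of the primitive of g, integration by parts shows that the weak derivative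
    vanishes; the difference is constant in the interior, and up to the ends by continuity. It is
    applied in space, and in time to integrate the state equation. *)
Lemma weak_derivative_primitive L f g : 0 < L -> {within `[0, L], continuous f} ->
  intble leb `]0, L[ g ->
  (forall psi, test_function 0 L psi ->
    \int[leb]_(x in `]0, L[) (f x * derive1 psi x) = - \int[leb]_(x in `]0, L[) (g x * psi x)) ->
  forall x, 0 <= x <= L -> f x = f 0 + \int[leb]_(y in `]0, x[) g y.
Proof.
move=> L0 cf gi H.
pose G x := \int[leb]_(y in `]0, x[) g y.
have cG : {within `[0, L], continuous G} by exact: primitive_cont (ltW L0) gi.
pose h x := f x - G x.
have ch : {within `[0, L], continuous h}.
  by move=> x; apply: cvgB; [exact: cf|exact: cG].
have m := @measurable_itv R `]0, L[.
have Hh psi : test_function 0 L psi -> \int[leb]_(x in `]0, L[) (h x * derive1 psi x) = 0.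
  move=> tpsi.
  have cp : {within `[0, L], continuous psi} by exact: (test_function_cont 0 L 0 tpsi).
  have cp' : {within `[0, L], continuous (derive1 psi)}.
    exact: (test_function_cont 0 L 1 tpsi).
  have ip' := intble_cont cp'.
  have ibp := integration_by_parts_primitive (ltW L0) ip' gi.
  have E1 : \int[leb]_(y in `]0, L[) (g y * \int[leb]_(x in `]0, y[) derive1 psi x) =
      \int[leb]_(x in `]0, L[) (g x * psi x).
    apply: eq_Rintegral => y; rewrite inE/= in_itv/= => /andP[y0 yL].
    by rewrite (test_function_primitive tpsi)// ltW.
  have psiL : \int[leb]_(y in `]0, L[) derive1 psi y = 0.
    by rewrite (test_function_primitive tpsi) ?ltW// (test_function_end tpsi).
  rewrite E1 psiL mul0r in ibp.
  have -> : \int[leb]_(x in `]0, L[) (h x * derive1 psi x) =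
    \int[leb]_(x in `]0, L[) (f x * derive1 psi x) - \int[leb]_(x in `]0, L[) (derive1 psi x * G x).
    rewrite -RintegralB//.
    - by apply: eq_Rintegral => x _; rewrite /h; ring.
    - by apply: intble_cont => x; apply: cvgM; [exact: cf|exact: cp'].
    - by apply: intble_cont => x; apply: cvgM; [exact: cp'|exact: cG].
  by rewrite H//; lra.
have hc a b : 0 < a < L -> 0 < b < L -> h a = h b.
  by move=> a0 b0; apply/eqP; rewrite eq_le !(constant_of_weak ch Hh).
have mid : 0 < L / 2 < L by lra.
have hmid x : 0 <= x <= L -> h x = h (L / 2).
  move=> /andP[x0 xL]; apply/eqP; rewrite -subr_eq0 -normr_le0 leNgt; apply/negP => n0.
  have [d d0 Hd] := within_itv_unif ch n0.
  have [y [yL yd]] : exists y, 0 < y < L /\ `|y - x| < d.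
    (* Moving x towards the midpoint by the fraction t gives an interior point at distance less than
       d, even when x is an end point. *)
    pose t := Num.min (1 / 2) (d / (2 * L)).
    have t0 : 0 < t by rewrite lt_min divr_gt0//= divr_gt0// mulr_gt0.
    have t1 : t <= 1 / 2 by rewrite ge_min lexx.
    have td : t * L <= d / 2.
      have : t <= d / (2 * L) by rewrite ge_min lexx orbT.
      by rewrite ler_pdivlMr ?mulr_gt0//; lra.
    exists (x + t * (L / 2 - x)); split; first by nra.
    by rewrite addrC addKr ltr_norml; nra.
  have := Hd y x; rewrite (distrC x) yd x0 xL !ltW//; try by case/andP: yL.
  by move=> /(_ isT isT isT); rewrite (hc _ _ yL mid) ltxx.
have G0 : G 0 = 0 by rewrite /G Rintegral_itv0.
move=> x xL; have := hmid x xL; rewrite -(hmid 0) ?lexx ?ltW// /h G0 -/(G x); lra.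
Qed.

(** By Lebesgue differentiation g is almost everywhere the derivative of its primitive, which is
    locally constant. *)
Lemma ae0_of_primitive0 L g : 0 < L -> intble leb `]0, L[ g ->
  (forall x, 0 < x < L -> \int[leb]_(y in `]0, x[) g y = 0) ->
  {ae leb, forall x : R, x \in `]0, L[ -> g x = 0}.
Proof.
move=> L0 gi H; pose h := g \_ `]0, L[.
have hi : intble leb setT h.
  exact/ib_patch.
have hy (y : R) : leb.-integrable `]-oo, y] (EFin \o h) by apply: integrableS hi.
have lh : locally_integrable [set: R] h.
  by apply: integrable_locally_restrict => //; rewrite -?itv_bnd_infty.
have [A [mA A0 HA]] := FTC1Ny hy lh.
exists A; split => // x /= /not_implyP[xL gx]; apply: HA => /= -[dx Fx].
apply: gx; move: xL; rewrite in_itv/= => /andP[x0 xL].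
have hx : h x = g x by rewrite /h patchE mem_set//= in_itv/= x0.
rewrite -hx -Fx derive1E.
rewrite (@near_eq_derive _ _ _ _ (cst 0)) ?derive_cst//.
near=> y; have y0 : 0 < y by near: y; exact: lt_nbhsr.
have yL : y < L by near: y; exact: lt_nbhsl.
rewrite /= -(H y) ?y0// /h -Rintegral_mkcondr.
rewrite [LHS](_ : _ = \int[leb]_(x in `]0, y]) g x).
  by rewrite -Rintegral_itv_bndo_bndc//; apply: intble_itv gi => //; exact: ltW.
congr (Rintegral _ _ _); apply/seteqP; split => z /=; rewrite !in_itv/=.
  by move=> [-> /andP[->]].
by move=> /andP[z0 zy]; rewrite zy z0 (le_lt_trans zy).
Unshelve. all: by end_near. Qed.

End WeakDerivative.
Arguments test_function_cont {R a b} x y {psi} n _ _.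

(** * The stationary problem on the star graph *)

Lemma L2_itvP (R : realType) (L : R) (f : R -> R) : L2_itv L f <-> L2on leb `]0, L[ f.
Proof.
have m := @measurable_itv R `]0, L[.
have E (g : R -> R) : (fun x => (g \_ `]0, L[) x ^+ 2) = (fun x => g x ^+ 2) \_ `]0, L[ :> (R -> R).
  by apply/funext => x; rewrite !patchE; case: ifP; rewrite ?expr0n.
split=> [fL|[mf f2]].
  have /andP[] := fL; rewrite !inE/= => mf _.
  split; first exact/(measurable_restrictT _ m).
  have := Lfun2_integrable_sqr fL.
  by move=> h; apply/ib_patch; rewrite -E.
apply/andP; split; rewrite inE/=; first exact/(measurable_restrictT _ m).
rewrite /finite_norm unlock poweR_lty//.
have : intble leb setT (fun x => (f \_ `]0, L[) x ^+ 2).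
  by rewrite E; apply/ib_patch.
move=> /integrable_lty => /(_ measurableT); congr (_ < _)%E.
by apply: eq_integral => x _ /=; rewrite powR_mulrn// real_normK ?num_real.
Qed.

(** * The Hilbert space L^2 of the graph *)

Section L2Graph.
Variables (R : realType) (N : nat) (l : 'I_N -> R).
Local Notation NF := (network_fun R N).
Local Notation dot := (dot_L2 l).
Implicit Types (u v w z : NF) (i j : 'I_N).

Definition inL2 v := forall i, L2on leb `]0, l i[ (v i).

Lemma L2_graphP v : L2_graph l v <-> inL2 v.
Proof. by split=> vL i; apply/L2_itvP; exact: vL. Qed.

Definition scale (a : R) v : NF := fun i x => a * v i x.

Lemma inL2D u v : inL2 u -> inL2 v -> inL2 (u + v).
Proof. by move=> uL vL i; have := @L2onD _ _ R leb _ (measurable_itv _) _ _ (uL i) (vL i). Qed.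

Lemma inL2B u v : inL2 u -> inL2 v -> inL2 (u - v).
Proof. by move=> uL vL i; have := @L2onB _ _ R leb _ (measurable_itv _) _ _ (uL i) (vL i). Qed.

Lemma inL2Z a v : inL2 v -> inL2 (scale a v).
Proof. by move=> vL i; have := @L2onZ _ _ R leb _ (measurable_itv _) _ a (vL i). Qed.

Lemma ib_mul (L : R) (f g : R -> R) : L2on leb `]0, L[ f -> L2on leb `]0, L[ g ->
  intble leb `]0, L[ (fun x => f x * g x).
Proof. by move=> fL gL; have := @intble_mul _ _ R leb _ (measurable_itv _) _ _ fL gL. Qed.

Lemma dotC v w : dot v w = dot w v.
Proof. by apply: eq_bigr => i _; apply: itv_eq => x _; rewrite mulrC. Qed.

Lemma dotDl u v w : inL2 u -> inL2 v -> inL2 w -> dot (u + v) w = dot u w + dot v w.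
Proof.
move=> uL vL wL; rewrite /dot_L2 -big_split; apply: eq_bigr => i _ /=.
rewrite -itvD; [|exact: ib_mul|exact: ib_mul].
by apply: itv_eq => x _; exact: mulrDl.
Qed.

Lemma dotBl u v w : inL2 u -> inL2 v -> inL2 w -> dot (u - v) w = dot u w - dot v w.
Proof.
move=> uL vL wL; rewrite /dot_L2 -sumrB; apply: eq_bigr => i _ /=.
rewrite -itvB; [|exact: ib_mul|exact: ib_mul].
by apply: itv_eq => x _; exact: mulrBl.
Qed.

Lemma dotZl a v w : inL2 v -> inL2 w -> dot (scale a v) w = a * dot v w.
Proof.
move=> vL wL; rewrite /dot_L2 mulr_sumr; apply: eq_bigr => i _ /=.
rewrite -itvZ; last exact: ib_mul.
by apply: itv_eq => x _; rewrite mulrA.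
Qed.

Lemma dotDr u v w : inL2 u -> inL2 v -> inL2 w -> dot w (u + v) = dot w u + dot w v.
Proof. by move=> *; rewrite dotC dotDl// !(dotC w). Qed.

Lemma dotBr u v w : inL2 u -> inL2 v -> inL2 w -> dot w (u - v) = dot w u - dot w v.
Proof. by move=> *; rewrite dotC dotBl// !(dotC w). Qed.

Lemma dotZr a v w : inL2 v -> inL2 w -> dot w (scale a v) = a * dot w v.
Proof. by move=> *; rewrite dotC dotZl// (dotC w). Qed.

Lemma dot_ge0 v : 0 <= dot v v.
Proof. by apply: sumr_ge0 => i _; apply: itv_ge0 => x _; rewrite -expr2 sqr_ge0. Qed.

Lemma dot_CauchySchwarz v w : inL2 v -> inL2 w -> dot v w ^+ 2 <= dot v v * dot w w.
Proof.
move=> vL wL; apply: discriminant_le0; first exact: dot_ge0.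
move=> k; have kL := inL2Z k wL; have := dot_ge0 (v + scale k w).
rewrite dotDl//; last exact: inL2D.
rewrite !dotDr// !dotZl// !dotZr// (dotC w v); lra.
Qed.

Definition nrm v := Num.sqrt (dot v v).

Lemma nrm_ge0 v : 0 <= nrm v. Proof. exact: sqrtr_ge0. Qed.

Lemma sqr_nrm v : nrm v ^+ 2 = dot v v.
Proof. by rewrite sqr_sqrtr// dot_ge0. Qed.

Lemma le_dot_nrm v w : inL2 v -> inL2 w -> `|dot v w| <= nrm v * nrm w.
Proof.
move=> vL wL; rewrite -sqrtrM ?dot_ge0// -sqrtr_sqr ler_wsqrtr//.
exact: dot_CauchySchwarz.
Qed.

Lemma ler_nrmD v w : inL2 v -> inL2 w -> nrm (v + w) <= nrm v + nrm w.
Proof.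
move=> vL wL; rewrite -(@ler_pXn2r _ 2)// ?nnegrE ?nrm_ge0 ?addr_ge0 ?nrm_ge0//.
rewrite sqr_nrm dotDl//; last exact: inL2D.
rewrite !dotDr// (dotC w v) sqrrD !sqr_nrm.
have := le_dot_nrm vL wL; rewrite ler_norml => /andP[_]; lra.
Qed.

Lemma nrmN v : nrm (- v) = nrm v.
Proof.
congr Num.sqrt; apply: eq_bigr => i _; apply: itv_eq => x _; exact: mulrNN.
Qed.

Lemma nrmBC v w : nrm (v - w) = nrm (w - v).
Proof. by rewrite -opprB nrmN. Qed.

Lemma ler_nrmB v w : inL2 v -> inL2 w -> nrm (v - w) <= nrm v + nrm w.
Proof.
move=> vL wL; rewrite -(nrmN w) ler_nrmD// => i.
by have := @L2onN _ _ R leb _ (measurable_itv _) _ (wL i).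
Qed.

Lemma ler_nrm_dist v w : inL2 v -> inL2 w -> `|nrm v - nrm w| <= nrm (v - w).
Proof.
move=> vL wL; rewrite ler_norml; apply/andP; split.
  have := ler_nrmD (inL2B wL vL) vL; rewrite subrK nrmBC; lra.
have := ler_nrmD (inL2B vL wL) wL; rewrite subrK; lra.
Qed.

Lemma le_edge_dot v i : \int[leb]_(x in `]0, l i[) (v i x ^+ 2) <= dot v v.
Proof.
rewrite /dot_L2 (bigD1 i)//= (_ : \int[leb]_(x in _) (v i x ^+ 2) = \int[leb]_(x in `]0, l i[) (v i x * v i x)).
  by rewrite lerDl sumr_ge0// => j _; apply: itv_ge0 => x _; rewrite -expr2 sqr_ge0.
by apply: itv_eq => x _; rewrite expr2.
Qed.

Lemma inL2_edge v i : inL2 v -> intble leb `]0, l i[ (v i).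
Proof.
move=> vL; have := @L2on_intble _ _ R leb `]0, l i[ (measurable_itv _) _ (v i) (vL i).
by apply; exact: lebesgue_itv_lty.
Qed.

Lemma L2_cont (L : R) f : {within `[0, L], continuous f} -> L2on leb `]0, L[ f.
Proof.
move=> cf; split; first exact: intble_measurable (intble_cont cf).
by apply: intble_cont => x; apply: cvgM; exact: cf.
Qed.

Lemma itv_CauchySchwarz (L a b : R) f g : L2on leb `]a, b[ f -> L2on leb `]a, b[ g ->
  (\int[leb]_(x in `]a, b[) (f x * g x)) ^+ 2 <=
  \int[leb]_(x in `]a, b[) f x ^+ 2 * \int[leb]_(x in `]a, b[) g x ^+ 2.
Proof. by move=> fL gL; apply: Rintegral_CauchySchwarz. Qed.

(** Cauchy-Schwarz against the constant 1: primitives of L^2 functions are Hoelder continuous with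
    exponent 1/2. *)
Lemma zeta_holder v i x y : inL2 v -> 0 <= x -> x <= y -> y <= l i ->
  `|\int[leb]_(s in `]x, y[) v i s| <= Num.sqrt (y - x) * nrm v.
Proof.
move=> vL x0 xy yl.
rewrite -sqrtrM ?subr_ge0// -sqrtr_sqr ler_wsqrtr//.
have vxy : L2on leb `]x, y[ (v i).
  have [mv v2] := vL i; split; last exact: intble_itv v2.
  by apply: measurable_funS mv => //; apply: subset_itv; rewrite bnd_simp.
have oxy : L2on leb `]x, y[ (fun=> 1 : R).
  split; first exact: measurable_cst.
  by apply: (@ib_eq _ _ _ (fun=> 1)) => [s _|]; [rewrite expr1n|exact: intble_cst].
have := itv_CauchySchwarz 0 oxy vxy.
rewrite (itv_eq (g := v i)); last by move=> s _; rewrite mul1r.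
rewrite (itv_eq (f := fun=> 1 ^+ 2) (g := fun=> 1 : R)); last by move=> s _; rewrite expr1n.
rewrite Rintegral_cst_itv// mul1r => /le_trans; apply.
rewrite ler_wpM2l ?subr_ge0//; apply: le_trans (le_edge_dot v i).
have [mv v2] := vL i.
have e : intble leb `]x, l i[ (fun s => v i s ^+ 2) by exact: intble_itv v2.
rewrite (Rintegral_chasles x0 (le_trans xy yl) v2) (Rintegral_chasles xy yl e).
rewrite addrCA lerDl addr_ge0//; apply: itv_ge0 => s _; exact: sqr_ge0.
Qed.

End L2Graph.

Lemma weak_derivativeP (R : realType) (L : R) (f : R -> R) : (exists w, is_weak_derivative L f w) ->
  is_weak_derivative L f (weak_derivative L f).
Proof. by move=> [w wf]; rewrite /weak_derivative; apply: (@getPex _ [set w | is_weak_derivative L f w]); exists w. Qed.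

(** The zero function has the weak derivative [w1 - w2], all of whose primitives from 0 therefore
    vanish. *)
Lemma weak_derivative_unique (R : realType) (L : R) (f w1 w2 : R -> R) : 0 < L ->
  is_weak_derivative L f w1 -> is_weak_derivative L f w2 ->
  {ae leb, forall x : R, x \in `]0, L[ -> w1 x = w2 x}.
Proof.
move=> L0 [/L2_itvP wL1 H1] [/L2_itvP wL2 H2].
have i1 : intble leb `]0, L[ w1.
  by apply: (@L2on_intble _ _ R leb); [exact: measurable_itv|exact: lebesgue_itv_lty|].
have i2 : intble leb `]0, L[ w2.
  by apply: (@L2on_intble _ _ R leb); [exact: measurable_itv|exact: lebesgue_itv_lty|].
have iB := ibB i1 i2.
have c0 : {within `[0, L], continuous (fun=> 0 : R)}.
  by apply: continuous_subspaceT => x; exact: cst_continuous.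
have := @weak_derivative_primitive _ L (fun=> 0) _ L0 c0 iB.
have hyp psi : test_function 0 L psi -> \int[leb]_(x in `]0, L[) (0 * derive1 psi x) =
    - (\int[leb]_(x in `]0, L[) ((w1 x - w2 x) * psi x)).
  move=> tpsi; have pL : L2on leb `]0, L[ psi by apply: L2_cont; exact: (test_function_cont 0 L 0 tpsi).
  have -> : \int[leb]_(x in `]0, L[) ((w1 x - w2 x) * psi x) =
    \int[leb]_(x in `]0, L[) (w1 x * psi x) - \int[leb]_(x in `]0, L[) (w2 x * psi x).
    rewrite -itvB; [|exact: ib_mul|exact: ib_mul].
    by apply: itv_eq => x _; rewrite mulrBl.
  have := H1 _ tpsi; rewrite H2// => /eqP; rewrite eqr_opp => /eqP ->.
  rewrite subrr oppr0 itvZ ?mul0r//; apply: intble_cont; exact: (test_function_cont 0 L 1 tpsi).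
move=> /(_ hyp) H.
have h : {ae leb, forall x : R, x \in `]0, L[ -> w1 x - w2 x = 0}.
  apply: ae0_of_primitive0 => // x /andP[x0 xL]; have := H x.
  by rewrite !ltW// => /(_ isT); lra.
have [A [mA A0 HA]] := h; exists A; split => // x /= nx; apply: HA => /= hx.
by apply: nx => /hx /eqP; rewrite subr_eq0 => /eqP.
Qed.

Section Elliptic.
Variables (R : realType) (N : nat) (l D : 'I_N -> R).
Hypotheses (hN : (0 < N)%N) (hl : forall i, 0 < l i) (hD : forall i, 0 < D i).
Local Notation NF := (network_fun R N).
Local Notation dot := (dot_L2 l).
Local Notation inL2 := (inL2 l).
Local Notation nrm := (nrm l).
Implicit Types (u v w z : NF) (i j : 'I_N).

Definition zeta v i x := \int[leb]_(s in `]0, x[) v i s.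
Definition flux_mean v i := (l i)^-1 * \int[leb]_(x in `]0, l i[) zeta v i x.
(** With y(0) = Y, the condition y_i(l_i) = 0 gives c_i = m_i - Y D_i / l_i, where m_i is the mean
    of int_0^x v_i over the edge; the flux condition sum_i c_i = 0 then determines Y. *)
Definition vertex_value v := (\sum_i flux_mean v i) / (\sum_i D i / l i).
Definition flux_cst v i := flux_mean v i - vertex_value v * (D i / l i).
(* [solK v] solves - D_i y_i'' = v_i with continuity and sum_i D_i y_i' = 0 at the
   vertex and y_i(l_i) = 0: integrating, D_i y_i' = c_i - int_0^x v_i, and the
   constants c_i are determined by the vertex conditions. *)
Definition solP v : NF := fun i x => (flux_cst v i - zeta v i x) / D i.
Definition solK v : NF := fun i x => vertex_value v + \int[leb]_(s in `]0, x[) solP v i s.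

Lemma edge_ge0 i : 0 <= l i. Proof. exact: ltW. Qed.
Hint Resolve edge_ge0 : core.

Lemma sum_conductance_gt0 : 0 < \sum_i D i / l i.
Proof.
case: N hN l D hl hD => // n _ l' D' hl' hD'; rewrite big_ord_recl ltr_pwDl//.
  by rewrite divr_gt0.
by apply: sumr_ge0 => i _; rewrite divr_ge0// ltW.
Qed.

Lemma zeta_cont v i : inL2 v -> {within `[0, l i], continuous (zeta v i)}.
Proof. by move=> vL; apply: primitive_cont => //; exact: inL2_edge. Qed.

Lemma zeta_int v i : inL2 v -> intble leb `]0, l i[ (zeta v i).
Proof. by move=> vL; apply: intble_cont; exact: zeta_cont. Qed.

Lemma solP_cont v i : inL2 v -> {within `[0, l i], continuous (solP v i)}.
Proof.
move=> vL x; apply: cvgM; last exact: cvg_cst.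
by apply: cvgB; [exact: cvg_cst|exact: zeta_cont].
Qed.

Lemma solP_inL2 v : inL2 v -> inL2 (solP v).
Proof. by move=> vL i; apply: L2_cont; exact: solP_cont. Qed.

Lemma solP_int v i : inL2 v -> intble leb `]0, l i[ (solP v i).
Proof. by move=> vL; apply: intble_cont; exact: solP_cont. Qed.

Lemma Rintegral_solP v i : inL2 v ->
  \int[leb]_(x in `]0, l i[) solP v i x = - vertex_value v.
Proof.
move=> vL; rewrite itvZr; last by apply: ibB; [exact: intble_cst|exact: zeta_int].
rewrite itvB; [|exact: intble_cst|exact: zeta_int].
rewrite Rintegral_cst_itv// /flux_cst /flux_mean subr0.
by field; rewrite !gt_eqF.
Qed.

Lemma sum_flux_cst v : \sum_i flux_cst v i = 0.
Proof.
rewrite sumrB -mulr_sumr /vertex_value divfK ?subrr//.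
by rewrite gt_eqF// sum_conductance_gt0.
Qed.

Lemma solK_cont v i : inL2 v -> {within `[0, l i], continuous (solK v i)}.
Proof.
move=> vL x; apply: cvgD; first exact: cvg_cst.
by apply: primitive_cont => //; exact: solP_int.
Qed.

Lemma solK0 v i : solK v i 0 = vertex_value v.
Proof. by rewrite /solK Rintegral_itv0// addr0. Qed.

Lemma solK_end v i : inL2 v -> solK v i (l i) = 0.
Proof. by move=> vL; rewrite /solK Rintegral_solP// subrr. Qed.

Lemma solK_inL2 v : inL2 v -> inL2 (solK v).
Proof. by move=> vL i; apply: L2_cont; exact: solK_cont. Qed.

Lemma solK_weak_derivative v i : inL2 v -> is_weak_derivative (l i) (solK v i) (solP v i).
Proof.
move=> vL; split; first exact/L2_itvP/solP_inL2.
move=> psi tpsi.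
have c1 : {within `[0, l i], continuous (derive1 psi)} by exact: (test_function_cont 0 (l i) 1 tpsi).
have ip := intble_cont c1.
have := integration_by_parts_primitive (edge_ge0 i) ip (solP_int i vL).
rewrite (test_function_primitive tpsi)// (test_function_end tpsi) mul0r.
have -> : \int[leb]_(y in `]0, l i[) (solP v i y * \int[leb]_(x in `]0, y[) derive1 psi x)
   = \int[leb]_(y in `]0, l i[) (solP v i y * psi y).
  by apply: itv_eq => y /andP[y0 _]; rewrite (test_function_primitive tpsi)// ltW.
have -> : \int[leb]_(x in `]0, l i[) (solK v i x * derive1 psi x) =
   vertex_value v * \int[leb]_(x in `]0, l i[) derive1 psi x +
   \int[leb]_(x in `]0, l i[) (derive1 psi x * \int[leb]_(y in `]0, x[) solP v i y).
  rewrite -itvZ// -itvD; [|exact: ibZ|].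
    by apply: itv_eq => x _; rewrite mulrDl [X in _ + X]mulrC.
  apply: ib_mul; apply: L2_cont => //.
  by apply: primitive_cont => //; exact: solP_int.
rewrite (test_function_primitive tpsi)// (test_function_end tpsi); lra.
Qed.

Lemma solK_V v : inL2 v -> V_graph l (solK v).
Proof.
move=> vL; split => [i|i|i j|i].
- split; first exact/L2_itvP/solK_inL2.
  by exists (solP v i); exact: solK_weak_derivative.
- exact: solK_cont.
- by rewrite !solK0.
- exact: solK_end.
Qed.

(** Integrate by parts, D_i P v_i being c_i minus the primitive of v_i: the terms at l_i vanish with
    z, and those at the vertex add up to - z(0) sum_i c_i = 0. The diffusion term tested with
    [solK v] thus loses all derivatives of z. *)
Lemma form_solP z v : V_graph l z -> inL2 v ->
  \sum_i D i * \int[leb]_(x in `]0, l i[) (weak_derivative (l i) (z i) x * solP v i x) = dot z v.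
Proof.
move=> [Hz cz z0 zl] vL.
pose z00 := z (Ordinal hN) 0.
have E i : D i * \int[leb]_(x in `]0, l i[) (weak_derivative (l i) (z i) x * solP v i x) =
  \int[leb]_(x in `]0, l i[) (z i x * v i x) - flux_cst v i * z00.
  have [/L2_itvP ziL hw] := Hz i; have [/L2_itvP wL Hw] := weak_derivativeP hw.
  set w := weak_derivative _ _ in wL Hw *.
  have wi : intble leb `]0, l i[ w.
    by apply: (@L2on_intble _ _ R leb); [exact: measurable_itv|exact: lebesgue_itv_lty|].
  have vi := inL2_edge i vL.
  have zE := weak_derivative_primitive (hl i) (cz i) wi Hw.
  have ibp := integration_by_parts_primitive (edge_ge0 i) wi vi.
  have E0 : z00 = z i 0 by exact: z0.
  have iwl : \int[leb]_(x in `]0, l i[) w x = - z00.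
    by have := zE (l i); rewrite zl lexx edge_ge0 E0 => /(_ isT); lra.
  have izL := L2_cont (zeta_cont (i := i) vL).
  have E1 : \int[leb]_(y in `]0, l i[) (v i y * \int[leb]_(x in `]0, y[) w x) =
    \int[leb]_(x in `]0, l i[) (z i x * v i x) - z00 * \int[leb]_(x in `]0, l i[) v i x.
    rewrite -itvZ// -itvB; [|exact: ib_mul|exact: ibZ].
    apply: itv_eq => x /andP[x0 xl]; rewrite (zE x) ?E0; last by rewrite !ltW.
    by ring.
  rewrite E1 iwl in ibp.
  have -> : \int[leb]_(x in `]0, l i[) (w x * solP v i x) =
    (flux_cst v i * \int[leb]_(x in `]0, l i[) w x - \int[leb]_(x in `]0, l i[) (w x * zeta v i x)) / D i.
    rewrite -itvZ// -itvB; [|exact: ibZ|exact: ib_mul].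
    rewrite -itvZr; last by apply: ibB; [exact: ibZ|exact: ib_mul].
    by apply: itv_eq => x _; rewrite /solP; ring.
  rewrite mulrC divfK ?gt_eqF// iwl; rewrite /zeta; lra.
rewrite (eq_bigr _ (fun i _ => E i)) sumrB -mulr_suml sum_flux_cst mul0r subr0.
by [].
Qed.

(** The same integration by parts, with [solK v] as the function that is continuous at the vertex
    and vanishes at the ends. The right-hand side is symmetric, so K is self-adjoint; for z = v it
    is the weighted squared norm of P v. *)
Lemma dot_solK z v : inL2 z -> inL2 v ->
  dot z (solK v) = \sum_i D i * \int[leb]_(x in `]0, l i[) (solP z i x * solP v i x).
Proof.
move=> zL vL.
have E i : D i * \int[leb]_(x in `]0, l i[) (solP z i x * solP v i x) =
  \int[leb]_(x in `]0, l i[) (z i x * solK v i x) - flux_cst z i * vertex_value v.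
  have zi := inL2_edge i zL; have Pi := solP_int i vL.
  have ibp := integration_by_parts_primitive (edge_ge0 i) zi Pi.
  rewrite Rintegral_solP// in ibp.
  have GL : L2on leb `]0, l i[ (fun x => \int[leb]_(y in `]0, x[) solP v i y).
    by apply/L2_cont/primitive_cont.
  have izL := L2_cont (zeta_cont (i := i) zL).
  have PL := solP_inL2 vL i.
  have -> : \int[leb]_(x in `]0, l i[) (z i x * solK v i x) =
    vertex_value v * \int[leb]_(x in `]0, l i[) z i x +
    \int[leb]_(x in `]0, l i[) (z i x * \int[leb]_(y in `]0, x[) solP v i y).
    rewrite -itvZ// -itvD; [|exact: ibZ|exact: ib_mul].
    by apply: itv_eq => x _; rewrite /solK; ring.
  have -> : \int[leb]_(x in `]0, l i[) (solP z i x * solP v i x) =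
    (flux_cst z i * \int[leb]_(x in `]0, l i[) solP v i x -
     \int[leb]_(x in `]0, l i[) (solP v i x * zeta z i x)) / D i.
    rewrite -itvZ// -itvB; [|exact: ibZ|exact: ib_mul].
    rewrite -itvZr; last by apply: ibB; [exact: ibZ|exact: ib_mul].
    by apply: itv_eq => x _; rewrite {1}/solP; ring.
  rewrite Rintegral_solP// mulrC divfK ?gt_eqF// /zeta; lra.
rewrite (eq_bigr _ (fun i _ => E i)) sumrB -mulr_suml sum_flux_cst mul0r subr0.
by [].
Qed.

End Elliptic.

(** * Bounds for the solution operator *)

Section EllipticBounds.
Variables (R : realType) (N : nat) (l D : 'I_N -> R).
Hypotheses (hN : (0 < N)%N) (hl : forall i, 0 < l i) (hD : forall i, 0 < D i).
Local Notation NF := (network_fun R N).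
Local Notation dot := (dot_L2 l).
Local Notation inL2 := (inL2 l).
Local Notation nrm := (nrm l).
Local Notation solP := (solP l D).
Local Notation solK := (solK l D).
Local Notation S := (\sum_i D i / l i).
Implicit Types (u v w z : NF) (i j : 'I_N).

(** The squared norm of v in the dual of V, for the inner product sum_i D_i int phi_i' psi_i' on V:
    [solK v] is the Riesz representative of v. *)
Definition energy v := dot v (solK v).

Lemma dot_solKC z v : inL2 z -> inL2 v -> dot z (solK v) = dot v (solK z).
Proof.
move=> zL vL; rewrite (dot_solK hN hl hD zL vL) (dot_solK hN hl hD vL zL).
apply: eq_bigr => i _; congr (_ * _).
by apply: itv_eq => x _; rewrite mulrC.
Qed.

Lemma dot_solKD z u v : inL2 z -> inL2 u -> inL2 v ->
  dot z (solK (u + v)) = dot z (solK u) + dot z (solK v).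
Proof.
move=> zL uL vL; rewrite (dot_solKC zL (inL2D uL vL)) (dot_solKC zL uL) (dot_solKC zL vL).
exact: dotDl uL vL (solK_inL2 D hl zL).
Qed.

(** A difference of two squares, factored by symmetry of the form (u, K v). An increment of the
    energy becomes one application of the equation, tested with the sum of the two values. *)
Lemma energyB u v : inL2 u -> inL2 v ->
  energy u - energy v = dot (u - v) (solK (u + v)).
Proof.
move=> uL vL; rewrite /energy (dot_solKD (inL2B uL vL) uL vL).
have Ku := solK_inL2 D hl uL; have Kv := solK_inL2 D hl vL.
rewrite (dotBl uL vL Ku) (dotBl uL vL Kv) (dot_solKC vL uL).
by move: (dot u _) (dot u _) (dot v _) => a b c; ring.
Qed.

Lemma le_min_diffusion : exists2 d : R, 0 < d & forall i, d <= D i.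
Proof.
pose s := 1 + \sum_i (D i)^-1.
have s0 i : (D i)^-1 <= s.
  rewrite /s (bigD1 i)//= addrCA lerDl addr_ge0// sumr_ge0// => j _.
  by rewrite invr_ge0 ltW.
have s1 : 0 < s.
  rewrite /s ltr_pwDl// sumr_ge0// => j _; by rewrite invr_ge0 ltW.
exists s^-1; first by rewrite invr_gt0.
by move=> i; rewrite -[leRHS]invrK lef_pV2 ?posrE ?invr_gt0.
Qed.

Lemma le_nrm_solP : exists2 c : R, 0 < c & forall v, inL2 v -> nrm (solP v) ^+ 2 <= c * energy v.
Proof.
have [d d0 dD] := le_min_diffusion; exists d^-1; first by rewrite invr_gt0.
move=> v vL; rewrite ler_pdivlMl// sqr_nrm /energy (dot_solK hN hl hD vL vL) /dot_L2 mulr_sumr.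
apply: ler_sum => i _; apply: ler_wpM2r => //.
by apply: itv_ge0 => x _; rewrite -expr2 sqr_ge0.
Qed.

Lemma energy_ge0 v : inL2 v -> 0 <= energy v.
Proof.
move=> vL; have [c c0 H] := le_nrm_solP; have := H v vL.
have := sqr_ge0 (nrm (solP v)) => h1 h2; have := le_trans h1 h2.
by rewrite pmulr_rge0.
Qed.

Lemma zetaB u v i x : inL2 u -> inL2 v -> 0 <= x <= l i ->
  zeta (u - v) i x = zeta u i x - zeta v i x.
Proof.
move=> uL vL /andP[x0 xl]; rewrite -[RHS]itvB.
- by apply: itv_eq => y _.
- by apply: intble_itv (inL2_edge i uL).
- by apply: intble_itv (inL2_edge i vL).
Qed.

Lemma flux_meanB u v i : inL2 u -> inL2 v ->
  flux_mean l (u - v) i = flux_mean l u i - flux_mean l v i.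
Proof.
move=> uL vL; rewrite /flux_mean -mulrBr -itvB; [|exact: zeta_int|exact: zeta_int].
by congr (_ * _); apply: itv_eq => x /andP[x0 xl]; rewrite zetaB// !ltW.
Qed.

Lemma vertex_valueB u v : inL2 u -> inL2 v ->
  vertex_value l D (u - v) = vertex_value l D u - vertex_value l D v.
Proof.
move=> uL vL; rewrite /vertex_value -mulrBl -sumrB; congr (_ / _).
by apply: eq_bigr => i _; rewrite flux_meanB.
Qed.

Lemma solPB u v i x : inL2 u -> inL2 v -> 0 <= x <= l i ->
  solP (u - v) i x = solP u i x - solP v i x.
Proof.
move=> uL vL xl; rewrite /solP zetaB// /flux_cst flux_meanB// vertex_valueB//; ring.
Qed.

Lemma ler_zeta v i x : inL2 v -> 0 <= x <= l i -> `|zeta v i x| <= Num.sqrt (l i) * nrm v.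
Proof.
move=> vL /andP[x0 xl]; apply: (le_trans (zeta_holder vL (lexx 0) x0 xl)).
by rewrite ler_wpM2r ?nrm_ge0// ler_wsqrtr// subr0.
Qed.

Lemma ler_flux_mean v i : inL2 v -> `|flux_mean l v i| <= Num.sqrt (l i) * nrm v.
Proof.
move=> vL; have li0 : 0 <= (l i)^-1 by rewrite invr_ge0 ltW.
rewrite /flux_mean normrM (ger0_norm li0) ler_pdivrMl//.
apply: le_trans (itv_norm (zeta_int hl i vL)) _.
rewrite mulrC -[X in _ * X]subr0 -(Rintegral_cst_itv _ (ltW (hl i))).
apply: itv_le; [exact/ib_norm/zeta_int|exact: intble_cst|].
by move=> x /andP[x0 xl]; apply: ler_zeta => //; rewrite !ltW.
Qed.

Lemma ler_solP : exists2 C : R, 0 < C &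
  forall v i x, inL2 v -> 0 <= x <= l i -> `|solP v i x| <= C * nrm v.
Proof.
pose L := \sum_i Num.sqrt (l i).
have L0 : 0 <= L by apply: sumr_ge0 => i _; exact: sqrtr_ge0.
have Li i : Num.sqrt (l i) <= L.
  by rewrite /L (bigD1 i)//= lerDl sumr_ge0// => j _; exact: sqrtr_ge0.
have S0 := sum_conductance_gt0 hN hl hD.
(* The three summands bound [flux_mean], the product of [vertex_value] with D_i / l_i, and
   [zeta]. *)
pose C i := (L + L / S * (D i / l i) + L) / D i.
have C0 i : 0 <= C i.
  rewrite /C divr_ge0 ?(ltW (hD i))// !addr_ge0// !mulr_ge0// ?invr_ge0 ?(ltW (hD i)) ?(ltW (hl i)) ?(ltW S0)//.
exists (1 + \sum_i C i); first by rewrite ltr_pwDl// sumr_ge0.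
move=> v i x vL xl; apply: (@le_trans _ _ (C i * nrm v)); last first.
  rewrite ler_wpM2r ?nrm_ge0// (bigD1 i)//= addrCA lerDl addr_ge0// sumr_ge0//.
have n0 := nrm_ge0 l v.
have Y : `|vertex_value l D v| <= L / S * nrm v.
  have S1 : 0 < S^-1 by rewrite invr_gt0.
  rewrite /vertex_value normrM (gtr0_norm S1) mulrAC (ler_pM2r S1).
  apply: le_trans (ler_norm_sum _ _ _) _; rewrite mulr_suml.
  by apply: ler_sum => j _; exact: ler_flux_mean.
have Z : `|zeta v i x| <= L * nrm v.
  by apply: le_trans (ler_zeta vL xl) _; rewrite ler_wpM2r.
have m : `|flux_mean l v i| <= L * nrm v.
  by apply: le_trans (ler_flux_mean i vL) _; rewrite ler_wpM2r.
have Dl : 0 <= D i / l i by rewrite divr_ge0// ltW.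
have D1 : 0 < (D i)^-1 by rewrite invr_gt0.
rewrite /solP normrM (gtr0_norm D1) /C mulrAC (ler_pM2r D1) !mulrDl.
apply: le_trans (ler_normB _ _) _; apply: lerD => //.
apply: le_trans (ler_normB _ _) _; apply: lerD => //.
by rewrite normrM (ger0_norm Dl) mulrAC ler_wpM2r.
Qed.

Lemma ler_nrm_bounded v (C : R) : 0 <= C -> (forall i x, 0 < x < l i -> `|v i x| <= C) ->
  (forall i, measurable_fun `]0, l i[ (v i)) -> nrm v <= C * Num.sqrt (\sum_i l i).
Proof.
move=> C0 H mv; rewrite -(@ler_pXn2r _ 2)// ?nnegrE ?nrm_ge0 ?mulr_ge0 ?sqrtr_ge0//.
rewrite sqr_nrm exprMn sqr_sqrtr; last by apply: sumr_ge0 => i _; exact: ltW.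
rewrite mulr_sumr; apply: ler_sum => i _; rewrite -[X in _ * X]subr0 -(Rintegral_cst_itv _ (ltW (hl i))).
have h x : 0 < x < l i -> v i x * v i x <= C ^+ 2.
  move=> xl; rewrite -expr2 -real_normK ?num_real// lerXn2r ?nnegrE//; exact: H.
apply: itv_le => //; last exact: intble_cst.
apply: (@ib_bounded _ _ _ _ (C ^+ 2)); first exact: measurable_funM.
by move=> x xl; rewrite ger0_norm ?h// -expr2 sqr_ge0.
Qed.

Lemma ler_nrm_solP : exists2 C : R, 0 < C & forall v, inL2 v -> nrm (solP v) <= C * nrm v.
Proof.
have [C C0 H] := ler_solP; exists (C * (Num.sqrt (\sum_i l i) + 1)).
  by rewrite mulr_gt0// ltr_wpDl// sqrtr_ge0.
move=> v vL; apply: (@le_trans _ _ (C * nrm v * Num.sqrt (\sum_i l i))).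
  apply: ler_nrm_bounded.
  - exact: mulr_ge0 (ltW C0) (nrm_ge0 _ _).
  - by move=> i x /andP[x0 xl]; apply: H => //; rewrite !ltW.
  - by move=> i; have [] := solP_inL2 D hl vL i.
by rewrite mulrAC ler_wpM2r ?nrm_ge0// ler_pM2l// lerDl.
Qed.

Lemma solP_holder v i x y : inL2 v -> 0 <= x -> x <= y -> y <= l i ->
  `|solP v i y - solP v i x| <= Num.sqrt (y - x) * nrm v / D i.
Proof.
move=> vL x0 xy yl.
have -> : solP v i y - solP v i x = - (\int[leb]_(s in `]x, y[) v i s) / D i.
  rewrite /solP -mulrBl; congr (_ / _).
  have e : intble leb `]0, y[ (v i) by exact: intble_itv (inL2_edge i vL).
  by rewrite /zeta (Rintegral_chasles x0 xy e); ring.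
have D1 : 0 < (D i)^-1 by rewrite invr_gt0.
rewrite normrM normrN (gtr0_norm D1) (ler_pM2r D1); exact: zeta_holder.
Qed.

End EllipticBounds.

(** * The state equation tested with solutions of the stationary problem *)

Section ControlForm.
Variables (R : realType) (N : nat) (l : 'I_N -> R).
Local Notation NF := (network_fun R N).
Local Notation CT := (control R N).
Local Notation dot := (dot_L2 l).
Local Notation inL2 := (inL2 l).
Local Notation nrm := (nrm l).
Implicit Types (u : CT) (a q v w : NF) (i : 'I_N) (M t T : R).

(** The bound holds everywhere rather than almost everywhere, so that the section at each fixed time
    is measurable and bounded, without exceptional times. *)
Definition bounded_control M u :=
  forall i, measurable_fun setT (u i) /\ forall z, `|u i z| <= M.

Definition advection u t a q : R :=
  \sum_i \int[leb]_(x in `]0, l i[) (u i (x, t) * (a i x * q i x)).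

Lemma bounded_control_ge0 (i : 'I_N) M u : bounded_control M u -> 0 <= M.
Proof. by move=> /(_ i)[_ /(_ (0, 0))]; exact: le_trans. Qed.

Lemma control_section M u i t : bounded_control M u ->
  measurable_fun `]0, l i[ (fun x => u i (x, t)).
Proof.
move=> /(_ i)[mu _]; apply: measurable_funTS.
by apply: (measurableT_comp mu); exact: pair2_measurable.
Qed.

Lemma advection_int M u i t a q : bounded_control M u -> inL2 a -> inL2 q ->
  intble leb `]0, l i[ (fun x => u i (x, t) * (a i x * q i x)).
Proof.
move=> uM aL qL; apply: (@ib_mulb _ _ _ _ _ M).
- exact: control_section uM.
- by move=> x _; have [_] := uM i; apply.
- exact: ib_mul.
Qed.

Lemma inL2_norm v : inL2 v -> inL2 (fun i x => `|v i x|).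
Proof. by move=> vL i; have := @L2on_norm _ _ R leb _ (v i) (vL i). Qed.

Lemma nrm_norm v : nrm (fun i x => `|v i x|) = nrm v.
Proof.
congr Num.sqrt; apply: eq_bigr => i _; apply: itv_eq => x _.
by rewrite -normrM ger0_norm// -expr2 sqr_ge0.
Qed.

Lemma ler_advection M u t a q : bounded_control M u -> inL2 a -> inL2 q ->
  `|advection u t a q| <= M * (nrm a * nrm q).
Proof.
move=> uM aL qL.
apply: (@le_trans _ _ (M * dot (fun i x => `|a i x|) (fun i x => `|q i x|))).
  apply: le_trans (ler_norm_sum _ _ _) _; rewrite /dot_L2 mulr_sumr.
  apply: ler_sum => i _.
  have aqi : intble leb `]0, l i[ (fun x => `|a i x| * `|q i x|).
    by apply: ib_mul; [exact: (inL2_norm aL i)|exact: (inL2_norm qL i)].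
  rewrite -itvZ//; apply: le_trans (itv_norm (advection_int i t uM aL qL)) _.
  apply: itv_le; [exact/ib_norm/(advection_int i t uM aL qL)|exact: ibZ|].
  by move=> x _; rewrite !normrM ler_wpM2r ?mulr_ge0//; have [_] := uM i; apply.
case: (pickP (xpredT : pred 'I_N)) => [i _|no]; last first.
  have d0 v w : dot v w = 0 by rewrite /dot_L2 big1// => i; have := no i.
  by rewrite /nrm !d0 sqrtr0 !mulr0.
have M0 := bounded_control_ge0 i uM.
rewrite ler_wpM2l// (le_trans (ler_norm _))// -(nrm_norm a) -(nrm_norm q).
by apply: le_dot_nrm; exact: inL2_norm.
Qed.

Lemma advectionBl M u t a b q : bounded_control M u -> inL2 a -> inL2 b -> inL2 q ->
  advection u t (a - b) q = advection u t a q - advection u t b q.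
Proof.
move=> uM aL bL qL; rewrite /advection -sumrB; apply: eq_bigr => i _.
rewrite -itvB; [|exact: (advection_int i t uM aL qL)|exact: (advection_int i t uM bL qL)].
by apply: itv_eq => x _; rewrite -mulrBr -mulrBl.
Qed.

Lemma advectionBr M u t a p q : bounded_control M u -> inL2 a -> inL2 p -> inL2 q ->
  advection u t a (p - q) = advection u t a p - advection u t a q.
Proof.
move=> uM aL pL qL; rewrite /advection -sumrB; apply: eq_bigr => i _.
rewrite -itvB; [|exact: (advection_int i t uM aL pL)|exact: (advection_int i t uM aL qL)].
by apply: itv_eq => x _; rewrite -mulrBr -mulrBr.
Qed.

Lemma eq_advection u t a q q' : (forall i x, 0 < x < l i -> q i x = q' i x) ->
  advection u t a q = advection u t a q'.
Proof. by move=> E; apply: eq_bigr => i _; apply: itv_eq => x xl; rewrite E. Qed.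

Lemma advectionZr M u t a q k : bounded_control M u -> inL2 a -> inL2 q ->
  advection u t a (scale k q) = k * advection u t a q.
Proof.
move=> uM aL qL; rewrite /advection mulr_sumr; apply: eq_bigr => i _.
rewrite -itvZ; last exact: (advection_int i t uM aL qL).
by apply: itv_eq => x _; rewrite /scale; ring.
Qed.

Lemma bounded_controlB M u M' u' : bounded_control M u -> bounded_control M' u' ->
  bounded_control (M + M') (fun i z => u i z - u' i z).
Proof.
move=> uM uM' i; have [mu hu] := uM i; have [mu' hu'] := uM' i; split.
  exact: measurable_funB.
by move=> z; rewrite (le_trans (ler_normB _ _))// lerD.
Qed.

Lemma advection_ctrlB M u M' u' t a q : bounded_control M u -> bounded_control M' u' ->
  inL2 a -> inL2 q ->
  advection (fun i z => u i z - u' i z) t a q = advection u t a q - advection u' t a q.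
Proof.
move=> uM uM' aL qL; rewrite /advection -sumrB; apply: eq_bigr => i _.
rewrite -itvB; [|exact: (advection_int i t uM aL qL)|exact: (advection_int i t uM' aL qL)].
by apply: itv_eq => x _; rewrite mulrBl.
Qed.

Lemma advection_edge_intble M u i s t (f : R -> R) : bounded_control M u ->
  intble leb `]0, l i[ f ->
  intble leb `]s, t[ (fun r => \int[leb]_(x in `]0, l i[) (u i (x, r) * f x)).
Proof.
move=> uM fi; have [mu hu] := uM i.
have := @intble_sectionl _ _ _ _ R leb leb `]0, l i[ `]s, t[ f (fun=> 1) (u i) M
  (measurable_itv _) (measurable_itv _) fi (intble_cst _ _ _) mu hu.
by apply: ib_eq => r _; rewrite mul1r.
Qed.

Lemma advection_intble M u s t a q : bounded_control M u -> inL2 a -> inL2 q ->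
  intble leb `]s, t[ (fun r => advection u r a q).
Proof.
move=> uM aL qL; apply: ib_sum => i; apply: (advection_edge_intble _ _ uM).
exact: ib_mul.
Qed.

Lemma advection_edge_prod M u i s t (f : R -> R) : bounded_control M u ->
  intble leb `]0, l i[ f ->
  \int[leb]_(r in `]s, t[) (\int[leb]_(x in `]0, l i[) (u i (x, r) * f x)) =
  \int[leb2]_(z in [set` `]0, l i[] `*` [set` `]s, t[]) (u i z * f z.1).
Proof.
move=> uM fi; have [mu hu] := uM i.
have := @Rintegral_prod_sectionl _ _ _ _ R leb leb `]0, l i[ `]s, t[ f (fun=> 1) (u i) M
  (measurable_itv _) (measurable_itv _) fi (intble_cst _ _ _) mu hu.
have -> : \int[leb]_(r in `]s, t[) (1 * \int[leb]_(x in `]0, l i[) (u i (x, r) * f x)) =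
  \int[leb]_(r in `]s, t[) (\int[leb]_(x in `]0, l i[) (u i (x, r) * f x)).
  by apply: itv_eq => r _; rewrite mul1r.
by move=> ->; apply: eq_Rintegral => z _; rewrite mulr1.
Qed.

End ControlForm.

(** * Measurability on the diagonal *)

Section Diagonal.
Variables (R : realType) (T : R).

(* [h t t] is the limit of [h t (s_n t)] with step functions [s_n]. *)
Lemma measurable_diagonal (h : R -> R -> R) :
  (forall s, 0 <= s <= T -> measurable_fun `]0, T[ (h ^~ s)) ->
  (forall t, 0 < t < T -> forall s, 0 <= s <= T -> forall e, 0 < e -> exists2 d : R, 0 < d &
     forall r, 0 <= r <= T -> `|r - s| < d -> `|h t r - h t s| < e) ->
  measurable_fun `]0, T[ (fun t => h t t).
Proof.
move=> mh ch.
pose c (n k : nat) : R := k%:R / n.+1%:R.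
pose K (n : nat) := (Num.truncn (T * n.+1%:R : R)).+1.
pose g (n : nat) (t : R) : R :=
  \sum_(k < K n) h t (c n k) * \1_(`[c n k, c n k.+1[%classic) t.
have [T0|T0] := leP T 0.
  by rewrite set_itv_ge ?bnd_simp -?leNgt//; exact: measurable_fun_set0.
have cT n (k : 'I_(K n)) : 0 <= c n k <= T.
  rewrite /c divr_ge0//= ler_pdivrMr//.
  have Tn : (Num.truncn (T * n.+1%:R))%:R <= T * n.+1%:R.
    by rewrite truncn_le mulr_ge0// ltW.
  by apply: le_trans Tn; rewrite ler_nat -ltnS; exact: ltn_ord.
have mg n : measurable_fun `]0, T[ (g n).
  apply: measurable_sum => k; apply: measurable_funM; first exact: mh.
  exact: measurable_indic.
have gE n t : 0 < t < T -> exists s, [/\ 0 <= s <= T, `|s - t| <= n.+1%:R^-1 & g n t = h t s].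
  move=> /andP[t0 tT].
  have tn : 0 <= t * n.+1%:R by rewrite mulr_ge0// ltW.
  have /andP[k1 k2] := truncn_itv tn; set k := Num.truncn _ in k1 k2.
  have kK : (k < K n)%N.
    by rewrite ltnS; apply: le_truncn; rewrite ler_wpM2r// ltW.
  exists (c n k); split; first exact: (cT n (Ordinal kK)).
    rewrite distrC ger0_norm; last by rewrite subr_ge0 ler_pdivrMr.
    by rewrite lerBlDl /c -[X in _ + X]mul1r -mulrDl ler_pdivlMr// natr1 ltW.
  rewrite /g (bigD1 (Ordinal kK))//= big1 ?addr0.
    by rewrite indicE mem_set ?mulr1//= in_itv/= ler_pdivrMr// k1 ltr_pdivlMr.
  move=> j /eqP jk; rewrite indicE memNset ?mulr0//= in_itv/= ler_pdivrMr// ltr_pdivlMr//.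
  move=> /andP[j1 j2]; apply: jk; apply/val_inj => /=; apply/eqP; rewrite eqn_leq.
  by rewrite -ltnS -(ltr_nat R) (le_lt_trans j1 k2)/= -ltnS -(ltr_nat R) (le_lt_trans k1 j2).
apply: (measurable_fun_cvg mg) => t; rewrite /= in_itv/= => tT.
apply/cvgrPdist_lt => e e0; have tT' : 0 <= t <= T by case/andP: tT => *; rewrite !ltW.
have [d d0 Hd] := ch t tT t tT' e e0.
near=> n; have [s [sT st ->]] := gE n t tT.
rewrite distrC; apply: Hd => //; apply: le_lt_trans st _.
near: n; exact: near_infty_natSinv_lt (PosNum d0).
Unshelve. all: by end_near. Qed.
End Diagonal.

(** * Null sets and their sections *)

Section AlmostEverywhere.
Context d (T : measurableType d) (R : realType) (mu : {measure set T -> \bar R}).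

Lemma ae_mono (P Q : T -> Prop) : (forall x, P x -> Q x) ->
  {ae mu, forall x, P x} -> {ae mu, forall x, Q x}.
Proof.
move=> PQ [A [mA A0 H]]; exists A; split => // x /= nQ.
by apply: H => /= /PQ.
Qed.

Lemma ae_and (P Q : T -> Prop) : {ae mu, forall x, P x} -> {ae mu, forall x, Q x} ->
  {ae mu, forall x, P x /\ Q x}.
Proof.
move=> [A [mA A0 HA]] [B [mB B0 HB]]; exists (A `|` B); split.
- exact: measurableU.
- by rewrite measureU0.
- move=> x /= /not_andP[nP|nQ]; [left; exact: HA|right; exact: HB].
Qed.

Lemma ae_all n (P : 'I_n -> T -> Prop) : (forall i, {ae mu, forall x, P i x}) ->
  {ae mu, forall x, forall i, P i x}.
Proof.
elim: n P => [|n IH] P H.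
  exists set0; split; [exact: measurable0|exact: measure0|].
  by move=> x /= H0; apply: H0; case.
have := ae_and (H ord0) (IH _ (fun i => H (lift ord0 i))).
apply: ae_mono => x [h0 hS] i; have [j ->|->//] := unliftP ord0 i.
exact: hS.
Qed.

End AlmostEverywhere.

Section ProductNull.
Context d1 d2 (T1 : measurableType d1) (T2 : measurableType d2) (R : realType).
Variables (m1 : {sigma_finite_measure set T1 -> \bar R})
          (m2 : {sigma_finite_measure set T2 -> \bar R}).

(** By Tonelli, the measures of the sections of a null set have zero integral, hence vanish for
    almost every section. *)
Lemma ae_prod_section (P : T1 * T2 -> Prop) : {ae (m1 \x m2)%E, forall z, P z} ->
  {ae m2, forall y, {ae m1, forall x, P (x, y)}}.
Proof.
move=> [A [mA A0 HA]].
have mi : measurable_fun setT (EFin \o \1_A : T1 * T2 -> \bar R).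
  by apply/measurable_EFinP; exact: measurable_indic.
have i0 (z : T1 * T2) : (0 <= (EFin \o (\1_A : T1 * T2 -> R)) z)%E by rewrite lee_fin.
pose F y := (\int[m1]_x (\1_A (x, y))%:E)%E.
have mF : measurable_fun setT F.
  by apply: (@measurable_fun_fubini_tonelli_G _ _ _ _ _ m1 (EFin \o \1_A)).
have IF0 : (\int[m2]_y F y = 0)%E.
  rewrite -(@fubini_tonelli2 _ _ _ _ _ m1 m2 (EFin \o \1_A) mi i0)/=.
  by rewrite integral_indic// setIT.
have F0 y : (0 <= F y)%E by apply: integral_ge0.
have : ae_eq m2 setT F (cst 0%E).
  apply/(ae_eq_integral_abs m2 measurableT mF).
  by rewrite -IF0; apply: eq_integral => y _; rewrite gee0_abs.
apply: ae_mono => y /(_ I) Fy; exists (ysection A y); split.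
- exact: measurable_ysection.
- have {}Fy : F y = 0%E by exact: Fy.
  rewrite -Fy /F -(setIT (ysection A y)) -integral_indic//; last exact: measurable_ysection.
  by apply: eq_integral => x _; rewrite !indicE mem_ysection.
- by move=> x /= nP; rewrite /ysection/= inE; exact: HA.
Qed.

End ProductNull.

(** * Continuous curves in L^2 *)

Section ContinuousL2.
Variables (R : realType) (N : nat) (l : 'I_N -> R) (T : R).
Hypothesis T0 : 0 < T.
Local Notation NF := (network_fun R N).
Local Notation dot := (dot_L2 l).
Local Notation inL2 := (inL2 l).
Local Notation nrm := (nrm l).
Implicit Types (rho z : R -> NF) (v w : NF).

(** Continuity is recorded in its uniform form, available by compactness of [0, T], since one
    modulus has to serve all cells of a grid. *)
Definition contL2 rho := (forall t, 0 <= t <= T -> inL2 (rho t)) /\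
  forall e : R, 0 < e -> exists2 d : R, 0 < d & forall s t, 0 <= s <= T -> 0 <= t <= T ->
    `|t - s| < d -> nrm (rho t - rho s) < e.

Lemma sqnorm_L2E v : inL2 v -> sqnorm_L2 l v = (nrm v ^+ 2)%:E.
Proof.
move=> vL; rewrite sqr_nrm /dot_L2 -sumEFin; apply: eq_bigr => i _.
have [_ v2] := vL i; by rewrite -EFin_Rintegral//.
Qed.

Lemma continuous_L2P rho : continuous_L2 l T rho -> contL2 rho.
Proof.
move=> [rL rc]; have rL' t : 0 <= t <= T -> inL2 (rho t).
  by move=> tT; apply/L2_graphP/rL; rewrite in_itv.
split => // e e0.
(* Clamping the time to [0, T] makes the distance satisfy the triangle inequality for all real
   arguments, as [uniform_modulus] asks. *)
pose c t := Num.max 0 (Num.min t T).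
have cT t : 0 <= c t <= T.
  by rewrite /c le_max lexx/= ge_max (ltW T0)/= ge_min lexx orbT.
have cE t : 0 <= t <= T -> c t = t.
  by move=> /andP[t0 tT]; rewrite /c min_l// max_r.
have [] := @uniform_modulus R (fun x y => nrm (rho (c x) - rho (c y))) 0 T _ _ _ e e0.
- by move=> x y; rewrite nrmBC.
- move=> x y z; rewrite -(subrKA (rho (c y))); apply: ler_nrmD;
   apply: inL2B; exact: rL'.
- move=> x xT e' e'0; have := rc x; rewrite in_itv/= => /(_ xT).
  move=> /fine_cvgP[].
  move=> h1 /cvgrPdist_lt /(_ (e' ^+ 2) (exprn_gt0 2 e'0)) h2.
  have H : \forall y \near x, y \in `[0, T] ->
      sqnorm_L2 l (rho y - rho x) \is a fin_num /\
      `|0 - fine (sqnorm_L2 l (rho y - rho x))| < e' ^+ 2 by exact: filterI h1 h2.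
  move: H => /nbhs_ballP[d /= d0 Hd].
  exists d => // y yT yx; have := Hd y; rewrite /ball/= distrC => /(_ yx).
  rewrite in_itv/= => /(_ yT)[_].
  rewrite sqnorm_L2E; last by apply: inL2B; exact: rL'.
  rewrite /= sub0r normrN ger0_norm ?sqr_ge0// ltr_pXn2r// ?nnegrE ?nrm_ge0 ?ltW//.
  by rewrite !cE// nrmBC.
move=> d d0 Hd; exists d => // s t sT tT st; rewrite nrmBC.
by have := Hd s t sT tT st; rewrite !cE.
Qed.

Lemma contL2_dot rho v : contL2 rho -> inL2 v ->
  {within `[0, T], continuous (fun t => dot (rho t) v)}.
Proof.
move=> [rL rc] vL; apply/within_itvP => x xT e e0.
have v0 : 0 < nrm v + 1 by rewrite ltr_wpDl// nrm_ge0.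
have [d d0 Hd] := rc (e / (nrm v + 1)) (divr_gt0 e0 v0).
exists d => // y yT yx; rewrite -(dotBl (rL _ yT) (rL _ xT) vL).
apply: le_lt_trans (le_dot_nrm (inL2B (rL _ yT) (rL _ xT)) vL) _.
apply: (@le_lt_trans _ _ (nrm (rho y - rho x) * (nrm v + 1))).
  by rewrite ler_wpM2l ?nrm_ge0// lerDl.
by rewrite -ltr_pdivlMr//; exact: Hd.
Qed.

Lemma contL2_nrm rho : contL2 rho -> {within `[0, T], continuous (fun t => nrm (rho t))}.
Proof.
move=> [rL rc]; apply/within_itvP => x xT e e0; have [d d0 Hd] := rc e e0.
exists d => // y yT yx; apply: le_lt_trans (ler_nrm_dist (rL _ yT) (rL _ xT)) _.
exact: Hd.
Qed.

Lemma contL2_bounded rho : contL2 rho -> exists2 B, 0 < B & forall t, 0 <= t <= T -> nrm (rho t) <= B.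
Proof.
move=> /contL2_nrm /cont_bounded[B B0 H]; exists B => // t tT.
by apply: le_trans (H t tT); exact: ler_norm.
Qed.

Lemma contL2B rho z : contL2 rho -> contL2 z -> contL2 (fun t => rho t - z t).
Proof.
move=> [rL rc] [zL zc]; split => [t tT|e e0]; first exact: inL2B (rL t tT) (zL t tT).
have e2 : 0 < e / 2 by rewrite divr_gt0.
have [d d0 Hd] := rc _ e2; have [d' d'0 Hd'] := zc _ e2.
exists (Num.min d d'); first by rewrite lt_min d0.
move=> s t sT tT; rewrite lt_min => /andP[h1 h2].
have -> : rho t - z t - (rho s - z s) = (rho t - rho s) - (z t - z s).
  by rewrite !opprB [X in _ + X]addrC addrACA [X in _ + X]addrC.
apply: le_lt_trans (ler_nrmB (inL2B (rL _ tT) (rL _ sT)) (inL2B (zL _ tT) (zL _ sT))) _.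
by rewrite (splitr e); apply: ltrD; [exact: Hd|exact: Hd'].
Qed.

Lemma contL2_cst v : inL2 v -> contL2 (fun=> v).
Proof.
move=> vL; split => // e e0; exists 1 => // s t _ _ _; rewrite subrr.
rewrite /nrm /dot_L2 big1 ?sqrtr0// => i _.
by rewrite (itv_eq (g := fun=> 0 * 0))//; rewrite itvZ ?mul0r//; exact: intble_cst.
Qed.

End ContinuousL2.

(** * The state equation integrated in time *)

Section MildFormulation.
Variables (R : realType) (N : nat) (l D : 'I_N -> R) (T : R).
Hypotheses (hN : (0 < N)%N) (hl : forall i, 0 < l i) (hD : forall i, 0 < D i).
Hypothesis T0 : 0 < T.
Local Notation NF := (network_fun R N).
Local Notation CT := (control R N).
Local Notation dot := (dot_L2 l).
Local Notation inL2 := (inL2 l).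
Local Notation nrm := (nrm l).
Local Notation solP := (solP l D).
Local Notation solK := (solK l D).
Local Notation advection := (advection l).
Implicit Types (rho z : R -> NF) (v w : NF) (u : CT).

(* For [M] an essential bound of [u], a representative of [u] on the cylinders that
   is measurable and bounded everywhere. *)
Definition truncate (M : R) u : CT := fun i p =>
  Num.max (- M) (Num.min M ((u i \_ (cylinder l T i)) p)).

Lemma truncate_bounded M u : 0 <= M -> Linfty l T u -> bounded_control M (truncate M u).
Proof.
move=> M0 uL i; split.
  apply: measurable_maxr; first exact: measurable_cst.
  apply: measurable_minr; first exact: measurable_cst.
  by have /andP[] := uL i; rewrite !inE.
move=> z; rewrite /truncate ler_norml le_max lexx/= ge_max ge_min lexx/= andbT.
by rewrite (le_trans _ M0)// oppr_le0.
Qed.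

Lemma truncateE M u i p : cylinder l T i p -> `|u i p| <= M -> truncate M u i p = u i p.
Proof.
by move=> cz; rewrite ler_norml /truncate patchE mem_set// => /andP[h1 h2]; rewrite min_r// max_r.
Qed.

(** With two separate times, the expression is measurable in the time of the control and continuous
    in the time of the two curves; [measurable_diagonal] then identifies the times. *)
Lemma advection_diag_measurable M u rho z : bounded_control M u -> contL2 l T rho ->
  contL2 l T z -> measurable_fun `]0, T[ (fun r => advection u r (rho r) (solP (z r))).
Proof.
move=> uM cr cz; have [rL rc] := cr; have [zL zc] := cz.
apply: (@measurable_diagonal R T (fun r s => advection u r (rho s) (solP (z s)))).
  move=> s sT; apply: (@intble_measurable _ _ R leb).
  exact: (advection_intble _ _ uM (rL s sT) (solP_inL2 D hl (zL s sT))).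
move=> t tT s sT e e0.
have [C C0 HC] := ler_nrm_solP hN hl hD.
have [B B0 HB] := contL2_bounded cr; have [B' B'0 HB'] := contL2_bounded cz.
have M0 : 0 <= M by exact: bounded_control_ge0 (Ordinal hN) _ _ uM.
(* M C (B + B') is the Lipschitz constant with respect to L^2 increments of [rho] and [z]; adding 1
   makes it positive and the final inequality strict. *)
pose Q := M * C * (B + B') + 1.
have Q0 : 0 < Q by rewrite ltr_wpDl// !mulr_ge0// ?addr_ge0// ltW.
have [d d0 Hd] := rc _ (divr_gt0 e0 Q0); have [d' d'0 Hd'] := zc _ (divr_gt0 e0 Q0).
exists (Num.min d d'); first by rewrite lt_min d0.
move=> r rT; rewrite lt_min => /andP[/(Hd s r sT rT) h1 /(Hd' s r sT rT) h2].
have Ps := solP_inL2 D hl (zL s sT); have Pr := solP_inL2 D hl (zL r rT).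
have rs := inL2B (rL r rT) (rL s sT); have zs := inL2B (zL r rT) (zL s sT).
have Pz := solP_inL2 D hl zs.
have -> : advection u t (rho r) (solP (z r)) - advection u t (rho s) (solP (z s)) =
   advection u t (rho r - rho s) (solP (z r)) + advection u t (rho s) (solP (z r - z s)).
  rewrite (advectionBl t uM (rL r rT) (rL s sT) Pr).
  rewrite (@eq_advection _ _ _ u t (rho s) (solP (z r - z s)) (solP (z r) - solP (z s))); last first.
    move=> i x /andP[x0 xl]; have xl' : 0 <= x <= l i by rewrite !ltW.
    exact: (solPB D hl (zL r rT) (zL s sT) xl').
  by rewrite (advectionBr t uM (rL s sT) Pr Ps) addrA subrK.
apply: le_lt_trans (ler_normD _ _) _.
have a1 := ler_advection t uM rs Pr; have a2 := ler_advection t uM (rL s sT) Pz.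
have p1 := HC _ (zL r rT); have p2 := HC _ zs; have b1 := HB s sT; have b2 := HB' r rT.
have n1 := nrm_ge0 l (rho r - rho s); have n2 := nrm_ge0 l (z r - z s).
have n3 := nrm_ge0 l (rho s); have n4 := nrm_ge0 l (z r).
have n5 := nrm_ge0 l (solP (z r)); have n6 := nrm_ge0 l (solP (z r - z s)).
apply: (@le_lt_trans _ _ (M * C * (B + B') * (e / Q))); last first.
  rewrite mulrA ltr_pdivrMr// mulrC ltr_pM2l// /Q ltrDl//.
apply: le_trans (lerD a1 a2) _.
have k1 : nrm (rho r - rho s) * nrm (solP (z r)) <= (e / Q) * (C * B').
  apply: ler_pM => //; first exact: ltW.
  by apply: le_trans p1 _; rewrite ler_pM2l.
have k2 : nrm (rho s) * nrm (solP (z r - z s)) <= B * (C * (e / Q)).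
  apply: ler_pM => //; apply: le_trans p2 _; rewrite ler_pM2l//; exact: ltW.
have -> : M * C * (B + B') * (e / Q) = M * (e / Q * (C * B') + B * (C * (e / Q))).
  by move: (e / Q) => q; ring.
by rewrite -mulrDr ler_wpM2l// lerD.
Qed.

Lemma advection_diag_intble M u rho z : bounded_control M u -> contL2 l T rho ->
  contL2 l T z -> intble leb `]0, T[ (fun r => advection u r (rho r) (solP (z r))).
Proof.
move=> uM cr cz; have [C C0 HC] := ler_nrm_solP hN hl hD.
have [B B0 HB] := contL2_bounded cr; have [B' B'0 HB'] := contL2_bounded cz.
have [rL rc] := cr; have [zL zc] := cz.
have M0 : 0 <= M by exact: bounded_control_ge0 (Ordinal hN) _ _ uM.
apply: (@ib_bounded _ _ _ _ (M * (B * (C * B')))).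
  exact: advection_diag_measurable uM cr cz.
move=> r /andP[r0 rT]; have rT' : 0 <= r <= T by rewrite !ltW.
apply: le_trans (ler_advection r uM (rL r rT') (solP_inL2 D hl (zL r rT'))) _.
rewrite ler_wpM2l// ler_pM ?nrm_ge0// ?HB//.
by apply: le_trans (HC _ (zL r rT')) _; rewrite ler_pM2l// HB'.
Qed.

(* The weak formulation integrated in time, for the test functions [solK v]: the
   diffusion term becomes an L^2 product, and no derivative of [rho] is left. *)
Definition mild_solution u rho := contL2 l T rho /\
  forall v s t, inL2 v -> 0 <= s -> s <= t -> t <= T ->
    dot (rho t - rho s) (solK v) =
    - \int[leb]_(r in `]s, t[) (dot (rho r) v + advection u r (rho r) (solP v)).

(** Here [u'] is the control of the equation and [u] a bounded one, equal to it almost everywhere in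
    space at time r. The control and the derivative of [solK v] are replaced on null sets, and
    [form_solP] removes the derivative of rho. *)
Lemma form_solK u M rho r v : bounded_control M u -> inL2 v -> V_graph l (rho r) -> inL2 (rho r) ->
  forall u', (forall i, {ae leb, forall x : R, x \in `]0, l i[ -> u' i (x, r) = u i (x, r)}) ->
  form_F l D u' r (rho r) (solK v) = dot (rho r) v + advection u r (rho r) (solP v).
Proof.
move=> uM vL rV rL u' uu'.
rewrite -(form_solP hN hl hD rV vL) /advection -big_split /form_F; apply: eq_bigr => i _.
have PL := solP_inL2 D hl vL i.
have [Hz _ _ _] := rV; have [_ hw] := Hz i; have [/L2_itvP wL Hw] := weak_derivativeP hw.
have KV : is_weak_derivative (l i) (solK v i) (weak_derivative (l i) (solK v i)).
  by apply: weak_derivativeP; exists (solP v i); exact: solK_weak_derivative.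
have Kae := weak_derivative_unique (hl i) KV (solK_weak_derivative D hl i vL).
have aui := advection_int i r uM rL (solP_inL2 D hl vL).
have wi := ib_mul wL PL.
rewrite [RHS](_ : _ = \int[leb]_(x in `]0, l i[)
    ((D i * weak_derivative (l i) (rho r i) x + u i (x, r) * rho r i x) * solP v i x)).
  apply: Rintegral_ae_nonmeasurable; first exact: measurable_itv.
  have := ae_and Kae (uu' i); apply: ae_mono => x [h1 h2] xl.
  by rewrite h1// h2.
rewrite /= -itvZ// -itvD//; last exact: ibZ.
by apply: itv_eq => x _; ring.
Qed.

(** For fixed v, the continuous function t |-> (rho t, K v) has the weak derivative [- g] on ]0, T[,
    hence it is a primitive of [- g]. *)
Lemma weak_solution_mild (rho0 : NF) u rho (M : R) : 0 <= M -> Linfty l T u ->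
  (forall i, {ae leb2, forall z : R * R, z \in cylinder l T i -> `|u i z| <= M}) ->
  weak_solution l T D rho0 u rho -> mild_solution (truncate M u) rho.
Proof.
move=> M0 uL uM [[[VA _ _] _ rc] _ H].
have cr := continuous_L2P T0 rc; have [rL _] := cr.
have tM := truncate_bounded M0 uL.
split => // v s t vL s0 st tT.
have tests psi := H (solK v) psi (solK_V hl hD vL).
pose g r := dot (rho r) v + advection (truncate M u) r (rho r) (solP v).
have gi : intble leb `]0, T[ g.
  apply: ibD; first by apply: intble_cont; exact: contL2_dot.
  exact: (advection_diag_intble tM cr (contL2_cst T vL)).
have KL := solK_inL2 D hl vL.
have cf := contL2_dot cr KL.
(* Null sets of the cylinder have null sections: at almost every time the control and its truncation
   agree almost everywhere in space. *)
have au : {ae leb, forall r : R, forall i, {ae leb, forall x : R,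
    x \in `]0, l i[ -> r \in `]0, T[ -> truncate M u i (x, r) = u i (x, r)}}.
  apply: ae_all => i.
  have h : {ae leb2, forall p : R * R, p.1 \in `]0, l i[ -> p.2 \in `]0, T[ ->
      truncate M u i p = u i p}.
    have := uM i; apply: ae_mono => -[x r] h xl rT.
    have cyl : cylinder l T i (x, r) by split.
    by rewrite truncateE// h// mem_set.
  exact: (ae_prod_section h).
have fg : {ae leb, forall r : R, `]0, T[%classic r -> form_F l D u r (rho r) (solK v) = g r}.
  have := ae_and VA au; apply: ae_mono => r [h1 h2] rT.
  have rT' : 0 <= r <= T by move: rT; rewrite /= in_itv/= => /andP[h3 h4]; rewrite !ltW.
  rewrite (form_solK tM vL (h1 rT) (rL r rT'))//.
  by move=> i; have := h2 i; apply: ae_mono => x h /h <-.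
have ng := ibN gi.
have := weak_derivative_primitive T0 cf ng.
have hyp psi : test_function 0 T psi ->
    \int[leb]_(x in `]0, T[) (dot (rho x) (solK v) * derive1 psi x) =
    - (\int[leb]_(x in `]0, T[) (- g x * psi x)).
  move=> tpsi; have := tests psi tpsi.
  have -> : \int[leb]_(r in `]0, T[) (form_F l D u r (rho r) (solK v) * psi r) =
            \int[leb]_(r in `]0, T[) (g r * psi r).
    apply: Rintegral_ae_nonmeasurable; first exact: measurable_itv.
    by move: fg; apply: ae_mono => r h rT; rewrite h.
  have -> : \int[leb]_(x in `]0, T[) (- g x * psi x) = - \int[leb]_(x in `]0, T[) (g x * psi x).
    rewrite -itvN; first by apply: itv_eq => x _; rewrite mulNr.
    have cp : {within `[0, T], continuous psi} by exact: (test_function_cont 0 T 0 tpsi).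
    have [B B0 HB] := cont_bounded cp.
    apply: (@ib_eq _ _ _ (fun x => psi x * g x)); first by move=> x _; rewrite mulrC.
    apply: (@ib_mulb _ _ _ _ _ B) => //.
      by have := intble_measurable (intble_cont cp).
    by move=> x /andP[x0 xT]; apply: HB; rewrite !ltW.
  by lra.
move=> /(_ hyp) E.
rewrite (dotBl (rL t _) (rL s _) KL) ?tT ?s0 ?(le_trans s0 st) ?(le_trans st tT)//.
rewrite (E t) ?tT ?(le_trans s0 st)// (E s) ?s0 ?(le_trans st tT)//.
have gt : intble leb `]0, t[ (fun x => - g x) by apply: intble_itv ng.
rewrite (Rintegral_chasles s0 st gt) -itvN; last by apply: intble_itv gi.
by rewrite addrA [X in X - _]addrC addrK.
Qed.

End MildFormulation.

(** * Energy estimates *)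

Section ScalarLemmas.
Variables (R : realType) (T : R).
Hypothesis T0 : 0 < T.

(** Cutting [0, t] into equal steps shorter than d and summing the increments bounds |f t - f 0| by
    e t / (T + 1), for every e. *)
Lemma zero_variation (f : R -> R) :
  (forall e : R, 0 < e -> exists2 d : R, 0 < d & forall s t, 0 <= s -> s <= t -> t <= T ->
     t - s < d -> `|f t - f s| <= e * (t - s)) ->
  forall t, 0 <= t <= T -> f t = f 0.
Proof.
move=> H t /andP[t0 tT]; apply/eqP; rewrite -subr_eq0 -normr_le0.
apply/ler_addgt0Pr => e e0; rewrite add0r.
have T1 : 0 < T + 1 by lra.
have [d d0 Hd] := H (e / (T + 1)) (divr_gt0 e0 T1).
have [n ] : exists n : nat, t / n.+1%:R < d.
  exists (Num.truncn (t / d)); rewrite ltr_pdivrMr// mulrC -ltr_pdivrMr//.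
  exact: truncnS_gt.
set h := t / n.+1%:R => hd.
have h0 : 0 <= h by rewrite divr_ge0.
have hn : h * n.+1%:R = t by rewrite divfK.
have step (k : nat) : (k <= n.+1)%N -> `|f (h * k%:R) - f 0| <= e / (T + 1) * (h * k%:R).
  elim: k => [|k IH] kn; first by rewrite mulr0 subrr normr0 mulr0.
  have kh : h * k.+1%:R <= T.
    by apply: le_trans tT; rewrite -hn ler_wpM2l// ler_nat.
  have e1 : h * k.+1%:R - h * k%:R = h by rewrite -mulrBr -natrB// subSnn mulr1.
  have := Hd (h * k%:R) (h * k.+1%:R); rewrite e1 hd kh mulr_ge0// => /(_ isT _ isT isT).
  rewrite -subr_ge0 e1 h0 => /(_ isT) a1; have a2 := IH (ltnW kn).
  rewrite -(subrKA (f (h * k%:R))) (le_trans (ler_normD _ _))//.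
  apply: le_trans (lerD a1 a2) _.
  by rewrite -mulrDr ler_wpM2l ?divr_ge0 ?(ltW e0) ?(ltW T1)// -[in leRHS]natr1 mulrDr mulr1 addrC.
have := step n.+1 (leqnn _); rewrite hn => /le_trans; apply.
by rewrite mulrAC ler_pdivrMr// ler_pM2l//; lra.
Qed.

Lemma integral_exp (mu t : R) : 0 < mu -> 0 <= t ->
  \int[leb]_(r in `]0, t[) expR (mu * r) = (expR (mu * t) - 1) / mu.
Proof.
move=> mu0; rewrite le_eqVlt => /predU1P[<-|t0].
  by rewrite Rintegral_itv0// mulr0 expR0 subrr mul0r.
pose F r : R := expR (mu * r) / mu.
have dF (x : R) : is_derive x 1 F (expR (mu * x)).
  have h1 := is_derive_expR (mu * x).
  have h2 : is_derive x 1 (fun y => mu * y) mu.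
    by have := is_deriveZ mu (is_derive_id x 1); rewrite /GRing.scale/= mulr1.
  have h3 := is_derive1_comp h1 h2.
  have h4 : is_derive x 1 F (mu^-1 * (expR (mu * x) * mu)).
    rewrite (_ : F = mu^-1 \*: (expR \o (fun y => mu * y))); first exact: is_deriveZ.
    by apply/funext => y; rewrite /F mulrC.
  by move: h4; rewrite mulrCA mulVf ?mulr1// gt_eqF.
have cF : continuous F.
  move=> x; apply: differentiable_continuous; apply/derivable1_diffP.
  by have [] := dF x.
have cf : {within `[0, t], continuous (fun r => expR (mu * r))}.
  apply: continuous_subspaceT => x; apply: continuous_comp; last exact: continuous_expR.
  by apply: cvgM; [exact: cvg_cst|exact: cvg_id].
rewrite Rintegral_itv_bndo_bndc; last exact: intble_cont cf.
rewrite Rintegral_itv_obnd_cbnd; last first.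
  have := @continuous_compact_integrable R _ _ (@segment_compact _ 0 t) cf.
  by apply: intble_itvS; apply: subset_itv; rewrite bnd_simp.
have := @continuous_FTC2 _ _ F 0 t t0 cf.
rewrite /Rintegral => ->.
- by rewrite /F mulr0 expR0 -EFinB/= -mulrBl.
- split.
  + by move=> y _; have [] := dF y.
  + exact/cvg_at_right_filter/cF.
  + exact/cvg_at_left_filter/cF.
- by move=> x _; rewrite derive1E; have [] := dF x.
Qed.

(** At a maximum point of m t exp (- 2 lam t), the weighted integral term is at most half the
    maximum. This explains the rate 2 lam and the factor 2. *)
Lemma gronwall (m : R -> R) (K lam : R) : 0 < lam -> 0 <= K ->
  {within `[0, T], continuous m} -> (forall t, 0 <= t <= T -> 0 <= m t) ->
  (forall t, 0 <= t <= T -> m t <= K + lam * \int[leb]_(r in `]0, t[) m r) ->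
  forall t, 0 <= t <= T -> m t <= 2 * K * expR (2 * lam * T).
Proof.
move=> lam0 K0 cm m0 H.
pose f t := m t * expR (- (2 * lam * t)).
have ce : continuous (fun t => expR (- (2 * lam * t))).
  move=> x; apply: continuous_comp; last exact: continuous_expR.
  by apply: continuousN; apply: cvgM; [exact: cvg_cst|exact: cvg_id].
have cf : {within `[0, T], continuous f}.
  move=> x; apply: cvgM; first exact: cm.
  exact: (continuous_subspaceT ce).
have [s + smax] := @EVT_max _ f _ _ (ltW T0) cf; rewrite in_itv/= => sT.
have fE t : m t = f t * expR (2 * lam * t).
  by rewrite /f -mulrA -expRD addNr expR0 mulr1.
have fs : f s <= 2 * K.
  have /andP[s0 sT'] := sT.
  have i1 : intble leb `]0, s[ m by apply: intble_itv (intble_cont cm).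
  have i5 : intble leb `]0, s[ (fun r => expR (2 * lam * r)).
    apply/intble_cont; apply: continuous_subspaceT => x.
    apply: continuous_comp; last exact: continuous_expR.
    by apply: cvgM; [exact: cvg_cst|exact: cvg_id].
  have i2 : intble leb `]0, s[ (fun r => f s * expR (2 * lam * r)) by exact: ibZ.
  have i3 : \int[leb]_(r in `]0, s[) m r <= \int[leb]_(r in `]0, s[) (f s * expR (2 * lam * r)).
    apply: itv_le => // x /andP[x0 xs]; rewrite fE ler_wpM2r ?expR_ge0// smax//.
    by rewrite in_itv/= !ltW// (lt_le_trans xs).
  have fs0 : 0 <= f s by rewrite mulr_ge0 ?expR_ge0// m0.
  have l2 : 0 < 2 * lam by lra.
  have := H s sT; rewrite {1}fE.
  rewrite itvZ// in i3.
  rewrite integral_exp// in i3.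
  have e1 : 1 <= expR (2 * lam * s) by rewrite -[leLHS]expR0 ler_expR; exact: (mulr_ge0 (ltW l2) s0).
  move: (expR (2 * lam * s)) e1 i3 => q q1; move: (\int[leb]_(r in _) m r) (f s) fs0 => I g g0 i3 i4.
  have : lam * I <= lam * (g * ((q - 1) / (2 * lam))) by rewrite ler_pM2l.
  have -> : lam * (g * ((q - 1) / (2 * lam))) = g * (q - 1) / 2 by field; lra.
  by move=> i6; nra.
move=> t tT; rewrite fE; have /andP[t0 tT'] := tT.
apply: ler_pM; rewrite ?expR_ge0//; first by rewrite mulr_ge0 ?expR_ge0// m0.
  by apply: le_trans fs; apply: smax; rewrite in_itv.
by rewrite ler_expR ler_pM2l//; lra.
Qed.

End ScalarLemmas.

(** * The energy identity *)

Section Energy.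
Variables (R : realType) (N : nat) (l D : 'I_N -> R) (T : R).
Hypotheses (hN : (0 < N)%N) (hl : forall i, 0 < l i) (hD : forall i, 0 < D i).
Hypothesis T0 : 0 < T.
Local Notation NF := (network_fun R N).
Local Notation dot := (dot_L2 l).
Local Notation inL2 := (inL2 l).
Local Notation nrm := (nrm l).
Local Notation solP := (solP l D).
Local Notation solK := (solK l D).
Local Notation energy := (energy l D).
Implicit Types (rho z : R -> NF) (v w : NF).

(* The difference of the two sides has increments [o(t - s)], by the equation tested
   with [v = z t + z s], hence is constant. *)
Lemma energy_identity z (B : R -> NF -> R) (beta : R) : contL2 l T z -> 0 <= beta ->
  (forall v, inL2 v -> intble leb `]0, T[ (B ^~ v)) ->
  intble leb `]0, T[ (fun r => B r (z r)) ->
  (forall (r : R) v, 0 < r < T -> inL2 v -> B r (scale 2 v) = 2 * B r v) ->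
  (forall (r : R) v w, 0 < r < T -> inL2 v -> inL2 w -> `|B r v - B r w| <= beta * nrm (v - w)) ->
  (forall v (s t : R), inL2 v -> 0 <= s -> s <= t -> t <= T ->
    dot (z t - z s) (solK v) = - \int[leb]_(r in `]s, t[) (dot (z r) v + B r v)) ->
  forall t : R, 0 <= t <= T -> energy (z t) = energy (z 0) -
    \int[leb]_(r in `]0, t[) (2 * (nrm (z r) ^+ 2 + B r (z r))).
Proof.
move=> cz b0 iB iBz BZ BL H.
have [zL zc] := cz; have [Bz Bz0 HBz] := contL2_bounded cz.
pose h r := 2 * (nrm (z r) ^+ 2 + B r (z r)).
have cn := contL2_nrm cz.
have hi : intble leb `]0, T[ h.
  apply/ibZ/ibD => //; apply: intble_cont => x.
  by rewrite (_ : (fun r => nrm (z r) ^+ 2) = fun r => nrm (z r) * nrm (z r))//; apply: cvgM; exact: cn.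
pose f t := energy (z t) + \int[leb]_(r in `]0, t[) h r.
suff E t : 0 <= t <= T -> f t = f 0.
  have f0 : f 0 = energy (z 0) by rewrite -[RHS]addr0; congr (_ + _); exact: Rintegral_itv0.
  by move=> t tT; rewrite -f0 -(E t tT); exact: (esym (addrK _ _)).
apply: zero_variation => // e e0.
have Q0 : 0 < 2 * (Bz + beta) by rewrite mulr_gt0// ltr_pwDl.
have [d d0 Hd] := zc _ (divr_gt0 e0 Q0); exists d => // s r s0 sr rT srd.
have s'T : 0 <= s <= T by rewrite s0 (le_trans sr).
have r'T : 0 <= r <= T by rewrite rT (le_trans s0).
have vL := inL2D (zL r r'T) (zL s s'T); set v := z r + z s in vL.
have h0r : intble leb `]0, r[ h by apply: intble_itv hi.
have hsr : intble leb `]s, r[ h by apply: intble_itv hi.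
have gsr : intble leb `]s, r[ (fun q => dot (z q) v + B q v).
  apply: (@intble_itv _ 0 T) => //; apply: ibD; last exact: iB.
  by apply: intble_cont; exact: contL2_dot.
have -> : f r - f s = \int[leb]_(q in `]s, r[) (h q - (dot (z q) v + B q v)).
  rewrite itvB// /f (Rintegral_chasles s0 sr h0r).
  have := energyB hN hl hD (zL r r'T) (zL s s'T); rewrite -/v (H v s r vL s0 sr rT).
  have alg (a b c k j : R) : a - b = - j -> a + (c + k) - (b + c) = k - j by lra.
  exact: alg.
apply: le_trans (itv_norm (ibB hsr gsr)) _.
rewrite -(Rintegral_cst_itv _ sr); apply: itv_le => //.
- exact/ib_norm/ibB.
- exact: intble_cst.
move=> q /andP[sq qr].
have qT : 0 <= q <= T by rewrite (le_trans s0 (ltW sq)) (le_trans (ltW qr) rT).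
have qT' : 0 < q < T by rewrite (le_lt_trans s0 sq) (lt_le_trans qr rT).
have zq := zL q qT; have z2 := inL2Z 2 zq.
(* [h q] is the integrand of the equation for the test function 2 z q, so the defect is controlled
   by the distance from 2 z q to v = z r + z s, small by continuity. *)
have -> : h q - (dot (z q) v + B q v) = dot (z q) (scale 2 (z q) - v) + (B q (scale 2 (z q)) - B q v).
  rewrite (dotBr z2 vL zq) (dotZr 2 zq zq) (BZ q _ qT' zq) /h sqr_nrm.
  by move: (dot _ _) (dot _ _) (B _ _) (B _ _) => a b c k; ring.
have dv : nrm (scale 2 (z q) - v) <= 2 * (e / (2 * (Bz + beta))).
  have -> : scale 2 (z q) - v = (z q - z r) + (z q - z s).
    apply/funext => i; apply/funext => x.
    by change (2 * z q i x - (z r i x + z s i x) = z q i x - z r i x + (z q i x - z s i x)); ring.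
  apply: le_trans (ler_nrmD (inL2B zq (zL r r'T)) (inL2B zq (zL s s'T))) _.
  rewrite mulr2n mulrDl mul1r; apply: lerD; apply/ltW.
    by apply: Hd => //; rewrite ltr_norml; lra.
  by apply: Hd => //; rewrite ltr_norml; lra.
apply: le_trans (ler_normD _ _) _.
apply: (@le_trans _ _ ((Bz + beta) * nrm (scale 2 (z q) - v))).
  rewrite mulrDl; apply: lerD; last exact: BL.
  apply: le_trans (le_dot_nrm zq (inL2B z2 vL)) _.
  by rewrite ler_wpM2r ?nrm_ge0// HBz.
apply: (@le_trans _ _ ((Bz + beta) * (2 * (e / (2 * (Bz + beta)))))).
  by rewrite ler_pM2l// ltr_pwDl.
have : Bz + beta != 0 by rewrite gt_eqF// ltr_pwDl.
by move: (Bz + beta) => p p0; rewrite le_eqVlt; apply/orP; left; apply/eqP; field.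
Qed.

End Energy.

Section Arithmetic.
Variable R : realFieldType.

Lemma le_sqr_sum (p a b : R) : 0 <= a -> 0 <= b -> p ^+ 2 <= 4 * (a * b) -> p <= a + b.
Proof.
move=> a0 b0 h; rewrite leNgt; apply/negP => ab.
have p0 : 0 <= p by rewrite (le_trans _ (ltW ab))// addr_ge0.
have : (a + b) ^+ 2 < p ^+ 2 by rewrite ltr_sqr ?nnegrE// addr_ge0.
have := sqr_ge0 (a - b); rewrite sqrrB sqrrD !mulr2n; lra.
Qed.

Lemma cell_constant (m c k x y z : R) : 0 <= m -> 0 <= c -> 0 <= k ->
  0 <= x -> 0 <= y -> 0 <= z ->
  m * (c * x) + m * (y + k * z) <= (1 + m * (c + 1 + k)) * (x + (y + z)).
Proof.
move=> m0 c0 k0 x0 y0 z0.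
have h1 := mulr_ge0 m0 x0; have h2 := mulr_ge0 m0 y0; have h3 := mulr_ge0 m0 z0.
have h4 := mulr_ge0 c0 h2; have h5 := mulr_ge0 c0 h3.
have h6 := mulr_ge0 k0 h1; have h7 := mulr_ge0 k0 h2.
by lra.
Qed.

End Arithmetic.

(** * Estimates for the difference of two states *)

Section PerturbedEquation.
Variables (R : realType) (N : nat) (l D : 'I_N -> R) (T : R).
Hypotheses (hN : (0 < N)%N) (hl : forall i, 0 < l i) (hD : forall i, 0 < D i).
Hypothesis T0 : 0 < T.
Local Notation NF := (network_fun R N).
Local Notation CT := (control R N).
Local Notation dot := (dot_L2 l).
Local Notation inL2 := (inL2 l).
Local Notation nrm := (nrm l).
Local Notation solP := (solP l D).
Local Notation solK := (solK l D).
Local Notation energy := (energy l D).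
Local Notation advection := (advection l).
Local Notation contL2 := (contL2 l T).
Implicit Types (rho z : R -> NF) (v : NF) (u w : CT).

(** This covers a single state, with w = 0, and the difference of two states, because u rho - u'
    rho' = u (rho - rho') + (u - u') rho'. *)
Definition perturbed_solution u w rho z := contL2 z /\
  forall v (s t : R), inL2 v -> 0 <= s -> s <= t -> t <= T ->
    dot (z t - z s) (solK v) = - \int[leb]_(r in `]s, t[)
      (dot (z r) v + (advection u r (z r) (solP v) + advection w r (rho r) (solP v))).

Lemma mild_perturbed u rho : mild_solution l D T u rho ->
  perturbed_solution u (fun _ _ => 0) rho rho.
Proof.
move=> [cr H]; split=> // v s t vL s0 st tT; rewrite H//; congr (- _).
apply: itv_eq => r _; congr (_ + _).
rewrite [X in _ = _ + X]big1 ?addr0// => i _.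
by rewrite (@itv_eq _ _ _ _ (fun=> 0)) ?itvZ ?Rintegral_cst0// => [|x _]; rewrite ?mul0r// /Rintegral integral0_eq.
Qed.

Lemma mild_difference M u (u' : CT) rho (rho' : R -> NF) : bounded_control M u -> bounded_control M u' ->
  mild_solution l D T u rho -> mild_solution l D T u' rho' ->
  perturbed_solution u (fun i p => u i p - u' i p) rho' (fun t => rho t - rho' t).
Proof.
move=> uM uM' [cr H] [cr' H']; split; first exact: contL2B.
have [rL _] := cr; have [rL' _] := cr'.
move=> v s t vL s0 st tT.
have sT : 0 <= s <= T by rewrite s0 (le_trans st).
have tT' : 0 <= t <= T by rewrite tT (le_trans s0).
have KL := solK_inL2 D hl vL; have PL := solP_inL2 D hl vL.
have i1 u0 (r0 : R -> NF) : bounded_control M u0 -> contL2 r0 ->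
    intble leb `]s, t[ (fun r => dot (r0 r) v + advection u0 r (r0 r) (solP v)).
  move=> uM0 c0; apply: (@intble_itv _ 0 T) => //; apply: ibD.
    by apply: intble_cont; exact: contL2_dot.
  exact: (advection_diag_intble hN hl hD uM0 c0 (contL2_cst T vL)).
have -> : rho t - rho' t - (rho s - rho' s) = (rho t - rho s) - (rho' t - rho' s).
  by rewrite !opprB [LHS]addrACA [RHS]addrACA [- rho' t + _]addrC.
rewrite (dotBl (inL2B (rL t tT') (rL s sT)) (inL2B (rL' t tT') (rL' s sT)) KL) H// H'//.
have alg (a b c : R) : a - b = c -> - a - - b = - c by lra.
apply: alg; rewrite -itvB; [|exact: i1|exact: i1].
apply: itv_eq => r /andP[sr rt].
have rT : 0 <= r <= T by rewrite (le_trans s0 (ltW sr)) (le_trans (ltW rt) tT).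
rewrite (dotBl (rL r rT) (rL' r rT) vL) (advectionBl r uM (rL r rT) (rL' r rT) PL).
rewrite (advection_ctrlB r uM uM' (rL' r rT) PL).
by move: (dot _ _) (dot _ _) (advection _ _ _ _) (advection _ _ _ _) (advection _ _ _ _) => a b c d e; ring.
Qed.

Lemma perturbed_energy M M' u w rho z : bounded_control M u -> bounded_control M' w ->
  contL2 rho -> perturbed_solution u w rho z ->
  forall t : R, 0 <= t <= T -> energy (z t) = energy (z 0) -
    \int[leb]_(r in `]0, t[) (2 * (nrm (z r) ^+ 2 +
       (advection u r (z r) (solP (z r)) + advection w r (rho r) (solP (z r))))).
Proof.
move=> uM wM cr [cz H].
have [C C0 HC] := ler_nrm_solP hN hl hD.
have [rL rc] := cr; have [zL zc] := cz.
have [B B0 HB] := contL2_bounded cr; have [B' B'0 HB'] := contL2_bounded cz.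
have i0 : 'I_N by exact: (Ordinal hN).
have M0 := bounded_control_ge0 i0 uM; have M0' := bounded_control_ge0 i0 wM.
have := @energy_identity R N l D T hN hl hD z
  (fun r v => advection u r (z r) (solP v) + advection w r (rho r) (solP v))
  ((M * B' + M' * B) * C) cz; apply => //.
- by apply: mulr_ge0; [apply: addr_ge0; apply: mulr_ge0; rewrite // ltW|exact: ltW].
- move=> v vL; apply: ibD.
    exact: (advection_diag_intble hN hl hD uM cz (contL2_cst T vL)).
  exact: (advection_diag_intble hN hl hD wM cr (contL2_cst T vL)).
- by apply: ibD; [exact: (advection_diag_intble hN hl hD uM cz)|exact: (advection_diag_intble hN hl hD wM cr)].
- move=> r v /andP[r0 rT] vL; have rT' : 0 <= r <= T by rewrite !ltW.
  have PL := solP_inL2 D hl vL.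
  have e a w0 : advection w0 r a (solP (scale 2 v)) = advection w0 r a (scale 2 (solP v)).
    apply: eq_advection => i x /andP[x0 xl].
    (* Homogeneity of [solP] is deduced from [solPB], by writing the double as a difference. *)
    have -> : scale 2 v = v - (- v).
      by apply/funext => j; apply/funext => y; change (2 * v j y = v j y - - v j y); ring.
    have vL' : inL2 (- v) by have := inL2Z (-1) vL; rewrite (_ : scale (-1) v = - v)//; 
      apply/funext => j; apply/funext => y; exact: mulN1r.
    rewrite (solPB D hl vL vL') ?ltW//.
    have -> : solP (- v) i x = solP (0 - v) i x by rewrite sub0r.
    have z0L : inL2 (0 : NF) by rewrite -(subrr v); exact: inL2B.
    rewrite (solPB D hl z0L vL) ?ltW// -{1}(subrr v) (solPB D hl vL vL) ?ltW//.
    change (solP v i x - (solP v i x - solP v i x - solP v i x) = 2 * solP v i x).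
    by move: (solP v i x) => a0; ring.
  by rewrite !e (advectionZr r 2 uM (zL r rT') PL) (advectionZr r 2 wM (rL r rT') PL) mulrDr.
- move=> r v v' /andP[r0 rT] vL vL'; have rT' : 0 <= r <= T by rewrite !ltW.
  have PL := solP_inL2 D hl vL; have PL' := solP_inL2 D hl vL'; have dL := inL2B vL vL'.
  have e w0 K a : bounded_control K w0 -> inL2 a ->
      advection w0 r a (solP v) - advection w0 r a (solP v') = advection w0 r a (solP (v - v')).
    move=> wM0 aL; rewrite -(advectionBr r wM0 aL PL PL'); apply: eq_advection => i x /andP[x0 xl].
    by rewrite (solPB D hl vL vL') ?ltW.
  have -> (a b c d : R) : a + b - (c + d) = (a - c) + (b - d) by ring.
  rewrite (e _ _ _ uM (zL r rT')) (e _ _ _ wM (rL r rT')).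
  apply: le_trans (ler_normD _ _) _.
  have b1 w0 K a (A : R) : 0 <= K -> bounded_control K w0 -> inL2 a -> nrm a <= A ->
      `|advection w0 r a (solP (v - v'))| <= K * A * C * nrm (v - v').
    move=> K0 wK aL aA; apply: le_trans (ler_advection r wK aL (solP_inL2 D hl dL)) _.
    rewrite -!mulrA ler_wpM2l//; apply: ler_pM; rewrite ?nrm_ge0//.
    exact: HC.
  apply: le_trans (lerD (b1 _ _ _ _ M0 uM (zL r rT') (HB' r rT')) (b1 _ _ _ _ M0' wM (rL r rT') (HB r rT'))) _.
  by rewrite -!mulrDl.
Qed.

(** Half of the dissipation 2 |z|^2 absorbs the control term, as 2 M |z| |P z| <= |z|^2 + M^2 c
    E(z); Gronwall's lemma deals with E. The source enters only through the integrals bounded by S,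
    so that weak convergence of w can make it small. The constant is fixed before the controls and
    does not depend on w. *)
Lemma energy_estimate (M : R) : exists2 C, 0 < C & forall M' u w rho z (S : R),
  bounded_control M u -> bounded_control M' w -> contL2 rho -> perturbed_solution u w rho z ->
  (forall t : R, 0 <= t <= T ->
     `|\int[leb]_(r in `]0, t[) advection w r (rho r) (solP (z r))| <= S) ->
  (forall t : R, 0 <= t <= T -> energy (z t) <= C * (energy (z 0) + 2 * S)) /\
  \int[leb]_(r in `]0, T[) (nrm (z r) ^+ 2) <= C * (energy (z 0) + 2 * S).
Proof.
have [c c0 Hc] := le_nrm_solP hN hl hD.
pose lam := 1 + M ^+ 2 * c.
have lam0 : 0 < lam by rewrite ltr_pwDl// mulr_ge0 ?sqr_ge0// ltW.
pose X := expR (2 * lam * T).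
have X0 : 0 < X by exact: expR_gt0.
have TX : 0 < T * X by exact: mulr_gt0.
(* Gronwall bounds the energy by 2 X times the data; inserted into the integrated inequality, this
   bounds the dissipation by 1 + 2 lam T X times the data. *)
exists (1 + 2 * X + 2 * lam * (T * X)).
  by have := mulr_gt0 lam0 TX; lra.
move=> M' u w rho z S uM wM cr pz HS.
have [cz _] := pz; have [zL _] := cz; have [rL _] := cr.
have T0' : 0 <= (0 : R) <= T by rewrite lexx ltW.
have E := perturbed_energy uM wM cr pz.
have cn := contL2_nrm cz.
have i0 : intble leb `]0, T[ (fun r => nrm (z r) ^+ 2).
  by apply: intble_cont => x; apply: cvgM; exact: cn.
have iu := advection_diag_intble hN hl hD uM cz cz.
have iw := advection_diag_intble hN hl hD wM cr cz.
have ce : {within `[0, T], continuous (fun t => energy (z t))}.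
  pose F (t : R) := \int[leb]_(r in `]0, t[) (2 * (nrm (z r) ^+ 2 +
       (advection u r (z r) (solP (z r)) + advection w r (rho r) (solP (z r))))).
  have cF : {within `[0, T], continuous F}.
    by apply: primitive_cont; [exact: ltW|apply/ibZ/ibD => //; exact: ibD].
  apply/within_itvP => x xT e e0; have /within_itvP /(_ x xT e e0)[d d0 Hd] := cF.
  exists d => // y yT yx; rewrite (E x xT) (E y yT) -/(F x) -/(F y).
  have -> (a b k : R) : a - b - (a - k) = - (b - k) by ring.
  by rewrite normrN; exact: Hd.
have ie : intble leb `]0, T[ (fun r => energy (z r)) by exact: intble_cont.
have S0 : 0 <= S by apply: le_trans (HS 0 _); rewrite ?normr_ge0// lexx ltW.
have E0 (t : R) : 0 <= t <= T -> 0 <= energy (z t) by move=> tT; exact: (energy_ge0 hN hl hD (zL t tT)).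
have main (t : R) : 0 <= t <= T -> energy (z t) + \int[leb]_(r in `]0, t[) (nrm (z r) ^+ 2) <=
    energy (z 0) + 2 * S + lam * \int[leb]_(r in `]0, t[) energy (z r).
  move=> tT; have /andP[t0 tT'] := tT.
  have [j0 ju jw je] : [/\ intble leb `]0, t[ (fun r => nrm (z r) ^+ 2),
     intble leb `]0, t[ (fun r => advection u r (z r) (solP (z r))),
     intble leb `]0, t[ (fun r => advection w r (rho r) (solP (z r))) &
     intble leb `]0, t[ (fun r => energy (z r))] by split; apply: (@intble_itv _ 0 T).
  have h1 : - (\int[leb]_(r in `]0, t[) (2 * advection u r (z r) (solP (z r)))) <=
      \int[leb]_(r in `]0, t[) (nrm (z r) ^+ 2) + lam * \int[leb]_(r in `]0, t[) energy (z r).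
    rewrite -itvN -?itvZ -?itvD//; [|exact: ibZ|exact: ibZ].
    apply: itv_le; [exact/ibN/ibZ|apply: ibD => //; exact: ibZ|].
    move=> r /andP[r0 rt]; have rT : 0 <= r <= T by rewrite (ltW r0) (le_trans (ltW rt)).
    have := ler_advection r uM (zL r rT) (solP_inL2 D hl (zL r rT)).
    rewrite ler_norml => /andP[+ _]; have := Hc _ (zL r rT); have := E0 r rT.
    rewrite /lam; move: (nrm (z r)) (nrm _) (energy _) (advection _ _ _ _) => a p e b e0 pe ab.
    have sq := sqr_ge0 (a - M * p); have M2 := sqr_ge0 M.
    have pe' : M ^+ 2 * p ^+ 2 <= M ^+ 2 * (c * e) by rewrite ler_wpM2l.
    by move: sq; rewrite sqrrB exprMn mulr2n => sq; lra.
  have := HS t tT; rewrite ler_norml => /andP[+ _].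
  rewrite (E t tT); move: h1; rewrite !itvZ//; last by apply: ibD => //; exact: ibD.
  rewrite itvD//; last exact: ibD.
  rewrite itvD//.
  have alg (a n b wi k s : R) : - (2 * b) <= n + k -> - s <= wi ->
     a - 2 * (n + (b + wi)) + n <= a + 2 * s + k by lra.
  by move=> h1 h2; exact: alg.
have K0 : 0 <= energy (z 0) + 2 * S by rewrite addr_ge0 ?E0 ?mulr_ge0.
have gr (t : R) : 0 <= t <= T -> energy (z t) <= 2 * (energy (z 0) + 2 * S) * X.
  apply: (gronwall T0 lam0 K0 ce E0) => s sT; apply: le_trans (main s sT).
  by rewrite lerDl; apply: itv_ge0 => r _; exact: sqr_ge0.
have c1 : 0 <= 2 * lam * (T * X) by move: (mulr_gt0 lam0 TX) => ?; lra.
split.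
  move=> t tT; apply: le_trans (gr t tT) _.
  have alg (K Y Z : R) : 0 <= K -> 0 <= Z -> 2 * K * Y <= (1 + 2 * Y + Z) * K.
    by move=> k0 z0; have := mulr_ge0 z0 k0; lra.
  exact: alg.
have TT : 0 <= T <= T by rewrite lexx ltW.
have := main T TT; have := E0 T TT.
have : \int[leb]_(r in `]0, T[) energy (z r) <= \int[leb]_(r in `]0, T[) (2 * (energy (z 0) + 2 * S) * X).
  apply: itv_le => //; first exact: intble_cst.
  by move=> r /andP[r0 rT]; apply: gr; rewrite !ltW.
rewrite Rintegral_cst_itv ?(ltW T0)// subr0.
have alg (K I a n : R) : 0 <= K -> I <= 2 * K * X * T -> 0 <= a -> a + n <= K + lam * I ->
    n <= (1 + 2 * X + 2 * lam * (T * X)) * K.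
  move=> k0 h1 h2 h3; have h4 : lam * I <= lam * (2 * K * X * T) by rewrite ler_wpM2l// ltW.
  by have := mulr_ge0 k0 (ltW X0); lra.
by move=> h1 h2 h3; exact: (alg _ _ _ _ K0 h1 h2 h3).
Qed.

(** The increment itself is the test function, which turns the equation into a formula for its
    energy. The smallness comes from the length of [s, t], although no common modulus of continuity
    in L^2 is known along a sequence of states. *)
Lemma energy_increment (M M' : R) : exists2 C, 0 < C & forall u w rho z,
  bounded_control M u -> bounded_control M' w -> contL2 rho -> perturbed_solution u w rho z ->
  forall s t : R, 0 <= s -> s <= t -> t <= T ->
  energy (z t - z s) <= C * nrm (z t - z s) * \int[leb]_(r in `]s, t[) (nrm (z r) + nrm (rho r)).
Proof.
have [c c0 Hc] := ler_nrm_solP hN hl hD.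
exists (1 + (`|M| + `|M'|) * c); first by rewrite ltr_pwDl// mulr_ge0 ?addr_ge0// ltW.
move=> u w rho z uM wM cr pz s t s0 st tT; have [cz H] := pz; have [zL _] := cz; have [rL _] := cr.
have M0 := bounded_control_ge0 (Ordinal hN) uM; have M0' := bounded_control_ge0 (Ordinal hN) wM.
have vL : inL2 (z t - z s).
  by apply: inL2B; apply: zL; rewrite ?s0 ?tT ?(le_trans s0 st) ?(le_trans st tT).
rewrite /energy (H _ s t vL)//; set v := z t - z s in vL *.
have PL := solP_inL2 D hl vL.
have ig : intble leb `]s, t[ (fun r => nrm (z r) + nrm (rho r)).
  by apply: (@intble_itv _ 0 T) => //; apply: ibD; apply: intble_cont; exact: contL2_nrm.
have ih : intble leb `]s, t[ (fun r => dot (z r) v +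
    (advection u r (z r) (solP v) + advection w r (rho r) (solP v))).
  apply: (@intble_itv _ 0 T) => //; apply: ibD.
    by apply: intble_cont; exact: contL2_dot.
  apply: ibD; first exact: (advection_diag_intble hN hl hD uM cz (contL2_cst T vL)).
  exact: (advection_diag_intble hN hl hD wM cr (contL2_cst T vL)).
apply: le_trans (ler_norm _) _; rewrite normrN; apply: le_trans (itv_norm ih) _.
rewrite -itvZ//; apply: itv_le; [exact: ib_norm|exact: ibZ|].
move=> r /andP[sr rt].
have rT : 0 <= r <= T by rewrite (le_trans s0 (ltW sr)) (le_trans (ltW rt) tT).
have n0 := nrm_ge0 l v; have P0 := nrm_ge0 l (solP v).
have b1 : `|advection u r (z r) (solP v)| <= M * (nrm (z r) * (c * nrm v)).
  apply: le_trans (ler_advection r uM (zL r rT) PL) _.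
  by rewrite ler_wpM2l// ler_wpM2l ?nrm_ge0//; exact: Hc.
have b2 : `|advection w r (rho r) (solP v)| <= M' * (nrm (rho r) * (c * nrm v)).
  apply: le_trans (ler_advection r wM (rL r rT) PL) _.
  by rewrite ler_wpM2l// ler_wpM2l ?nrm_ge0//; exact: Hc.
have b3 := le_dot_nrm (zL r rT) vL.
apply: le_trans (ler_normD _ _) _; apply: le_trans (lerD b3 (ler_normD _ _)) _.
apply: le_trans (lerD (lexx _) (lerD b1 b2)) _.
rewrite !ger0_norm//.
have alg (a b n : R) : 0 <= a -> 0 <= b -> 0 <= n ->
    a * n + (M * (a * (c * n)) + M' * (b * (c * n))) <= (1 + (M + M') * c) * n * (a + b).
  move=> a0 b0 k0; have h1 := mulr_ge0 k0 b0.
  have h2 : 0 <= M * c * (n * b) by rewrite mulr_ge0// mulr_ge0// ltW.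
  have h3 : 0 <= M' * c * (n * a) by rewrite !mulr_ge0// ltW.
  by move: h1 h2 h3; lra.
by apply: alg => //; exact: nrm_ge0.
Qed.

Lemma energyC v v' : inL2 v -> inL2 v' -> energy (v - v') = energy (v' - v).
Proof.
move=> vL vL'; have aL := inL2B vL vL'; have bL := inL2B vL' vL.
apply/eqP; rewrite -subr_eq0 (energyB hN hl hD aL bL).
have -> : v - v' + (v' - v) = v - v by rewrite addrA subrK.
have dL := inL2B aL bL.
rewrite (dot_solKC hN hl hD dL (inL2B vL vL)) (dotBl vL vL (solK_inL2 D hl dL)).
by rewrite subrr.
Qed.

(* On the cell [s, t], [rho r] is replaced by [rho s] and [z r] by the value of [z]
   at the time where [nrm (z r)] is minimal. *)
Lemma cell_estimate (M M' : R) : exists2 C, 0 < C & forall u w rho z,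
  bounded_control M u -> bounded_control M' w -> contL2 rho -> perturbed_solution u w rho z ->
  forall s t Q B G del om eta : R, 0 <= s -> s <= t -> t <= T -> 0 <= Q -> 0 < del ->
  (forall r, s <= r <= t -> energy (z r) <= Q ^+ 2) ->
  (forall r, s <= r <= t -> nrm (rho r - rho s) <= om) -> nrm (rho s) <= B ->
  \int[leb]_(r in `]s, t[) (nrm (z r) + nrm (rho r)) <= G ->
  (forall r, s <= r <= t ->
     (t - s) * nrm (z r) ^+ 2 <= \int[leb]_(x in `]s, t[) (nrm (z x) ^+ 2) ->
     `|\int[leb]_(x in `]s, t[) advection w x (rho s) (solP (z r))| <= eta) ->
  `|\int[leb]_(r in `]s, t[) advection w r (rho r) (solP (z r))| <=
  \int[leb]_(r in `]s, t[) (C * (om * Q + B * (del * nrm (z r) + G / del))) + eta.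
Proof.
have [c c0 Hc] := le_nrm_solP hN hl hD.
have [k k0 Hk] := energy_increment M M'.
pose K := c * k / 2; have K0 : 0 < K by rewrite divr_gt0// mulr_gt0.
exists (1 + `|M'| * (Num.sqrt c + 1 + K)).
  by rewrite ltr_pwDl// mulr_ge0// addr_ge0 ?(ltW K0)// addr_ge0 ?sqrtr_ge0.
move=> u w rho z uM wM cr pz s t Q B G del om eta s0 st tT Q0 d0 HQ Hom HB HG Heta.
have [cz _] := pz; have [zL _] := cz; have [rL _] := cr.
have M0' := bounded_control_ge0 (Ordinal hN) wM; rewrite (ger0_norm M0').
have cn := contL2_nrm cz.
have inT r : s <= r <= t -> 0 <= r <= T.
  by move=> /andP[sr rt]; rewrite (le_trans s0 sr) (le_trans rt tT).
have sT : 0 <= s <= T by apply: inT; rewrite lexx.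
have [sg sgI Hsg] : exists2 sg, s <= sg <= t & forall r, s <= r <= t -> nrm (z sg) <= nrm (z r).
  have cn' : {within `[s, t], continuous (fun r => nrm (z r))}.
    by apply: continuous_subspaceW cn; apply: subset_itv; rewrite bnd_simp.
  have [sg sgI H] := EVT_min st cn'; exists sg; first by move: sgI; rewrite in_itv.
  by move=> r rI; apply: H; rewrite in_itv.
have i2 : intble leb `]s, t[ (fun x => nrm (z x) ^+ 2).
  apply: (@intble_itv _ 0 T) => //; apply: intble_cont => x; apply: cvgM; exact: cn.
have i1 : intble leb `]s, t[ (fun x => nrm (z x)).
  by apply: (@intble_itv _ 0 T) => //; exact: intble_cont.
have ir : intble leb `]s, t[ (fun x => nrm (rho x)).
  by apply: (@intble_itv _ 0 T) => //; apply: intble_cont; exact: contL2_nrm.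
have := Heta sg sgI; have -> : (t - s) * nrm (z sg) ^+ 2 <=
    \int[leb]_(x in `]s, t[) (nrm (z x) ^+ 2).
  rewrite mulrC -(Rintegral_cst_itv _ st); apply: itv_le => //; first exact: intble_cst.
  move=> r /andP[sr rt]; rewrite ler_sqr ?nnegrE ?nrm_ge0//; apply: Hsg.
  by rewrite !ltW.
move=> /(_ isT) H3.
have PsL := solP_inL2 D hl (zL sg (inT sg sgI)).
have ib3 : intble leb `]s, t[ (fun r => advection w r (rho s) (solP (z sg))).
  exact: (advection_intble s t wM (rL s sT) PsL).
have ib0 : intble leb `]s, t[ (fun r => advection w r (rho r) (solP (z r))).
  exact: (intble_itv s0 tT (advection_diag_intble hN hl hD wM cr cz)).
have iC : intble leb `]s, t[ (fun r => (1 + M' * (Num.sqrt c + 1 + K)) *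
    (om * Q + B * (del * nrm (z r) + G / del))).
  by apply: ibZ; apply: ibD; [exact: intble_cst|apply: ibZ; apply: ibD; [exact: ibZ|exact: intble_cst]].
rewrite -[X in `|X|](subrK (\int[leb]_(x in `]s, t[) advection w x (rho s) (solP (z sg)))).
apply: le_trans (ler_normD _ _) _; apply: lerD => //.
rewrite -(itvB ib0 ib3); apply: le_trans (itv_norm (ibB ib0 ib3)) _.
apply: (itv_le (ib_norm (ibB ib0 ib3)) iC).
move=> r /andP[sr rt]; have rI : s <= r <= t by rewrite !ltW.
have rT := inT r rI.
have PrL := solP_inL2 D hl (zL r rT).
have dL := inL2B (zL r rT) (zL sg (inT sg sgI)).
have e1 : advection w r (rho r) (solP (z r)) - advection w r (rho s) (solP (z sg)) =
    advection w r (rho r - rho s) (solP (z r)) + advection w r (rho s) (solP (z r - z sg)).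
  rewrite (advectionBl r wM (rL r rT) (rL s sT) PrL).
  rewrite (@eq_advection _ _ l w r (rho s) (solP (z r - z sg)) (solP (z r) - solP (z sg))).
    rewrite (advectionBr r wM (rL s sT) PrL PsL).
    by move: (advection _ _ _ _) (advection _ _ _ _) (advection _ _ _ _) => a b d; ring.
  by move=> i x /andP[x0 xl]; rewrite (solPB D hl (zL r rT) (zL sg (inT sg sgI))) ?ltW.
rewrite e1; apply: le_trans (ler_normD _ _) _.
apply: le_trans (lerD (ler_advection r wM (inL2B (rL r rT) (rL s sT)) PrL)
  (ler_advection r wM (rL s sT) (solP_inL2 D hl dL))) _.
have p1 : nrm (solP (z r)) <= Num.sqrt c * Q.
  have sc : Num.sqrt c ^+ 2 = c by rewrite sqr_sqrtr// ltW.
  rewrite -ler_sqr ?nnegrE ?nrm_ge0 ?(mulr_ge0 (sqrtr_ge0 c) Q0)// exprMn sc.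
  by apply: le_trans (Hc _ (zL r rT)) _; rewrite ler_pM2l//; exact: HQ.
have G0 : 0 <= G.
  by apply: le_trans HG; apply: itv_ge0 => x _; rewrite addr_ge0 ?nrm_ge0.
(* By minimality |z r - z sg| <= 2 |z r|, so the square of the left side is at most 2 c k G |z r|.
   This equals four times the product of the two terms on the right, by the choice of K, and the
   arithmetic-geometric inequality concludes. *)
have p2 : nrm (solP (z r - z sg)) <= del * nrm (z r) + K * (G / del).
  have en : energy (z r - z sg) <= k * (2 * nrm (z r)) * G.
    have nd : nrm (z r - z sg) <= 2 * nrm (z r).
      apply: le_trans (ler_nrmB (zL r rT) (zL sg (inT sg sgI))) _.
      by rewrite mulr_natl mulr2n lerD2l; exact: Hsg.
    have sub a b : s <= a -> a <= b -> b <= t ->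
        \int[leb]_(x in `]a, b[) (nrm (z x) + nrm (rho x)) <= G.
      move=> sa ab bt; apply: le_trans HG; have iS := ibD i1 ir.
      rewrite (Rintegral_chasles (le_trans sa ab) bt iS).
      rewrite (Rintegral_chasles sa ab (intble_itv (lexx _) bt iS)).
      have p0 a' b' : 0 <= \int[leb]_(x in `]a', b'[) (nrm (z x) + nrm (rho x)).
        by apply: itv_ge0 => x _; rewrite addr_ge0 ?nrm_ge0.
      by rewrite -addrA addrCA lerDl addr_ge0.
    have /andP[ssg sgt] := sgI.
    have [rs|/ltW rs] := leP sg r.
      apply: le_trans (Hk _ _ _ _ uM wM cr pz sg r _ rs _) _; [exact: le_trans ssg|by case/andP: rT|].
      apply: ler_pM; rewrite ?mulr_ge0 ?nrm_ge0 ?(ltW k0)//.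
      - by apply: itv_ge0 => x _; rewrite addr_ge0 ?nrm_ge0.
      - by rewrite ler_pM2l.
      - by apply: sub => //; rewrite ltW.
    rewrite (energyC (zL r rT) (zL sg (inT sg sgI))).
    rewrite nrmBC in nd.
    apply: le_trans (Hk _ _ _ _ uM wM cr pz r sg _ rs _) _; [by case/andP: rT|exact: le_trans tT|].
    apply: ler_pM; rewrite ?mulr_ge0 ?nrm_ge0 ?(ltW k0)//.
    - by apply: itv_ge0 => x _; rewrite addr_ge0 ?nrm_ge0.
    - by rewrite ler_pM2l.
    - by apply: sub => //; rewrite ltW.
  apply: (le_sqr_sum (mulr_ge0 (ltW d0) (nrm_ge0 _ _)) (mulr_ge0 (ltW K0) (divr_ge0 G0 (ltW d0)))).
  apply: le_trans (Hc _ dL) _.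
  apply: le_trans (ler_wpM2l (ltW c0) en) _; rewrite le_eqVlt; apply/orP; left; apply/eqP.
  by rewrite /K; clear -d0; move: (nrm _) => a; field; lra.
have om0 : 0 <= om by apply: le_trans (Hom r rI); exact: nrm_ge0.
have B0 : 0 <= B by apply: le_trans HB; exact: nrm_ge0.
have q1 : nrm (rho r - rho s) * nrm (solP (z r)) <= om * (Num.sqrt c * Q).
  by apply: ler_pM; rewrite ?nrm_ge0//; exact: Hom.
have q2 : nrm (rho s) * nrm (solP (z r - z sg)) <= B * (del * nrm (z r) + K * (G / del)).
  by apply: ler_pM; rewrite ?nrm_ge0.
apply: le_trans (lerD (ler_wpM2l M0' q1) (ler_wpM2l M0' q2)) _.
have a0 : 0 <= B * (del * nrm (z r)) by rewrite mulr_ge0// mulr_ge0 ?nrm_ge0// ltW.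
have b0 : 0 <= B * (G / del) by rewrite mulr_ge0// divr_ge0// ltW.
have o0 : 0 <= om * Q by rewrite mulr_ge0.
have sc0 := sqrtr_ge0 c.
rewrite (mulrCA om) ![B * (_ + _)]mulrDr (mulrCA B K).
by apply: cell_constant => //; exact: ltW.
Qed.

End PerturbedEquation.

(** * Convergence of the remainder under weak convergence of the controls *)

Lemma grid_sum_bound (R : realFieldType) (B k e : R) : 0 < k -> 0 <= B -> 0 < e ->
  B * (e / (2 * k * (B + 1))) * k <= e / 2.
Proof.
move=> k0 B0 e0; have -> : B * (e / (2 * k * (B + 1))) * k = e * B / (2 * (B + 1)).
  by field; lra.
by rewrite ler_pdivrMr ?mulr_gt0 ?ltr_pwDr//; lra.
Qed.

Lemma young_le (R : realFieldType) (ep x : R) : 0 < ep -> x <= ep * x ^+ 2 + ep^-1.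
Proof.
move=> e0; rewrite -(ler_pM2l e0) mulrDr divff ?gt_eqF// mulrA -expr2 -exprMn.
by have := sqr_ge0 (ep * x - 1); have := sqr_ge0 (ep * x); move: (ep * x) => y; rewrite sqrrB; lra.
Qed.

Lemma le_1_sqr (R : realFieldType) (x : R) : x <= 1 + x ^+ 2.
Proof. by have := young_le x ltr01; rewrite mul1r invr1 addrC. Qed.

Lemma itv_mono (R : realType) (a b c d : R) (f : R -> R) : a <= c -> c <= d -> d <= b ->
  intble leb `]a, b[ f -> (forall x, 0 <= f x) ->
  \int[leb]_(x in `]c, d[) f x <= \int[leb]_(x in `]a, b[) f x.
Proof.
move=> ac cd db fi f0; rewrite (Rintegral_chasles (le_trans ac cd) db fi).
rewrite (Rintegral_chasles ac cd (intble_itv (lexx _) db fi)) -addrA addrCA lerDl.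
by apply: addr_ge0; apply: itv_ge0.
Qed.

Section WeakControls.
Variables (R : realType) (N : nat) (l D : 'I_N -> R) (T : R).
Hypotheses (hN : (0 < N)%N) (hl : forall i, 0 < l i) (hD : forall i, 0 < D i).
Hypothesis T0 : 0 < T.
Local Notation NF := (network_fun R N).
Local Notation CT := (control R N).
Local Notation inL2 := (inL2 l).
Local Notation nrm := (nrm l).
Local Notation solP := (solP l D).
Local Notation energy := (energy l D).
Local Notation advection := (advection l).
Local Notation contL2 := (contL2 l T).
Variables (F : set_system nat) (w : nat -> CT) (M : R).
Context {FF : Filter F}.
Hypothesis wM : forall n, bounded_control M (w n).
Hypothesis w_weak : forall (i : 'I_N) (f : R -> R) (s t : R), L2on leb `]0, l i[ f ->
  0 <= s -> s <= t -> t <= T -> forall e : R, 0 < e -> \forall n \near F,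
    `|\int[leb]_(r in `]s, t[) (\int[leb]_(x in `]0, l i[) (w n i (x, r) * f x))| <= e.
Implicit Types (rho z : R -> NF) (a q v : NF).

(** The factor g will depend on n, hence the bound for all g at once. Bounds and Hoelder constants
    being common, g is within a fixed error of a step function on one grid, and only finitely many
    products of f with indicators of cells are tested. *)
Lemma edge_smallness (i : 'I_N) (f : R -> R) (s t B m e : R) : L2on leb `]0, l i[ f ->
  0 <= s -> s <= t -> t <= T -> 0 <= B -> 0 <= m -> 0 < e ->
  \forall n \near F, forall g : R -> R, measurable_fun `]0, l i[ g ->
    (forall x, 0 <= x <= l i -> `|g x| <= B) ->
    (forall x y, 0 <= x -> x <= y -> y <= l i -> `|g y - g x| <= Num.sqrt (y - x) * m) ->
    `|\int[leb]_(r in `]s, t[) (\int[leb]_(x in `]0, l i[) (w n i (x, r) * (f x * g x)))| <= e.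
Proof.
move=> fL s0 st tT B0 m0 e0; have L0 := hl i.
have M0 : 0 <= M := bounded_control_ge0 i (wM 0%N).
have fi : intble leb `]0, l i[ f.
  apply: (@L2on_intble _ _ R leb `]0, l i[ (measurable_itv _) _ f fL); exact: lebesgue_itv_lty.
set A := \int[leb]_(x in `]0, l i[) `|f x|.
have A0 : 0 <= A by apply: itv_ge0.
(* Freezing g on cells of length h costs at most c sqrt h; [d] satisfies d c <= e / 2, and the
   number of cells below makes sqrt h <= d. *)
pose c := (t - s) * M * m * A.
have c0 : 0 <= c by rewrite !mulr_ge0// subr_ge0.
pose d := e / (2 * (c + 1)).
have d0 : 0 < d by rewrite divr_gt0// mulr_gt0// ltr_pwDr.
pose K := Num.truncn (l i / d ^+ 2); pose h := l i / K.+1%:R.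
have h0 : 0 < h by rewrite divr_gt0.
have hd : Num.sqrt h <= d.
  rewrite -[leRHS](@ger0_norm _ d) ?(ltW d0)// -sqrtr_sqr ler_wsqrtr//.
  rewrite /h ler_pdivrMr// mulrC -ler_pdivrMr ?exprn_gt0//.
  by apply/ltW; exact: truncnS_gt.
have hK : h * K.+1%:R = l i by rewrite /h divfK.
pose fk (k : 'I_K.+1) (x : R) := \1_(`[h * k%:R, h * k.+1%:R[%classic) x * f x.
have fkL k : L2on leb `]0, l i[ (fk k).
  apply: (@L2on_mulb _ _ R leb `]0, l i[ (measurable_itv _) f (\1_(`[h * k%:R, h * k.+1%:R[%classic)) 1) => //.
  by move=> x _; rewrite indicE; case: (_ \in _); rewrite ?normr1 ?normr0.
(* The K + 1 frozen terms, each at most B eta, add up to at most e / 2. *)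
pose eta := e / (2 * K.+1%:R * (B + 1)).
have eta0 : 0 < eta by rewrite divr_gt0// mulr_gt0 ?mulr_gt0 ?ltr_pwDr.
have := @filter_forall nat 'I_K.+1 (fun k n =>
  `|\int[leb]_(r in `]s, t[) (\int[leb]_(x in `]0, l i[) (w n i (x, r) * fk k x))| <= eta) F FF
  (fun k => w_weak (fkL k) s0 st tT eta0).
apply: filterS => n Hn g mg gB gH.
have hk (k : 'I_K.+1) : 0 <= h * k%:R <= l i.
  by rewrite mulr_ge0 ?(ltW h0)//= -hK ler_pM2l// ler_nat ltnW.
have fki k : intble leb `]0, l i[ (fk k).
  apply: (@L2on_intble _ _ R leb `]0, l i[ (measurable_itv _) _ _ (fkL k)); exact: lebesgue_itv_lty.
have fgi : intble leb `]0, l i[ (fun x => f x * g x).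
  apply: (@ib_eq _ _ _ (fun x => g x * f x)); first by move=> x _; rewrite mulrC.
  apply: (@ib_mulb _ _ _ _ _ B) => // x /andP[x0 xl]; apply: gB; rewrite !ltW//.
pose S x := \sum_(k < K.+1) g (h * k%:R) * fk k x.
have Si : intble leb `]0, l i[ S by apply: ib_sum => k; exact: ibZ.
have Sx x : 0 < x < l i -> `|f x * g x - S x| <= d * m * `|f x|.
  move=> /andP[x0 xl].
  pose k0 := Num.truncn (x / h).
  have xh0 : 0 <= x / h by rewrite divr_ge0 ?ltW.
  have k0K : (k0 < K.+1)%N by rewrite truncn_lt_nat// ltr_pdivrMr// mulrC hK.
  have ik k : x \in `[h * k%:R, h * k.+1%:R[%classic = (k0 == k).
    rewrite mem_setE in_itv/= truncn_eq// ler_pdivlMr// ltr_pdivrMr//.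
    by rewrite ![_%:R * h]mulrC.
  have -> : S x = g (h * k0%:R) * f x.
    rewrite /S (bigD1 (Ordinal k0K))//= big1 ?addr0.
      by rewrite /fk indicE ik eqxx mul1r.
    move=> k kk; rewrite /fk indicE ik (_ : (k0 == k) = false) ?mul0r ?mulr0//.
    by apply/negbTE; move: kk; apply: contra => /eqP kk; apply/eqP/val_inj.
  have /andP[k1 k2] : h * k0%:R <= x < h * k0.+1%:R.
    by have := ik k0; rewrite mem_setE in_itv/= eqxx => ->.
  rewrite mulrC -mulrBl normrM ler_wpM2r//.
  have [hk0 _] := andP (hk (Ordinal k0K)).
  apply: le_trans (gH _ _ hk0 k1 (ltW xl)) _; rewrite ler_wpM2r//.
  apply: le_trans hd; apply: ler_wsqrtr; rewrite lerBlDl.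
  by rewrite (le_trans (ltW k2))// -natr1 mulrDr mulr1.
have wx r p : intble leb `]0, l i[ p -> intble leb `]0, l i[ (fun x => w n i (x, r) * p x).
  move=> ip; apply: (@ib_mulb _ _ _ _ _ M) => //; first exact: control_section (wM n).
  by move=> x _; have [_] := wM n i; apply.
pose I p r := \int[leb]_(x in `]0, l i[) (w n i (x, r) * p x).
have wi p : intble leb `]0, l i[ p -> intble leb `]s, t[ (I p).
  exact: advection_edge_intble (wM n).
have di := ibB fgi Si.
have -> : \int[leb]_(r in `]s, t[) I (fun x => f x * g x) r =
    \int[leb]_(r in `]s, t[) I (fun x => f x * g x - S x) r +
    \sum_(k < K.+1) g (h * k%:R) * (\int[leb]_(r in `]s, t[) I (fk k) r).
  have -> : \sum_(k < K.+1) g (h * k%:R) * (\int[leb]_(r in `]s, t[) I (fk k) r) =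
      \int[leb]_(r in `]s, t[) (\sum_(k < K.+1) g (h * k%:R) * I (fk k) r).
    rewrite itv_sum; first by apply: eq_bigr => k _; rewrite itvZ//; exact: wi.
    by move=> k; apply: ibZ; exact: wi.
  rewrite -itvD; [|exact: wi|by apply: ib_sum => k; apply: ibZ; exact: wi].
  apply: itv_eq => r _.
  have -> : \sum_(k < K.+1) g (h * k%:R) * I (fk k) r = I S r.
    rewrite /I /S; under [RHS]itv_eq do rewrite mulr_sumr.
    rewrite itv_sum; last by move=> k; apply: wx; exact: ibZ.
    by apply: eq_bigr => k _; rewrite -itvZ; [apply: itv_eq => x _; rewrite mulrCA|exact: wx].
  rewrite /I -itvD; [|exact: wx|exact: wx].
  by apply: itv_eq => x _; rewrite -mulrDr subrK.
apply: le_trans (ler_normD _ _) _.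
have b1 : `|\int[leb]_(r in `]s, t[) I (fun x => f x * g x - S x) r| <= e / 2.
  apply: le_trans (itv_norm (wi _ di)) _.
  apply: (@le_trans _ _ (M * (d * m * A) * (t - s))).
    rewrite -(Rintegral_cst_itv _ st); apply: (itv_le (ib_norm (wi _ di)) (intble_cst _ _ _)).
    move=> r _; apply: le_trans (itv_norm (wx r _ di)) _.
    have ifn := ib_norm fi.
    rewrite /A -(itvZ _ ifn) -itvZ; last exact: ibZ.
    apply: (itv_le (ib_norm (wx r _ di)) (ibZ M (ibZ (d * m) ifn))) => x xl.
    rewrite normrM; apply: ler_pM => //; last exact: Sx.
    by have [_] := wM n i; apply.
  have -> : M * (d * m * A) * (t - s) = d * c by rewrite /c; clear; ring.
  rewrite /d mulrAC ler_pdivrMr ?mulr_gt0 ?ltr_pwDr//.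
  by rewrite [leRHS]mulrA divfK// ler_pM2l// lerDl.
have b2 : `|\sum_(k < K.+1) g (h * k%:R) * (\int[leb]_(r in `]s, t[) I (fk k) r)| <= e / 2.
  apply: le_trans (ler_norm_sum _ _ _) _.
  apply: (@le_trans _ _ (\sum_(k < K.+1) (B * eta))).
    apply: ler_sum => k _; rewrite normrM; apply: ler_pM => //; first exact: gB.
    exact: Hn.
  rewrite sumr_const card_ord -[_ *+ K.+1]mulr_natr /eta.
  have K0 : 0 < K.+1%:R :> R by [].
  exact: grid_sum_bound.
by apply: le_trans (lerD b1 b2) _; rewrite -mulrDl -mulr2n -[e *+ 2]mulr_natr mulfK.
Qed.

Lemma uniform_smallness a (s t B m e : R) : inL2 a -> 0 <= s -> s <= t -> t <= T ->
  0 <= B -> 0 <= m -> 0 < e ->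
  \forall n \near F, forall q, (forall i, measurable_fun `]0, l i[ (q i)) ->
    (forall i x, 0 <= x <= l i -> `|q i x| <= B) ->
    (forall i x y, 0 <= x -> x <= y -> y <= l i -> `|q i y - q i x| <= Num.sqrt (y - x) * m) ->
    `|\int[leb]_(r in `]s, t[) advection (w n) r a q| <= e.
Proof.
move=> aL s0 st tT B0 m0 e0.
have N0 : 0 < N%:R :> R by rewrite ltr0n.
have := filter_forall FF (fun i : 'I_N => edge_smallness (aL i) s0 st tT B0 m0 (divr_gt0 e0 N0)).
apply: filterS => n H q mq qB qH.
have ai i : intble leb `]0, l i[ (fun x => a i x * q i x).
  apply: (@ib_eq _ _ _ (fun x => q i x * a i x)); first by move=> x _; rewrite mulrC.
  apply: (@ib_mulb _ _ _ _ _ B) => //; last by apply: inL2_edge.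
  by move=> x /andP[x0 xl]; apply: qB; rewrite !ltW.
rewrite itv_sum; last by move=> i; exact: (advection_edge_intble s t (wM n) (ai i)).
apply: le_trans (ler_norm_sum _ _ _) _.
apply: (@le_trans _ _ (\sum_(i < N) (e / N%:R))).
  by apply: ler_sum => i _; apply: H; [exact: mq|exact: qB|exact: qH].
by rewrite sumr_const card_ord -[_ *+ N]mulr_natr divfK// gt_eqF.
Qed.

Lemma remainder_vanishes (Mu : R) (u : nat -> CT) rho (zn : nat -> R -> NF) (C1 : R) :
  (forall n, bounded_control Mu (u n)) -> contL2 rho ->
  (forall n, perturbed_solution l D T (u n) (w n) rho (zn n)) -> 0 <= C1 ->
  (forall n t, 0 <= t <= T -> energy (zn n t) <= C1) ->
  (forall n, \int[leb]_(r in `]0, T[) (nrm (zn n r) ^+ 2) <= C1) ->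
  forall e : R, 0 < e -> \forall n \near F, forall t : R, 0 <= t <= T ->
    `|\int[leb]_(r in `]0, t[) advection (w n) r (rho r) (solP (zn n r))| <= e.
Proof.
move=> uM cr pz C10 En In e e0.
have [C C0 HC] := @cell_estimate R N l D T hN hl hD Mu M.
have [B B0 HB] := contL2_bounded cr; have [rL rc] := cr.
have [c c0 Hc] := le_nrm_solP hN hl hD.
have [cs cs0 Hcs] := ler_solP hN hl hD.
have [dm dm0 Hdm] := le_min_diffusion hD.
have M0 : 0 <= M := bounded_control_ge0 (Ordinal hN) (wM 0%N).
pose Q := Num.sqrt C1; have Q0 : 0 <= Q by exact: sqrtr_ge0.
have Q2 : Q ^+ 2 = C1 by rewrite sqr_sqrtr.
pose L0 := M * (B * (Num.sqrt c * Q)).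
have L00 : 0 <= L0 by rewrite !mulr_ge0 ?sqrtr_ge0// ltW.
pose e5 := e / 5; have e50 : 0 < e5 by rewrite divr_gt0.
have small (p : R) : 0 <= p -> exists2 x : R, 0 < x & x * p <= e5.
  move=> p0; exists (e5 / (p + 1)); first by rewrite divr_gt0// ltr_pwDr.
  by rewrite mulrAC ler_pdivrMr ?ltr_pwDr// ler_pM2l// lerDl.
have [del del0 Hdel] := small (C * B * (T + C1)) (mulr_ge0 (ltW (mulr_gt0 C0 B0)) (addr_ge0 (ltW T0) C10)).
have [om om0 Hom] := small (C * Q * T) (mulr_ge0 (mulr_ge0 (ltW C0) Q0) (ltW T0)).
have [G1 G10 HG1] := small (C * B * T) (ltW (mulr_gt0 (mulr_gt0 C0 B0) T0)).
(* With this value the term G / del of the cell estimate is G1. *)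
pose G := G1 * del; have G0 : 0 < G by exact: mulr_gt0.
have [d d0 Hd] := rc om om0.
have [h1 h10 Hh1] := small L0 L00.
(* By [young_le], the integral of |z| + |rho| over a cell of length h is at most ep C1 + h (1 / ep +
   B). Making each term at most G / 2 fixes [ep] and [h2]. *)
pose ep := G / (2 * (C1 + 1)).
have ep0 : 0 < ep by rewrite divr_gt0// mulr_gt0// ltr_pwDr.
have epC : ep * C1 <= G / 2.
  by rewrite /ep mulrAC ler_pdivrMr ?mulr_gt0 ?ltr_pwDr// mulrA divfK// ler_pM2l// lerDl.
pose h2 := G / 2 / (ep^-1 + B).
have iB0 : 0 < ep^-1 + B by rewrite addr_gt0// invr_gt0.
have h20 : 0 < h2 by rewrite !divr_gt0.
(* The length of a cell is limited by the oscillation of rho ([d / 2]), by the last cell ([h1]) and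
   by the mass bound ([h2]). *)
pose hm := Num.min (d / 2) (Num.min h1 h2).
have hm0 : 0 < hm by rewrite !lt_min divr_gt0// h10 h20.
pose K := Num.truncn (T / hm); pose h := T / K.+1%:R.
have h0 : 0 < h by rewrite divr_gt0.
have hhm : h <= hm.
  by rewrite /h ler_pdivrMr// mulrC -ler_pdivrMr//; apply/ltW; exact: truncnS_gt.
have [hd hh1 hh2] : [/\ h < d, h <= h1 & h <= h2].
  move: hhm; rewrite !le_min => /and3P[a1 a2 a3]; split => //.
  by apply: le_lt_trans a1 _; rewrite ltr_pdivrMr// ltr_pMr// ltr1n.
have hK : h * K.+1%:R = T by rewrite /h divfK.
(* At the selected time of a cell h |z|^2 <= int |z|^2 <= C1, hence |z| <= Z: this bound depends on
   the grid but not on n. *)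
pose Z := Num.sqrt (C1 / h); have Z0 : 0 <= Z by exact: sqrtr_ge0.
have Z2 : Z ^+ 2 = C1 / h by rewrite sqr_sqrtr// divr_ge0// ltW.
pose eta := e5 / K.+1%:R; have eta0 : 0 < eta by rewrite divr_gt0.
have hk (k : nat) : (k <= K.+1)%N -> 0 <= h * k%:R <= T.
  by move=> kK; rewrite mulr_ge0 ?(ltW h0)//= -hK ler_pM2l// ler_nat.
have hS (k : nat) : h * k%:R <= h * k.+1%:R by rewrite ler_pM2l// ler_nat.
have hSB (k : nat) : h * k.+1%:R - h * k%:R = h by rewrite -mulrBr -natrB// subSnn mulr1.
(* One smallness statement per cell, with [rho] frozen at its left end. Their finite intersection is
   the required set of indices, the same for all t. *)
have US (k : 'I_K.+1) := @uniform_smallness (rho (h * k%:R)) (h * k%:R) (h * k.+1%:R)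
  (cs * Z) (Z / dm) eta (rL _ (hk k (ltnW (ltn_ord k)))) (proj1 (andP (hk k (ltnW (ltn_ord k)))))
  (hS k) (proj2 (andP (hk k.+1 (ltn_ord k)))) (mulr_ge0 (ltW cs0) Z0) (divr_ge0 Z0 (ltW dm0)) eta0.
have := filter_forall FF US; apply: filterS => n Hn t tT.
have [cz _] := pz n; have [zL zc] := cz; have cn := contL2_nrm cz.
pose b r := advection (w n) r (rho r) (solP (zn n r)).
pose g r := C * (om * Q + B * (del * nrm (zn n r) + G / del)).
have ib : intble leb `]0, T[ b by exact: (advection_diag_intble hN hl hD (wM n) cr cz).
have iz := intble_cont cn.
have iz2 : intble leb `]0, T[ (fun r => nrm (zn n r) ^+ 2).
  by apply: intble_cont => x; apply: cvgM; exact: cn.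
have ig : intble leb `]0, T[ g.
  apply: ibZ; apply: ibD; first exact: intble_cst.
  by apply: ibZ; apply: ibD; [exact: ibZ|exact: intble_cst].
have inr : intble leb `]0, T[ (fun r => nrm (rho r)) by apply: intble_cont; exact: contL2_nrm.
have g0 r : 0 <= g r.
  rewrite /g mulr_ge0 ?(ltW C0)// addr_ge0//; first by rewrite mulr_ge0// ltW.
  rewrite mulr_ge0 ?(ltW B0)// addr_ge0//; first by rewrite mulr_ge0 ?nrm_ge0// ltW.
  by rewrite divr_ge0// ltW.
have step (k : nat) : (k <= K.+1)%N ->
    `|\int[leb]_(r in `]0, h * k%:R[) b r| <= \int[leb]_(r in `]0, h * k%:R[) g r + eta * k%:R.
  elim: k => [|k IH] kK; first by rewrite !Rintegral_itv0 ?mulr0// normr0 addr0.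
  have /andP[k0 kT] := hk k (ltnW kK); have /andP[k1 k1T] := hk k.+1 kK.
  rewrite (Rintegral_chasles k0 (hS k) (intble_itv (lexx _) k1T ib)).
  rewrite (Rintegral_chasles k0 (hS k) (intble_itv (lexx _) k1T ig)).
  apply: le_trans (ler_normD _ _) _.
  have cellI r : h * k%:R <= r <= h * k.+1%:R -> 0 <= r <= T.
    by move=> /andP[r1 r2]; rewrite (le_trans k0 r1) (le_trans r2 k1T).
  have cell := HC _ _ _ _ (uM n) (wM n) cr (pz n) (h * k%:R) (h * k.+1%:R) Q B G del om eta
    k0 (hS k) k1T Q0 del0.
  have {}cell : `|\int[leb]_(r in `]h * k%:R, h * k.+1%:R[) b r| <=
      \int[leb]_(r in `]h * k%:R, h * k.+1%:R[) g r + eta.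
    apply: cell.
    - by move=> r rI; rewrite Q2; apply: En; exact: cellI.
    - move=> r rI; apply/ltW; have /andP[r1 r2] := rI; apply: Hd; [by rewrite k0 kT|exact: cellI|].
      rewrite ger0_norm ?subr_ge0//; apply: le_lt_trans hd.
      by rewrite -[leRHS](hSB k) lerD2r.
    - by apply: HB; rewrite k0 kT.
    - apply: (@le_trans _ _ (\int[leb]_(r in `]h * k%:R, h * k.+1%:R[) (ep * nrm (zn n r) ^+ 2 + (ep^-1 + B)))).
        apply: itv_le.
        + by apply: ibD; [exact: (intble_itv k0 k1T iz)|exact: (intble_itv k0 k1T inr)].
        + by apply: ibD; [apply: ibZ; exact: (intble_itv k0 k1T iz2)|exact: intble_cst].
        move=> r /andP[r1 r2]; rewrite addrA; apply: lerD; last first.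
          by apply: HB; apply: cellI; rewrite !ltW.
        exact: young_le.
      rewrite itvD; [|by apply: ibZ; exact: (intble_itv k0 k1T iz2)|exact: intble_cst].
      rewrite itvZ; last exact: (intble_itv k0 k1T iz2).
      rewrite (Rintegral_cst_itv _ (hS k)) (hSB k).
      rewrite [leRHS](splitr G); apply: lerD.
        apply: le_trans epC; rewrite ler_pM2l//; apply: le_trans (In n).
        by apply: itv_mono => // r; exact: sqr_ge0.
      by rewrite mulrC -ler_pdivlMr.
    move=> r rI; rewrite (hSB k) => hr.
    have vL := zL r (cellI r rI).
    have nZ : nrm (zn n r) <= Z.
      rewrite -ler_sqr ?nnegrE ?nrm_ge0// Z2.
      rewrite ler_pdivlMr// mulrC; apply: le_trans hr _; apply: le_trans (In n).
      by apply: itv_mono => // x; exact: sqr_ge0.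
    apply: (Hn (Ordinal kK)).
    - by move=> i; have [] := solP_inL2 D hl vL i.
    - move=> i x xl; apply: le_trans (Hcs _ _ _ vL xl) _; exact: (ler_wpM2l (ltW cs0) nZ).
    - move=> i x y x0 xy yl; apply: le_trans (solP_holder hD vL x0 xy yl) _.
      rewrite -mulrA ler_wpM2l ?sqrtr_ge0//; apply: ler_pM; rewrite ?nrm_ge0 ?invr_ge0 ?(ltW (hD i))//.
      by rewrite lef_pV2 ?posrE.
  apply: le_trans (lerD (IH (ltnW kK)) cell) _.
  have -> : eta * k.+1%:R = eta * k%:R + eta by rewrite -[k.+1%:R]natr1 mulrDr mulr1.
  by rewrite [leLHS]addrACA lexx.
have /andP[t0 tT'] := tT.
pose k := Num.truncn (t / h).
have th0 : 0 <= t / h by rewrite divr_ge0// ltW.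
have kt : h * k%:R <= t by rewrite mulrC -ler_pdivlMr// truncn_le.
have tk : t - h * k%:R <= h.
  by rewrite lerBlDl -[X in _ + X]mulr1 -mulrDr natr1 mulrC -ler_pdivrMr//; apply/ltW; exact: truncnS_gt.
have kK : (k <= K.+1)%N by rewrite -(ler_nat R) -(ler_pM2l h0) hK (le_trans kt).
have /andP[k0 kT] := hk k kK.
rewrite (Rintegral_chasles k0 kt (intble_itv (lexx _) tT' ib)).
apply: le_trans (ler_normD _ _) _.
(* The cell cut off by t is estimated crudely, by [L0] per unit of time. *)
have last_cell : `|\int[leb]_(r in `]h * k%:R, t[) b r| <= e5.
  apply: le_trans (itv_norm (intble_itv k0 tT' ib)) _.
  apply: (@le_trans _ _ (L0 * (t - h * k%:R))).
    rewrite -(Rintegral_cst_itv _ kt).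
    apply: (itv_le (ib_norm (intble_itv k0 tT' ib)) (intble_cst _ _ _)) => r /andP[r1 r2].
    have rT : 0 <= r <= T by rewrite (le_trans k0 (ltW r1)) (le_trans (ltW r2)).
    apply: le_trans (ler_advection r (wM n) (rL r rT) (solP_inL2 D hl (zL r rT))) _.
    rewrite ler_wpM2l//; apply: ler_pM; rewrite ?nrm_ge0//; first exact: HB.
    have sc : Num.sqrt c ^+ 2 = c by rewrite sqr_sqrtr// ltW.
    rewrite -ler_sqr ?nnegrE ?nrm_ge0 ?(mulr_ge0 (sqrtr_ge0 c) Q0)// exprMn sc Q2.
    by apply: le_trans (Hc _ (zL r rT)) _; rewrite ler_pM2l//; exact: En.
  apply: le_trans Hh1; rewrite mulrC ler_wpM2r//.
  exact: le_trans tk hh1.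
have gb : \int[leb]_(r in `]0, h * k%:R[) g r <= e5 + e5 + e5.
  apply: (@le_trans _ _ (\int[leb]_(r in `]0, T[) g r)); first exact: itv_mono.
  pose A0 := om * (C * Q) + G1 * (C * B) + del * (C * B).
  have CBd : 0 <= del * (C * B) by rewrite ltW// !mulr_gt0.
  have iy : intble leb `]0, T[ (fun r => del * (C * B) * nrm (zn n r) ^+ 2) by exact: ibZ.
  apply: (@le_trans _ _ (\int[leb]_(r in `]0, T[) (A0 + del * (C * B) * nrm (zn n r) ^+ 2))).
    apply: (itv_le ig (ibD (intble_cst _ _ _) iy)) => r _.
    rewrite /g /G mulfK ?gt_eqF//.
    have := ler_wpM2l CBd (le_1_sqr (nrm (zn n r))); rewrite /A0; move: (nrm _) => x; lra.
  rewrite (itvD (intble_cst _ _ _) iy) (itvZ _ iz2) (Rintegral_cst_itv _ (ltW T0)) subr0.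
  have := ler_wpM2l CBd (In n); move: Hdel Hom HG1; rewrite /A0.
  move: (\int[leb]_(r in _) _) => I; lra.
have ek : eta * k%:R <= e5.
  by rewrite /eta mulrAC ler_pdivrMr// ler_pM2l// ler_nat.
apply: le_trans (lerD (le_trans (step k kK) (lerD gb ek)) last_cell) _.
by rewrite /e5; lra.
Qed.

End WeakControls.

(** * Weak compactness along ultrafilters *)

Section UltrafilterLimits.
Variables (R : realType) (I : Type) (U : set_system I).
Context {UU : UltraFilter U}.

(** The values lie in a compact interval, and a cluster point along an ultrafilter is a limit, since
    each set or its complement belongs to the ultrafilter. *)
Lemma ultra_limit (a : I -> R) (B : R) : (forall n, `|a n| <= B) ->
  exists c : R, forall e : R, 0 < e -> \forall n \near U, `|a n - c| <= e.
Proof.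
move=> aB; have UP : ProperFilter U by exact: ultra_proper.
have FB : nbhs (a @ U) `[- B, B]%classic.
  change (U (a @^-1` `[- B, B]%classic)); apply: filterE => n.
  by rewrite /= in_itv/= -ler_norml.
have [c [_ cc]] := @segment_compact R (- B) B _ (fmap_proper_filter a UP) FB.
exists c => e e0.
have [//|no] := in_ultra_setVsetC [set n | `|a n - c| <= e] UU.
have nc : nbhs c [set x | `|c - x| < e] by exact: (@nbhsx_ballx R R c e e0).
have na : (a @ U) [set x | ~ `|x - c| <= e] by exact: no.
have [x [/= h1 h2]] := cc _ _ na nc.
by exfalso; apply: h1; rewrite distrC ltW.
Qed.

End UltrafilterLimits.

(** * Density of an absolutely continuous additive set function *)

Section SetFunctionDensity.
Context d (T : measurableType d) (R : realType) (mu : {measure set T -> \bar R}).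
Variables (D : set T) (mD : measurable D) (muD : (mu D < +oo)%E) (c : set T -> R).
Hypothesis cU : forall A B, measurable A -> measurable B -> A `&` B = set0 ->
  c (A `|` B) = c A + c B.
Hypothesis c_cont : forall e : R, 0 < e -> exists2 r : R, 0 < r &
  forall A, measurable A -> (mu (A `&` D) < r%:E)%E -> `|c A| <= e.

Let nu : set T -> \bar R := fun A => (c A)%:E.

Let c0 : c set0 = 0.
Proof.
have := cU measurable0 measurable0 (setI0 _); rewrite setU0 => /eqP.
by rewrite -subr_eq subrr => /eqP.
Qed.

Let nu0 : nu set0 = 0%E. Proof. by rewrite /nu c0. Qed.

Let nu_fin A : measurable A -> nu A \is a fin_num. Proof. by []. Qed.

(** Countable additivity from finite additivity: the tails of a disjoint union decrease to the empty
    set, their measure in D tends to 0, and absolute continuity makes [c] small on them. *)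
Let nu_sigma : semi_sigma_additive nu.
Proof.
move=> F mF tF mUF.
pose G n := \bigcup_(i in [set k | (n <= k)%N]) F i.
have mG n : measurable (G n) by apply: bigcup_measurable => k _; exact: mF.
have decomp n : c (\bigcup_n F n) = \sum_(0 <= i < n) c (F i) + c (G n).
  elim: n => [|n IH].
    by rewrite big_geq// add0r; congr c; apply: eq_bigcupl; split.
  have GS : G n = F n `|` G n.+1.
    rewrite eqEsubset; split => x.
      move=> [k /= nk Fx]; move: nk; rewrite leq_eqVlt => /predU1P[->|nk]; first by left.
      by right; exists k.
    by move=> [Fx|[k /= nk Fx]]; [exists n => /=|exists k => //=; exact: ltnW].
  rewrite IH big_nat_recr//= -addrA GS cU//.
  rewrite -subset0 => x [Fx [k /= nk Fk]].
  by have := tF n k I I (ex_intro _ x (conj Fx Fk)) => nk'; rewrite nk' ltnn in nk.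
have mu0 : (mu (G n `&` D)) @[n --> \oo] --> 0%E.
  have -> : 0%E = mu (\bigcap_n (G n `&` D)).
    rewrite (_ : \bigcap_n _ = set0) ?measure0// -subset0 => x H.
    have [[k _ Fk] _] := H 0%N I; have [[j /= kj Fj] _] := H k.+1 I.
    by have := tF k j I I (ex_intro _ x (conj Fk Fj)) => jk; rewrite jk ltnn in kj.
  apply: nonincreasing_cvg_mu.
  - by apply: le_lt_trans muD; apply: le_measure; rewrite ?inE//; exact: measurableI.
  - by move=> n; exact: measurableI.
  - by apply: bigcap_measurable => // n _; exact: measurableI.
  - apply/nonincreasing_seqP => n; rewrite subsetEset; apply: setSI.
    by move=> x [k /= nk Fk]; exists k => //=; exact: ltnW.
rewrite /nu; apply: cvg_EFin; first by near=> n; rewrite sumEFin.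
apply/cvgrPdist_le => e e0.
have [r r0 Hr] := c_cont e0.
have : \forall n \near \oo, (mu (G n `&` D) < r%:E)%E.
  have /fine_cvgP[hfin /cvgrPdist_lt/(_ r r0) hc] := mu0.
  apply: filterS2 hfin hc => n fin /=; rewrite sub0r normrN => h.
  by rewrite -(fineK fin) lte_fin (le_lt_trans (ler_norm _)).
apply: filterS => n Hn /=; rewrite (decomp n) sumEFin/= addrC addKr.
exact: Hr.
Unshelve. all: by end_near. Qed.

HB.instance Definition _ := isCharge.Build _ _ _ nu nu0 nu_fin nu_sigma.

Local Notation restr := (mfrestr mD muD).

Let restr_integral A (f : T -> \bar R) : measurable A -> A `<=` D ->
  (\int[restr]_(x in A) f x = \int[mu]_(x in A) f x)%E.
Proof.
move=> mA AD; apply: eq_measure_integral => B mB BA.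
by rewrite -[LHS]/(mu (B `&` D)) setIidl//; exact: subset_trans BA AD.
Qed.

(** Radon-Nikodym for the charge [nu] with respect to the restriction of [mu] to D, a finite measure
    with the same integrals over subsets of D. *)
Lemma set_function_density : exists2 f : T -> R, intble mu D f &
  forall A, measurable A -> A `<=` D -> c A = \int[mu]_(x in A) f x.
Proof.
have dom : nu `<< restr.
  move=> A nA B mB BA; rewrite /nu; congr EFin; apply/eqP; rewrite -normr_le0.
  apply/ler_addgt0Pr => e e0; rewrite add0r; have [r r0 Hr] := c_cont e0.
  by apply: Hr => //; have := nA B mB BA; rewrite /mfrestr /mrestr => ->; rewrite lte_fin.
have ffin x := @Radon_Nikodym_fin_num _ _ _ nu restr x dom.
have fE : Radon_Nikodym nu restr = EFin \o (fine \o Radon_Nikodym nu restr).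
  by apply/funext => x /=; rewrite fineK.
exists (fine \o Radon_Nikodym nu restr).
  rewrite /intble -fE; have := Radon_Nikodym_integrable dom.
  move=> /(integrableS measurableT mD (@subsetT _ _))/integrableP[mf foo].
  by apply/integrableP; split => //; rewrite -restr_integral.
move=> A mA AD; have E := Radon_Nikodym_integral dom mA.
rewrite /Rintegral -[LHS]/(fine (c A)%:E); congr fine; rewrite [LHS]E restr_integral//.
by apply: eq_integral => x _; rewrite /= fineK.
Qed.

End SetFunctionDensity.

(** * Weak compactness of bounded sequences in L^2 *)

Section WeakCompactness.
Context d (T : measurableType d) (R : realType) (mu : {measure set T -> \bar R}).
Variables (D : set T) (mD : measurable D) (muD : (mu D < +oo)%E).
Variables (w : nat -> T -> R) (C : R).
Hypothesis wL : forall n, L2on mu D (w n).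
Hypothesis wC : forall n, \int[mu]_(x in D) (w n x ^+ 2) <= C.

Let Rint_sub n A : measurable A ->
  \int[mu]_(x in A `&` D) w n x = \int[mu]_(x in D) (w n x * \1_(A `&` D) x).
Proof. by move=> mA; rewrite Rintegral_indic//; exact: measurableI. Qed.

(** Cauchy-Schwarz against an indicator. The absolute continuity is uniform in n, which is what
    survives in the limit. *)
Lemma small_sets n A : measurable A -> 
  (\int[mu]_(x in A `&` D) w n x) ^+ 2 <= C * fine (mu (A `&` D)).
Proof.
move=> mA; have mAD := measurableI _ _ mA mD.
have C0 : 0 <= C by apply: le_trans (wC n); apply: Rintegral_ge0 => x _; exact: sqr_ge0.
have iL : L2on mu D (\1_(A `&` D) : T -> R).
  apply: (@L2on_bounded _ _ _ _ D mD muD _ 1); first exact: measurable_indic.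
  by move=> x _; rewrite indicE; case: (_ \in _); rewrite ?normr1 ?normr0.
rewrite Rint_sub//; apply: le_trans (Rintegral_CauchySchwarz mD (wL n) iL) _.
apply: ler_pM => //; try by apply: Rintegral_ge0 => x _; exact: sqr_ge0.
have -> : \int[mu]_(x in D) (\1_(A `&` D) x ^+ 2) = \int[mu]_(x in D) ((fun=> 1) x * \1_(A `&` D) x) :> R.
  by apply: eq_Rintegral => x _; rewrite indicE mul1r; case: (_ \in _); rewrite ?expr1n ?expr0n.
by rewrite Rintegral_indic// Rintegral_cst//= mul1r.
Qed.

(** One ultrafilter makes the integrals over all measurable sets converge at once, in place of a
    diagonal extraction over a countable family. The limit inherits additivity, and absolute
    continuity through [small_sets]. *)
Lemma weak_compactness (U : set_system nat) : UltraFilter U ->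
  exists2 f : T -> R, intble mu D f & forall A, measurable A -> A `<=` D -> forall e : R, 0 < e ->
    \forall n \near U, `|\int[mu]_(x in A) w n x - \int[mu]_(x in A) f x| <= e.
Proof.
move=> UU; have UP : ProperFilter U by exact: ultra_proper.
have C0 : 0 <= C by apply: le_trans (wC 0%N); apply: Rintegral_ge0 => x _; exact: sqr_ge0.
have fin A : measurable A -> mu (A `&` D) \is a fin_num.
  move=> mA; rewrite ge0_fin_numE//; apply: le_lt_trans muD.
  by apply: le_measure; rewrite ?inE//; exact: measurableI.
have [c Hc] : exists c : set T -> R, forall A, measurable A -> forall e : R, 0 < e ->
    \forall n \near U, `|\int[mu]_(x in A `&` D) w n x - c A| <= e.
  suff /boolp.choice[c Hc] : forall A, exists c : R, measurable A -> forall e : R, 0 < e ->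
      \forall n \near U, `|\int[mu]_(x in A `&` D) w n x - c| <= e by exists c.
  move=> A.
  (* The value 0 on nonmeasurable sets is a placeholder. *)
  have [mA|nA] := pselect (measurable A); last by exists 0.
  have [|c Hc] := @ultra_limit R nat U UU (fun n => \int[mu]_(x in A `&` D) w n x)
    (1 + C * fine (mu (A `&` D))); last by exists c.
  move=> n; have := small_sets n mA; rewrite -real_normK ?num_real//.
  move: (C * _) => k h; apply: le_trans (le_1_sqr _) _; by rewrite lerD2l.
have uniq (x y : R) : (forall e : R, 0 < e -> `|x - y| <= e) -> x = y.
  move=> H; apply/eqP; rewrite -subr_eq0 -normr_le0; apply/ler_addgt0Pr => e e0.
  by rewrite add0r; exact: H.
have cU A B : measurable A -> measurable B -> A `&` B = set0 -> c (A `|` B) = c A + c B.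
  move=> mA mB AB; apply: uniq => e e0.
  have e3 : 0 < e / 3 by rewrite divr_gt0.
  have [n [n1 n2 n3]] : exists n, [/\ `|\int[mu]_(x in (A `|` B) `&` D) w n x - c (A `|` B)| <= e / 3,
     `|\int[mu]_(x in A `&` D) w n x - c A| <= e / 3 & `|\int[mu]_(x in B `&` D) w n x - c B| <= e / 3].
    have FU : Filter U by exact: filter_filter.
    have := @filterI _ U FU _ _ (Hc _ (measurableU _ _ mA mB) _ e3)
      (@filterI _ U FU _ _ (Hc _ mA _ e3) (Hc _ mB _ e3)).
    by move=> /filter_ex[n [h1 [h2 h3]]]; exists n; split.
  have E : \int[mu]_(x in (A `|` B) `&` D) w n x =
      \int[mu]_(x in A `&` D) w n x + \int[mu]_(x in B `&` D) w n x.
    rewrite setIUl Rintegral_setU//; try exact: measurableI.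
    - apply: (@intble_sub _ _ _ _ D) => //; first by apply: measurableU; exact: measurableI.
        by move=> x [[]|[]].
      exact: L2on_intble (wL n).
    - by apply/eqP; rewrite setIACA AB set0I.
  move: n1 n2 n3; rewrite E.
  rewrite !ler_norml => /andP[? ?] /andP[? ?] /andP[? ?]; apply/andP; split; lra.
have cc (e : R) : 0 < e -> exists2 r : R, 0 < r &
    forall A, measurable A -> (mu (A `&` D) < r%:E)%E -> `|c A| <= e.
  (* With this r, [small_sets] bounds every integral by e / 2; the other half of e pays for the
     distance to the limit. *)
  move=> e0; exists ((e / 2) ^+ 2 / (C + 1)).
    by rewrite divr_gt0 ?exprn_gt0 ?divr_gt0 ?ltr_pwDr.
  move=> A mA; rewrite -(fineK (fin A mA)) lte_fin => h.
  have e2 : 0 < e / 2 by rewrite divr_gt0.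
  have /filter_ex[n Hn] := Hc A mA _ e2.
  have h2 : `|\int[mu]_(x in A `&` D) w n x| <= e / 2.
    rewrite -ler_sqr ?nnegrE ?(ltW e2)// real_normK ?num_real//.
    apply: le_trans (small_sets n mA) _.
    have m0 : 0 <= fine (mu (A `&` D)) by rewrite fine_ge0.
    move: h; rewrite ltr_pdivlMr ?ltr_pwDr// => h.
    by apply: le_trans (ltW h); rewrite mulrDr mulr1 mulrC lerDl.
  rewrite -[c A](subrK (\int[mu]_(x in A `&` D) w n x)).
  apply: le_trans (ler_normD _ _) _; rewrite distrC.
  by apply: le_trans (lerD Hn h2) _; rewrite -splitr.
have [f fi fE] := set_function_density mD muD cU cc.
exists f => // A mA AD e e0; have := Hc A mA e e0; rewrite (fE A mA AD).
by rewrite (setIidl AD).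
Qed.

End WeakCompactness.

(** * From indicators to test functions in L^2 *)

Section WeakConvergence.
Context d (T : measurableType d) (R : realType) (mu : {measure set T -> \bar R}).
Variables (D : set T) (mD : measurable D) (muD : (mu D < +oo)%E).

(** Dominated convergence, with dominating function g^2: each point leaves the sets where |g| >=
    n. *)
Lemma L2_tail (g : T -> R) (e : R) : L2on mu D g -> 0 < e -> exists2 K : nat, (0 < K)%N &
  \int[mu]_(x in D) (g x ^+ 2 * \1_(D `&` (fun x => `|g x|) @^-1` `[K%:R, +oo[) x) <= e.
Proof.
move=> [mg ig] e0.
pose A (n : nat) := D `&` (fun x => `|g x|) @^-1` `[n%:R, +oo[.
have mA n : measurable (A n).
  have mn : measurable_fun D (fun x => `|g x|) by exact: measurableT_comp.
  exact: (mn mD).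
have iA n := intble_indic mD (mA n) ig.
have := @dominated_convergence _ _ _ mu D mD
  (fun n x => (g x ^+ 2 * \1_(A n) x)%:E) (fun=> 0%E) (fun x => (g x ^+ 2)%:E)
  (fun n => measurable_int mu (iA n)) _ _ ig _.
case.
- exact: measurable_cst.
- apply: aeW => x Dx; apply: cvg_near_cst.
  exists (Num.truncn `|g x|).+1 => // n /= gn.
  rewrite indicE memNset ?mulr0// => -[_ /=]; rewrite in_itv/= andbT leNgt => /negP; apply.
  by rewrite (lt_le_trans (truncnS_gt _))// ler_nat.
- apply: aeW => x n Dx; rewrite lee_fin indicE normrM ger0_norm ?sqr_ge0//.
  by rewrite ler_piMr ?sqr_ge0//; case: (_ \in _); rewrite ?normr1 ?normr0.
move=> _ _; rewrite integral0 => /fine_cvgP[_ /cvgr0_norm_le/(_ e e0)[K _ HK]].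
exists K.+1 => //; have := HK K.+1 (leqnSn K); exact: le_trans (ler_norm _).
Qed.

Variables (w : nat -> T -> R) (C : R).
Hypothesis wL : forall n, L2on mu D (w n).
Hypothesis wC : forall n, \int[mu]_(x in D) (w n x ^+ 2) <= C.

(** A density argument: g is rounded down to the grid - K + del j, and to 0 outside its range, with
    squared error at most del^2 plus the tail of g. The bound C controls the error by
    Cauchy-Schwarz, the hypothesis the finitely many level sets. *)
Lemma weak_convergence_L2 (F : set_system nat) (g : T -> R) : Filter F ->
  (forall A, measurable A -> A `<=` D -> forall e : R, 0 < e ->
    \forall n \near F, `|\int[mu]_(x in A) w n x| <= e) ->
  L2on mu D g -> forall e : R, 0 < e ->
    \forall n \near F, `|\int[mu]_(x in D) (w n x * g x)| <= e.
Proof.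
move=> FF H gL e e0; have [mg ig] := gL.
have C0 : 0 <= C by apply: le_trans (wC 0%N); apply: Rintegral_ge0 => x _; exact: sqr_ge0.
pose m0 := fine (mu D); have m00 : 0 <= m0 by rewrite fine_ge0.
(* One Q for the rounding and one for the tail: C (2 Q) <= (e / 2)^2. *)
pose Q := (e / 2) ^+ 2 / (C + 1) / 2.
have Q0 : 0 < Q by rewrite !divr_gt0 ?exprn_gt0 ?divr_gt0 ?ltr_pwDr.
have [K K0 tail] := L2_tail gL Q0.
pose del := Num.sqrt (Q / (m0 + 1)).
have del0 : 0 < del by rewrite sqrtr_gt0 divr_gt0// ltr_pwDr.
have del2 : del ^+ 2 = Q / (m0 + 1) by rewrite sqr_sqrtr// ltW// divr_gt0// ltr_pwDr.
(* With m steps the grid covers [- K, K]: m del > 2 K. *)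
pose m := (Num.truncn (2 * K%:R / del)).+1.
pose c (j : nat) : R := - K%:R + del * j%:R.
pose A (j : nat) := D `&` g @^-1` `[c j, c j.+1[.
have mA j : measurable (A j) by exact: (mg mD).
have AD j : A j `<=` D by move=> x [].
pose s x : R := \sum_(j < m) c j * \1_(A j) x.
have indL j : L2on mu D (\1_(A j) : T -> R).
  apply: (@L2on_bounded _ _ _ _ D mD muD _ 1); first exact: measurable_indic.
  by move=> x _; rewrite indicE; case: (_ \in _); rewrite ?normr1 ?normr0.
have sL : L2on mu D s by apply: L2on_sum => // j; exact: L2onZ.
have rL := L2onB mD gL sL.
have rb x : D x -> (g x - s x) ^+ 2 <=
    del ^+ 2 + g x ^+ 2 * \1_(D `&` (fun x => `|g x|) @^-1` `[K%:R, +oo[) x.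
  move=> Dx; have tl : 0 <= g x ^+ 2 * \1_(D `&` (fun x => `|g x|) @^-1` `[K%:R, +oo[) x.
    by rewrite mulr_ge0 ?sqr_ge0.
  have ik j : - K%:R <= g x -> (x \in A j) = (Num.truncn ((g x + K%:R) / del) == j).
    move=> gK; have gK' : 0 <= (g x + K%:R) / del by rewrite divr_ge0 ?(ltW del0)// -lerBlDr sub0r.
    rewrite truncn_eq// ler_pdivlMr// ltr_pdivrMr// ![_%:R * del]mulrC -lerBlDr -ltrBrDr.
    rewrite ![_ - K%:R]addrC.
    apply/idP/idP; first by move/set_mem => -[_ /=]; rewrite in_itv.
    by move=> h; apply: mem_set; split => //=; rewrite in_itv.
  have [gK|gK] := boolP (- K%:R <= g x); last first.
    have -> : s x = 0.
      rewrite /s big1// => j _; rewrite indicE memNset ?mulr0// => -[_ /=]; rewrite in_itv/= => /andP[h _].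
      move: gK; rewrite (le_trans _ h)// /c lerDl mulr_ge0// ltW//.
    rewrite subr0 indicE mem_set ?mulr1 ?lerDr ?sqr_ge0//; split => //=.
    rewrite in_itv/= andbT; move: gK; rewrite -ltNge => gK.
    by rewrite ltr0_norm; [rewrite lerNr ltW|rewrite (lt_le_trans gK)// oppr_le0].
  pose k0 := Num.truncn ((g x + K%:R) / del).
  have [k0m|k0m] := ltnP k0 m.
    have -> : s x = c k0.
      rewrite /s (bigD1 (Ordinal k0m))//= big1 ?addr0; first by rewrite indicE ik// eqxx mulr1.
      move=> j jk; rewrite indicE ik// (_ : (_ == _) = false) ?mulr0//.
      by apply/negbTE; move: jk; apply: contra => /eqP kk; apply/eqP/val_inj.
    have /set_mem[_ /=] : x \in A k0 by rewrite ik.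
    rewrite in_itv/= => /andP[h1 h2].
    have h3 : 0 <= g x - c k0 by rewrite subr_ge0.
    have h4 : g x - c k0 <= del.
      by rewrite lerBlDl (le_trans (ltW h2))// /c -natr1 mulrDr mulr1 addrA.
    apply: (@le_trans _ _ (del ^+ 2)); last by rewrite lerDl.
    by rewrite ler_sqr ?nnegrE// ltW.
  have -> : s x = 0.
    rewrite /s big1// => j _; rewrite indicE ik// (_ : (_ == _) = false) ?mulr0//.
    by apply/negbTE; rewrite neq_ltn (leq_trans (ltn_ord j) k0m) orbT.
  rewrite subr0 indicE mem_set ?mulr1 ?lerDr ?sqr_ge0//; split => //=.
  rewrite in_itv/= andbT; apply: le_trans (ler_norm _).
  have : m%:R <= (g x + K%:R) / del.
    by rewrite -truncn_ge_nat// divr_ge0 ?(ltW del0)// -lerBlDr sub0r.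
  rewrite ler_pdivlMr// => h5.
  have : 2 * K%:R <= m%:R * del.
    by rewrite -ler_pdivrMr//; apply/ltW; exact: truncnS_gt.
  by move: h5; move: (m%:R * del) => q; lra.
have r2 : \int[mu]_(x in D) ((g x - s x) ^+ 2) <= 2 * Q.
  have [_ ir] := rL.
  have mK : measurable (D `&` (fun x => `|g x|) @^-1` `[K%:R, +oo[).
    by have mn : measurable_fun D (fun x => `|g x|); [exact: measurableT_comp|exact: (mn mD)].
  have it := intble_indic mD mK ig.
  have ic : intble mu D (fun=> del ^+ 2).
    by apply: (@intble_bounded _ _ _ _ D mD muD _ `|del ^+ 2|).
  apply: le_trans (le_Rintegral mD ir (intbleD mD ic it) rb) _.
  rewrite (RintegralD mD ic it) Rintegral_cst// -/m0 del2 mulr_natl mulr2n; apply: lerD => //.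
  by rewrite mulrAC ler_pdivrMr ?ltr_pwDr// ler_pM2l// lerDl.
pose S : R := \sum_(j < m) `|c j|.
have S0 : 0 <= S by apply: sumr_ge0.
have e'0 : 0 < e / 2 / (S + 1) by rewrite !divr_gt0// ltr_pwDr.
have := filter_forall FF (fun j : 'I_m => H _ (mA j) (AD j) _ e'0).
apply: filterS => n Hn.
have wA j : intble mu D (fun x => c j * (w n x * \1_(A j) x)).
  by apply: intbleZ => //; exact: intble_indic (mA j) (L2on_intble mD muD (wL n)).
have -> : \int[mu]_(x in D) (w n x * g x) = \int[mu]_(x in D) (w n x * (g x - s x)) +
    \sum_(j < m) c j * \int[mu]_(x in A j) w n x.
  have -> : \sum_(j < m) c j * \int[mu]_(x in A j) w n x =
      \int[mu]_(x in D) (\sum_(j < m) c j * (w n x * \1_(A j) x)).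
    rewrite Rintegral_sum//; apply: eq_bigr => j _.
    have <- : \int[mu]_(x in D) (w n x * \1_(A j) x) = \int[mu]_(x in A j) w n x.
      by apply: Rintegral_indic.
    rewrite RintegralZl//; exact: intble_indic (mA j) (L2on_intble mD muD (wL n)).
  rewrite -RintegralD//; [|exact: intble_mul|by apply: intble_sum].
  apply: eq_Rintegral => x _; rewrite mulrBr /s mulr_sumr.
  by under [X in _ - X]eq_bigr do rewrite mulrCA; rewrite subrK.
apply: le_trans (ler_normD _ _) _; rewrite [leRHS]splitr; apply: lerD.
  rewrite -ler_sqr ?nnegrE ?divr_ge0 ?(ltW e0)// real_normK ?num_real//.
  apply: le_trans (Rintegral_CauchySchwarz mD (wL n) rL) _.
  apply: (@le_trans _ _ (C * (2 * Q))).
    by apply: ler_pM => //; apply: Rintegral_ge0 => x _; exact: sqr_ge0.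
  rewrite /Q [2 * _]mulrC divfK// mulrCA ger_pMr ?exprn_gt0 ?divr_gt0//.
  by rewrite ler_pdivrMr ?ltr_pwDr// mul1r lerDl.
apply: le_trans (ler_norm_sum _ _ _) _.
apply: (@le_trans _ _ (\sum_(j < m) `|c j| * (e / 2 / (S + 1)))).
  by apply: ler_sum => j _; rewrite normrM ler_wpM2l//; exact: Hn.
rewrite -mulr_suml -/S mulrCA ger_pMr ?divr_gt0//.
by rewrite ler_pdivrMr ?ltr_pwDr// mul1r lerDl.
Qed.

End WeakConvergence.

(** * Nonmeasurable comparison with a factor *)

Section NonmeasurableScaling.
Context d {T : measurableType d} {R : realType} (mu : {measure set T -> \bar R}).
Variables (D : set T) (mD : measurable D).
Local Open Scope ereal_scope.
Import HBNNSimple.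

(** If a simple function h lies below f, then h / k lies below g; the factor k is only taken out of
    the integral of h. *)
Lemma le_integralZ_nonmeasurable (f g : T -> \bar R) (k : R) : (0 < k)%R ->
  (forall x, D x -> 0 <= f x) -> (forall x, D x -> 0 <= g x) ->
  (forall x, D x -> f x <= k%:E * g x) ->
  \int[mu]_(x in D) f x <= k%:E * \int[mu]_(x in D) g x.
Proof.
move=> k0 f0 g0 fg.
rewrite [leLHS]integral_mkcond ge0_integralTE; last exact: erestrict_ge0.
apply: ge_ereal_sup => _ [h hf <-]; rewrite -integralT_nnsfun.
have hD x : ~ D x -> h x = 0%R.
  move=> Dx; have := hf x; rewrite patchE memNset// lee_fin => hx.
  by apply/eqP; rewrite eq_le hx/=.
have -> : \int[mu]_x (h x)%:E = \int[mu]_(x in D) (k%:E * (k^-1 * h x)%:E).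
  rewrite [RHS]integral_mkcond; apply: eq_integral => x _.
  rewrite patchE; case: ifPn => [_|/negP]; last by rewrite inE => /hD ->.
  by rewrite -EFinM mulrA divff ?gt_eqF// mul1r.
have mh : measurable_fun D h by apply: measurable_funTS.
rewrite ge0_integralZl//; first last.
- by rewrite lee_fin ltW.
- by move=> x _; rewrite lee_fin mulr_ge0// invr_ge0 ltW.
- by apply/measurable_EFinP; exact: measurable_funM.
rewrite lee_pmul2l ?lte_fin//; apply: le_integral_nonmeasurable => x Dx.
  by rewrite lee_fin mulr_ge0// invr_ge0 ltW.
have := hf x; rewrite patchE mem_set// => /le_trans/(_ (fg x Dx)).
move=> h1; rewrite -(@lee_pmul2l _ k%:E) ?lte_fin//.
by rewrite -EFinM mulrA divff ?gt_eqF// mul1r.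
Qed.

Lemma le_integralDZ_nonmeasurable (f g : T -> \bar R) (h : T -> R) (k : R) : (0 < k)%R ->
  measurable_fun D h -> (forall x, D x -> (0 <= h x)%R) ->
  (forall x, D x -> 0 <= f x) -> (forall x, D x -> 0 <= g x) ->
  (forall x, D x -> f x <= k%:E * g x + (h x)%:E) ->
  \int[mu]_(x in D) f x <= k%:E * \int[mu]_(x in D) g x + \int[mu]_(x in D) (h x)%:E.
Proof.
move=> k0 mh h0 f0 g0 fgh.
have kg0 x : D x -> 0 <= k%:E * g x by move=> Dx; rewrite mule_ge0 ?g0// lee_fin ltW.
apply: (@le_trans _ _ (\int[mu]_(x in D) (k%:E * g x) + \int[mu]_(x in D) (h x)%:E)).
  by apply: (le_integralD_nonmeasurable mD measurable0) => // x Dx _; exact: fgh.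
by rewrite leeD2r//; exact: le_integralZ_nonmeasurable.
Qed.

End NonmeasurableScaling.

(** * Essential bounds and signs *)

Section EssentialBounds.
Context d {T : measurableType d} {R : realType} (mu : {measure set T -> \bar R}).

Lemma Lfun_inftyP (f : T -> R) : f \in Lfun mu +oo%E <->
  measurable_fun setT f /\ exists2 M : R, 0 <= M & {ae mu, forall x, `|f x| <= M}.
Proof.
rewrite inE; split.
- move=> /andP[]; rewrite !inE => mf; split => //.
  move: b; rewrite /= /finite_norm unlock /=; case: ifPn => [_ fin|mu0 _]; last first.
    (* The whole space is null in this case, so the bound 0 holds almost everywhere. *)
    exists 0 => //; exists setT; split => //.
    by apply/eqP; rewrite eq_le measure_ge0 andbT leNgt.
  exists `|fine (ess_sup mu (abse \o (EFin \o f)))| => //.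
  have := ess_sup_ge mu (abse \o (EFin \o f)); apply: filterS => x /=.
  move: fin; case: (ess_sup _ _) => [r _|//|//] /=.
  by rewrite lee_fin => /le_trans; apply; exact: ler_norm.
- move=> [mf [M M0 fM]]; apply/andP; rewrite !inE; split => //=.
  rewrite /finite_norm unlock /=; case: ifPn => // _.
  apply: (@le_lt_trans _ _ M%:E); last exact: ltry.
  by apply/ess_supP; move: fM; apply: filterS => x; rewrite /= lee_fin.
Qed.

(** The integral over the set where f < 0 is both nonnegative and nonpositive, so f vanishes almost
    everywhere on it. *)
Lemma ae_ge0_of_integral (D : set T) (f : T -> R) : measurable D -> intble mu D f ->
  (forall A, measurable A -> A `<=` D -> 0 <= \int[mu]_(x in A) f x) ->
  {ae mu, forall x, D x -> 0 <= f x}.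
Proof.
move=> mD fi H; pose A := D `&` f @^-1` `]-oo, 0[.
have mA : measurable A by exact: (intble_measurable fi mD).
have AD : A `<=` D by move=> x [].
have Ai : intble mu A f by exact: intble_sub fi.
have fA x : A x -> f x < 0 by move=> [_]; rewrite /= in_itv.
have I0 : (\int[mu]_(x in A) `|(f x)%:E| = 0)%E.
  have -> : (\int[mu]_(x in A) `|(f x)%:E| = \int[mu]_(x in A) (- f x)%:E)%E.
    by apply: eq_integral => x /set_mem /fA fx; rewrite /= ltr0_norm.
  rewrite -EFin_Rintegral//; last exact: intbleN.
  rewrite RintegralN//; congr EFin; apply/eqP; rewrite oppr_eq0 eq_le H// andbT.
  rewrite -oppr_ge0 -RintegralN//; apply: Rintegral_ge0 => x Ax.
  by rewrite oppr_ge0 ltW// fA.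
have /(ae_eq_integral_abs mu mA (measurable_int mu Ai)) [N [mN N0 sN]] := I0.
exists N; split => // x /= /not_implyP[Dx fx]; apply: sN => /= /(_ _)h.
have Ax : A x by split => //=; rewrite in_itv/= ltNge; exact/negP.
by have fx0 := EFin_inj (h Ax); move: (fA x Ax); rewrite fx0 ltxx.
Qed.

End EssentialBounds.

(** * Weak limits of functions between two bounds *)

Section BoundedWeakCompactness.
Context d (T : measurableType d) (R : realType) (mu : {measure set T -> \bar R}).
Variables (D : set T) (mD : measurable D) (muD : (mu D < +oo)%E).

Lemma ae_Rintegral_le (A : set T) (f g : T -> R) : measurable A -> A `<=` D ->
  intble mu D f -> intble mu D g -> {ae mu, forall x, D x -> f x <= g x} ->
  \int[mu]_(x in A) f x <= \int[mu]_(x in A) g x.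
Proof.
move=> mA AD fi gi fg.
rewrite -subr_ge0 -RintegralB//; [|exact: intble_sub gi|exact: intble_sub fi].
rewrite (@Rintegral_ae_nonmeasurable _ _ _ _ _ mA _ (fun x => Num.max (g x - f x) 0)).
  by apply: Rintegral_ge0 => x _; rewrite le_max lexx orbT.
by move: fg; apply: ae_mono => x h /AD /h; rewrite -subr_ge0 => /max_idPl ->.
Qed.

(** The integrals over every measurable set pass to the limit, and so do the inequalities between
    them; they yield the pointwise bounds almost everywhere. *)
Lemma bounded_weak_compactness (U : set_system nat) (un : nat -> T -> R) (a b : T -> R) (M : R) :
  UltraFilter U ->
  (forall n, measurable_fun setT (un n)) -> (forall n x, `|un n x| <= M) ->
  measurable_fun setT a -> (forall x, `|a x| <= M) ->
  measurable_fun setT b -> (forall x, `|b x| <= M) ->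
  (forall n, {ae mu, forall x, D x -> a x <= un n x <= b x}) ->
  exists f : T -> R, [/\ measurable_fun setT f, forall x, `|f x| <= M,
    {ae mu, forall x, D x -> a x <= f x <= b x} &
    forall g, L2on mu D g -> forall e : R, 0 < e ->
      \forall n \near U, `|\int[mu]_(x in D) ((un n x - f x) * g x)| <= e].
Proof.
move=> UU mun unM ma aM mb bM ab.
have UP : ProperFilter U by exact: ultra_proper.
have bL (f : T -> R) : measurable_fun setT f -> (forall x, `|f x| <= M) -> L2on mu D f.
  by move=> mf fM; apply: (@L2on_bounded _ _ _ _ D mD muD _ M) => //; exact: measurable_funTS.
have bi (f : T -> R) mf fM := L2on_intble mD muD (bL f mf fM).
pose m0 := fine (mu D).
have sq (K : R) (f : T -> R) : L2on mu D f -> (forall x, `|f x| <= K) -> \int[mu]_(x in D) (f x ^+ 2) <= K ^+ 2 * m0.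
  move=> [mf ff] fK; rewrite /m0 -Rintegral_cst//; apply: le_Rintegral => //.
    by apply: (@intble_bounded _ _ _ _ D mD muD _ (K ^+ 2)) => // x _; rewrite ger0_norm ?sqr_ge0.
  by move=> x _; rewrite -real_normK ?num_real// ler_sqr ?nnegrE// (le_trans _ (fK x)).
have [f0 f0i f0E] := weak_compactness mD muD (fun n => bL _ (mun n) (unM n))
  (fun n => sq M _ (bL _ (mun n) (unM n)) (unM n)) UU.
have below : {ae mu, forall x, D x -> 0 <= f0 x - a x}.
  apply: ae_ge0_of_integral => //; first exact: intbleB (bi a ma aM).
  move=> A mA AD; rewrite RintegralB//; [|exact: intble_sub f0i|exact: intble_sub (bi a ma aM)].
  rewrite subr_ge0; apply/ler_addgt0Pr => e e0.
  have /filter_ex[n] := f0E A mA AD e e0; rewrite ler_norml => /andP[_ h].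
  apply: (@le_trans _ _ (\int[mu]_(x in A) un n x)); last by rewrite -lerBlDl.
  apply: ae_Rintegral_le => //; [exact: bi|exact: bi|].
  by move: (ab n); apply: ae_mono => x H /H/andP[].
have above : {ae mu, forall x, D x -> 0 <= b x - f0 x}.
  apply: ae_ge0_of_integral => //; first exact: intbleB (bi b mb bM) _.
  move=> A mA AD; rewrite RintegralB//; [|exact: intble_sub (bi b mb bM)|exact: intble_sub f0i].
  rewrite subr_ge0; apply/ler_addgt0Pr => e e0.
  have /filter_ex[n] := f0E A mA AD e e0; rewrite ler_norml => /andP[h _].
  apply: (@le_trans _ _ (\int[mu]_(x in A) un n x + e)); first by clear -h; lra.
  rewrite lerD2r; apply: ae_Rintegral_le => //; [exact: bi|exact: bi|].
  by move: (ab n); apply: ae_mono => x H /H/andP[].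
(* Truncation gives a representative bounded by M everywhere. It agrees with [f0] almost everywhere
   on D, where [f0] lies between a and b. *)
pose f x := Num.max (- M) (Num.min M ((f0 \_ D) x)).
have mf : measurable_fun setT f.
  apply: measurable_maxr; first exact: measurable_cst.
  apply: measurable_minr; first exact: measurable_cst.
  by have /intble_patch/intble_measurable := f0i; apply.
have fM x : `|f x| <= M.
  have M0 : 0 <= M by exact: le_trans (aM x).
  rewrite /f ler_norml le_max lexx/= ge_max ge_min lexx/= andbT.
  by rewrite (le_trans _ M0)// oppr_le0.
have ff0 : {ae mu, forall x, D x -> f x = f0 x}.
  have := ae_and below above; apply: ae_mono => x [h1 h2] Dx.
  have := aM x; have := bM x; rewrite !ler_norml /f patchE mem_set// => /andP[_ h3] /andP[h4 _].
  have := h1 Dx; have := h2 Dx; rewrite !subr_ge0 => h5 h6.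
  by rewrite min_r ?max_r// ?(le_trans h4)// (le_trans h5).
exists f; split => //.
  have := ae_and ff0 (ae_and below above); apply: ae_mono => x [h [h1 h2]] Dx.
  by have := h1 Dx; have := h2 Dx; rewrite h// !subr_ge0 => -> ->.
move=> g gL; apply: (@weak_convergence_L2 _ _ _ mu D mD muD (fun n x => un n x - f x) ((M + M) ^+ 2 * m0)) => //.
- by move=> n; apply: L2onB => //; exact: bL.
- move=> n; apply: sq; first by apply: L2onB => //; exact: bL.
  by move=> x; apply: le_trans (ler_normB _ _) _; exact: lerD.
move=> A mA AD e e0; have := f0E A mA AD e e0; apply: filterS => n.
rewrite RintegralB//; [|exact: intble_sub (bi _ (mun n) (unM n))|exact: intble_sub (bi f mf fM)].
rewrite [X in _ -> `|_ - X| <= _](@Rintegral_ae_nonmeasurable _ _ _ _ _ mA _ f0)//.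
by move: ff0; apply: ae_mono => x h /AD.
Qed.

End BoundedWeakCompactness.

(** * Weak compactness of the controls *)

Section ControlCompactness.
Variables (R : realType) (N : nat) (l : 'I_N -> R) (T : R).
Hypotheses (hl : forall i, 0 < l i) (T0 : 0 < T).
Local Notation CT := (control R N).
Local Notation cyl := (cylinder l T).
Implicit Types (u : CT) (i : 'I_N).

Lemma measurable_cylinder i : measurable (cyl i).
Proof. by apply: measurableX; exact: measurable_itv. Qed.

Lemma cylinder_lty i : (leb2 (cyl i) < +oo)%E.
Proof.
rewrite product_measure1E; [|exact: measurable_itv|exact: measurable_itv].
by apply: lte_mul_pinfty => //; rewrite ?ge0_fin_numE//; exact: lebesgue_itv_lty.
Qed.

Lemma Linfty_bounded u : Linfty l T u ->
  exists2 M : R, 0 <= M & forall i, {ae leb2, forall z : R * R, z \in cyl i -> `|u i z| <= M}.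
Proof.
move=> uL.
have /boolp.choice[m Hm] : forall i, exists m : R, 0 <= m /\
    {ae leb2, forall z : R * R, z \in cyl i -> `|u i z| <= m}.
  move=> i; have /Lfun_inftyP[_ [m m0 H]] := uL i.
  exists m; split => //; move: H; apply: ae_mono => z; rewrite patchE.
  by case: ifP.
exists (\sum_i m i); first by apply: sumr_ge0 => i _; have [] := Hm i.
move=> i; have [_] := Hm i; apply: ae_mono => z H /H /le_trans; apply.
rewrite (bigD1 i)//= lerDl sumr_ge0// => j _; by have [] := Hm j.
Qed.

Lemma bounded_Linfty M u : bounded_control M u -> Linfty l T u.
Proof.
move=> uM i; have [mu hu] := uM i; apply/Lfun_inftyP; split.
  apply/measurable_restrict => //; [exact: measurable_cylinder|by apply: measurable_funTS].
exists M; first exact: (bounded_control_ge0 i uM).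
apply: aeW => z; rewrite patchE; case: ifP => // _.
by rewrite normr0; exact: (bounded_control_ge0 i uM).
Qed.

Lemma truncate_ae M u i : {ae leb2, forall z : R * R, z \in cyl i -> `|u i z| <= M} ->
  {ae leb2, forall z : R * R, cyl i z -> truncate l T M u i z = u i z}.
Proof. by apply: ae_mono => z h cz; rewrite truncateE// h// mem_set. Qed.

Lemma control_weak_compactness (U : set_system nat) (un : nat -> CT) (a b : CT) (M : R) :
  UltraFilter U -> (forall n, bounded_control M (un n)) ->
  bounded_control M a -> bounded_control M b ->
  (forall n i, {ae leb2, forall z : R * R, cyl i z -> a i z <= un n i z <= b i z}) ->
  exists f : CT, [/\ bounded_control M f,
    forall i, {ae leb2, forall z : R * R, cyl i z -> a i z <= f i z <= b i z} &
    forall i g, L2on leb2 (cyl i) g -> forall e : R, 0 < e ->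
      \forall n \near U, `|\int[leb2]_(z in cyl i) ((un n i z - f i z) * g z)| <= e].
Proof.
move=> UU uM aM bM ab.
have /boolp.choice[f Hf] i := @bounded_weak_compactness _ _ R leb2 (cyl i)
  (measurable_cylinder i) (cylinder_lty i) U (fun n => un n i) (a i) (b i) M UU
  (fun n => (uM n i).1) (fun n => (uM n i).2) (aM i).1 (aM i).2 (bM i).1 (bM i).2 (fun n => ab n i).
exists f; split.
- by move=> i; have [] := Hf i.
- by move=> i; have [] := Hf i.
- by move=> i; have [_ _ _] := Hf i.
Qed.

(** Weak convergence on the cylinder is tested with the product of f(x) and the indicator of ]s, t[
    in time, and Fubini gives the iterated integral. *)
Lemma edge_weak_limit (F : set_system nat) (w : nat -> CT) (M : R) : Filter F ->
  (forall n, bounded_control M (w n)) ->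
  (forall i g, L2on leb2 (cyl i) g -> forall e : R, 0 < e ->
      \forall n \near F, `|\int[leb2]_(z in cyl i) (w n i z * g z)| <= e) ->
  forall (i : 'I_N) (f : R -> R) (s t : R), L2on leb `]0, l i[ f ->
  0 <= s -> s <= t -> t <= T -> forall e : R, 0 < e -> \forall n \near F,
    `|\int[leb]_(r in `]s, t[) (\int[leb]_(x in `]0, l i[) (w n i (x, r) * f x))| <= e.
Proof.
move=> FF wM H i f s t [mf f2] s0 st tT e e0.
have mst : measurable ([set` `]0, l i[] `*` [set` `]s, t[] : set (R * R)).
  by apply: measurableX; exact: measurable_itv.
have sub : [set` `]0, l i[] `*` [set` `]s, t[] `<=` cyl i.
  move=> [x r] [/= h1 h2]; split => //=; apply: subset_itv h2; rewrite bnd_simp//.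
have fi : intble leb `]0, l i[ f.
  apply: (@L2on_intble _ _ R leb `]0, l i[ (measurable_itv _) _ f) => //; exact: lebesgue_itv_lty.
have lift (h : R -> R) : intble leb `]0, l i[ h -> intble leb2 (cyl i) (fun z => h z.1).
  move=> hi; have := @intble_section_prod _ _ _ _ R leb leb `]0, l i[ `]0, T[ h (fun=> 1) (fun=> 1) 1
    (measurable_itv _) (measurable_itv _) hi (intble_cst _ _ _) (measurable_cst _) (fun=> _).
  rewrite (_ : (fun z : R * R => 1 * (h z.1 * 1)) = fun z => h z.1).
    by apply => z; rewrite normr1.
  by apply/funext => z; rewrite mulr1 mul1r.
have gL : L2on leb2 (cyl i) (fun z => \1_([set` `]0, l i[] `*` [set` `]s, t[]) z * f z.1).
  apply: (@L2on_mulb _ _ R leb2 (cyl i) (measurable_cylinder i) (fun z => f z.1) _ 1).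
  - exact: measurable_indic.
  - by move=> x _; rewrite indicE; case: (_ \in _); rewrite ?normr1 ?normr0.
  by split; [exact: intble_measurable (lift f fi)|exact: lift f2].
have := H i _ gL e e0; apply: filterS => n.
rewrite (advection_edge_prod s t (wM n) fi).
rewrite (_ : \int[leb2]_(z in cyl i) _ = \int[leb2]_(z in [set` `]0, l i[] `*` [set` `]s, t[]) (w n i z * f z.1))//.
have := @Rintegral_indic _ _ R leb2 (cyl i) (fun z => w n i z * f z.1) _ mst sub => <-.
by apply: eq_Rintegral => z _; rewrite -mulrA [f _ * _]mulrC.
Qed.

End ControlCompactness.

(** * Lower semicontinuity of the cost and existence *)

Section TerminalConvergence.
Variables (R : realType) (N : nat) (l D : 'I_N -> R).
Hypotheses (hN : (0 < N)%N) (hl : forall i, 0 < l i) (hD : forall i, 0 < D i).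
Local Notation NF := (network_fun R N).
Local Notation dot := (dot_L2 l).
Local Notation inL2 := (inL2 l).
Local Notation nrm := (nrm l).
Local Notation solP := (solP l D).
Local Notation solK := (solK l D).
Local Notation energy := (energy l D).
Implicit Types (u v g : NF) (i : 'I_N).

Lemma nrm_sub_sqr u v : inL2 u -> inL2 v -> nrm (u - v) ^+ 2 <= 2 * nrm u ^+ 2 + 2 * nrm v ^+ 2.
Proof.
move=> uL vL; have h := ler_nrmB uL vL; have := nrm_ge0 l (u - v).
move: (nrm (u - v)) (nrm u) (nrm v) h => a b c h a0.
have h2 : a ^+ 2 <= (b + c) ^+ 2 by rewrite ler_sqr ?nnegrE// (le_trans a0 h).
by have := sqr_ge0 (b - c); move: h2; rewrite sqrrB sqrrD !mulr2n; lra.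
Qed.

(** The parallelogram identity for the form (u, K v), without the nonnegative energy of u + v. *)
Lemma energy_sub u v : inL2 u -> inL2 v -> energy (u - v) <= 2 * energy u + 2 * energy v.
Proof.
move=> uL vL; have dL := inL2B uL vL; have sL := inL2D uL vL.
have h1 : dot (u - v) (solK u) = dot (u - v) (solK (u - v)) + dot (u - v) (solK v).
  by rewrite -(dot_solKD hN hl hD dL dL vL) subrK.
have := energy_ge0 hN hl hD sL; move: h1; rewrite /energy.
rewrite (dot_solKD hN hl hD sL uL vL).
rewrite (dotBl uL vL (solK_inL2 D hl uL)) (dotBl uL vL (solK_inL2 D hl vL)).
rewrite (dotDl uL vL (solK_inL2 D hl uL)) (dotDl uL vL (solK_inL2 D hl vL)).
rewrite (dot_solKC hN hl hD vL uL).
move: (dot _ _) (dot _ _) (dot _ _) (dot _ _) => a b c k; lra.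
Qed.

Lemma energy_nrm0 u v : inL2 u -> inL2 v -> nrm (u - v) = 0 -> energy u = energy v.
Proof.
move=> uL vL uv; apply/eqP; rewrite -subr_eq0 (energyB hN hl hD uL vL) -normr_le0.
apply: le_trans (le_dot_nrm (inL2B uL vL) (solK_inL2 D hl (inL2D uL vL))) _.
by rewrite uv mul0r.
Qed.

Lemma nrm_ae0 u v : (forall i, {ae leb, forall x : R, x \in `]0, l i[ -> u i x = v i x}) ->
  nrm (u - v) = 0.
Proof.
move=> uv; rewrite /nrm /dot_L2 big1 ?sqrtr0// => i _.
rewrite (@Rintegral_ae_nonmeasurable _ _ R leb _ (measurable_itv _) _ (fun=> 0)).
  by rewrite /Rintegral integral0.
move: (uv i); apply: ae_mono => x h xl; have := h xl.
by change (u i x = v i x -> (u i x - v i x) * (u i x - v i x) = 0) => ->; rewrite subrr mul0r.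
Qed.

(** Average over [x, x + h]: the value at x differs from that at y by the Hoelder bound, and |P v
    (y)| <= ep |P v (y)|^2 + 1 / ep. Small energy and bounded L^2 norm thus give small values at
    points. *)
Lemma solP_pointwise v i x h ep : inL2 v -> 0 <= x -> 0 < h -> x + h <= l i -> 0 < ep ->
  h * `|solP v i x| <= ep * nrm (solP v) ^+ 2 + h * (ep^-1 + Num.sqrt h * nrm v / D i).
Proof.
move=> vL x0 h0 xl ep0; have PL := solP_inL2 D hl vL.
have xh : x <= x + h by rewrite lerDl ltW.
have [_ i2] := PL i; have i2' := intble_itv x0 xl i2.
set K := ep^-1 + _.
have -> : h * `|solP v i x| = \int[leb]_(y in `]x, x + h[) `|solP v i x|.
  by rewrite Rintegral_cst_itv// addrAC subrr add0r mulrC.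
apply: (@le_trans _ _ (\int[leb]_(y in `]x, x + h[) (ep * solP v i y ^+ 2 + K))).
  apply: itv_le; [exact: intble_cst|by apply: ibD; [exact: ibZ|exact: intble_cst]|].
  move=> y /andP[xy yh].
  rewrite -(subrK (solP v i y) (solP v i x)); apply: le_trans (ler_normD _ _) _.
  have h1 := young_le `|solP v i y| ep0; rewrite real_normK ?num_real// in h1.
  rewrite /K addrA addrC; apply: lerD => //.
  rewrite distrC; apply: le_trans (solP_holder hD vL x0 (ltW xy) (le_trans (ltW yh) xl)) _.
  rewrite ler_pM2r ?invr_gt0// ler_wpM2r ?nrm_ge0// ler_wsqrtr// lerBlDl.
  exact: ltW.
rewrite itvD; [|exact: ibZ|exact: intble_cst].
rewrite (Rintegral_cst_itv _ xh) itvZ// [x + h - x]addrAC subrr add0r [K * h]mulrC lerD2r.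
rewrite ler_pM2l// sqr_nrm; apply: le_trans (le_edge_dot _ _ i).
by apply: itv_mono => // y; exact: sqr_ge0.
Qed.

Section AlongUltrafilter.
Variables (U : set_system nat) (z : nat -> NF) (Z : R).
Hypotheses (UU : UltraFilter U) (zL : forall n, inL2 (z n)) (zZ : forall n, nrm (z n) <= Z).
Hypothesis z_energy : forall e : R, 0 < e -> \forall n \near U, energy (z n) <= e.

Lemma solP_vanishes i x : 0 <= x < l i -> forall e : R, 0 < e ->
  \forall n \near U, `|solP (z n) i x| <= e.
Proof.
move=> /andP[x0 xl] e e0; have Z0 : 0 <= Z by exact: le_trans (nrm_ge0 _ _) (zZ 0%N).
have [c c0 Hc] := le_nrm_solP hN hl hD.
have e3 : 0 < e / 3 by rewrite divr_gt0.
pose K := Z / D i; have K0 : 0 <= K by rewrite divr_ge0// ltW.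
pose k := e / 3 / (K + 1).
have k0 : 0 < k by rewrite divr_gt0// ltr_pwDr.
(* h keeps [x, x + h] inside the edge and makes the Hoelder term at most e / 3. With ep = 3 / e, the
   three terms of [solP_pointwise] are at most h e / 3 each. *)
pose h := Num.min (l i - x) (k ^+ 2).
have h0 : 0 < h by rewrite lt_min subr_gt0 xl exprn_gt0.
have hl' : x + h <= l i by rewrite -lerBrDl /h ge_min lexx.
have sh : Num.sqrt h * K <= e / 3.
  have : Num.sqrt h <= k.
    by rewrite -[leRHS](@ger0_norm _ k) ?(ltW k0)// -sqrtr_sqr ler_wsqrtr// /h ge_min lexx orbT.
  move=> /(ler_wpM2r K0)/le_trans; apply.
  by rewrite /k mulrAC ler_pdivrMr ?ltr_pwDr// ler_pM2l// lerDl.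
have ep0 : 0 < (e / 3)^-1 by rewrite invr_gt0.
have en0 : 0 < h * (e / 3) * (e / 3) / c by rewrite divr_gt0// !mulr_gt0.
apply: filterS (z_energy en0) => n En.
have := solP_pointwise (zL n) x0 h0 hl' ep0.
have n2 : (e / 3)^-1 * nrm (solP (z n)) ^+ 2 <= h * (e / 3).
  rewrite mulrC ler_pdivrMr//; apply: le_trans (Hc _ (zL n)) _.
  by rewrite mulrC -ler_pdivlMr.
have n3 : Num.sqrt h * nrm (z n) / D i <= e / 3.
  apply: le_trans sh; rewrite /K -mulrA ler_wpM2l ?sqrtr_ge0// ler_pM2r ?invr_gt0//.
rewrite invrK => n1.
have n4 : h * (e / 3 + Num.sqrt h * nrm (z n) / D i) <= h * (e / 3 + e / 3).
  by rewrite ler_pM2l// lerD2l.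
have := le_trans n1 (lerD n2 n4); rewrite -mulrDr ler_pM2l//.
by move=> /le_trans; apply; lra.
Qed.

(** The primitive of z_i from 0 to x is D_i (P z (0) - P z (x)): the constant c_i cancels. *)
Lemma edge_primitive_vanishes i x : 0 <= x < l i -> forall e : R, 0 < e ->
  \forall n \near U, `|\int[leb]_(y in `]0, x[) z n i y| <= e.
Proof.
move=> xl e e0; have e2 : 0 < e / (2 * D i) by rewrite divr_gt0// mulr_gt0.
have l0 : 0 <= (0 : R) < l i by rewrite lexx hl.
have FU : Filter U by exact: filter_filter.
apply: filterS2 (solP_vanishes xl e2) (solP_vanishes l0 e2) => n h1 h2.
have -> : \int[leb]_(y in `]0, x[) z n i y = D i * (solP (z n) i 0 - solP (z n) i x).
  rewrite /solP -mulrBl mulrC divfK ?gt_eqF//.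
  have -> : zeta (z n) i 0 = 0 by exact: Rintegral_itv0.
  by rewrite subr0 opprB addrCA subrr addr0.
rewrite normrM gtr0_norm// mulrC -ler_pdivlMr//.
apply: le_trans (ler_normB _ _) _; apply: le_trans (lerD h2 h1) _.
by rewrite invfM mulrA -mulrDl -splitr.
Qed.

(** On each edge a weak limit exists by compactness, its primitives vanish, so it is zero. The L^2
    bound Z extends to all g in L^2 what small energy gives for test functions in V. *)
Lemma dot_vanishes g : inL2 g -> forall e : R, 0 < e ->
  \forall n \near U, `|dot (z n) g| <= e.
Proof.
move=> gL e e0; have FU : Filter U by exact: filter_filter.
have UP : ProperFilter U by exact: ultra_proper.
have N0 : 0 < N%:R :> R by rewrite ltr0n.
have zC i n : \int[leb]_(x in `]0, l i[) (z n i x ^+ 2) <= Z ^+ 2.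
  apply: le_trans (le_edge_dot _ _ i) _; rewrite -sqr_nrm ler_sqr ?nnegrE ?nrm_ge0//.
  exact: le_trans (nrm_ge0 _ _) (zZ n).
have edge i : \forall n \near U, `|\int[leb]_(x in `]0, l i[) (z n i x * g i x)| <= e / N%:R.
  have [f fi fE] := @weak_compactness _ _ R leb `]0, l i[ (measurable_itv _)
    (lebesgue_itv_lty _ _) (fun n => z n i) (Z ^+ 2) (fun n => zL n i) (zC i) U UU.
  have f0 : {ae leb, forall x : R, x \in `]0, l i[ -> f x = 0}.
    apply: ae0_of_primitive0 => // x /andP[x0 xl].
    apply/eqP; rewrite -normr_le0; apply/ler_addgt0Pr => d d0; rewrite add0r.
    have d2 : 0 < d / 2 by rewrite divr_gt0.
    have xI : 0 <= x < l i by rewrite ltW.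
    have sub : `]0, x[%classic `<=` `]0, l i[%classic.
      by apply: subset_itv; rewrite bnd_simp// ltW.
    have /filter_ex[n [h1 h2]] := @filterI _ U FU _ _ (edge_primitive_vanishes xI d2)
      (fE _ (measurable_itv _) sub _ d2).
    rewrite [d]splitr -[X in `|X|](subrK (\int[leb]_(y in `]0, x[) z n i y)) addrC.
    apply: le_trans (ler_normD _ _) _; apply: lerD => //.
    by rewrite distrC.
  apply: (@weak_convergence_L2 _ _ R leb `]0, l i[ (measurable_itv _)
    (lebesgue_itv_lty _ _) (fun n => z n i) (Z ^+ 2) (fun n => zL n i) (zC i)) => //.
  - move=> A mA AD d d0; have := fE A mA AD d d0; apply: filterS => n.
    rewrite [X in `|_ - X| <= _ -> _](@Rintegral_ae_nonmeasurable _ _ R leb _ mA _ (fun=> 0)).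
      by rewrite [X in `|_ - X|](_ : _ = 0) ?subr0// /Rintegral integral0.
    by move: f0; apply: ae_mono => x h /AD; exact: h.
  - exact: divr_gt0.
apply: filterS (filter_forall FU edge) => n Hn.
apply: le_trans (ler_norm_sum _ _ _) _.
apply: (@le_trans _ _ (\sum_(i < N) (e / N%:R))); first exact: ler_sum.
by rewrite sumr_const card_ord -[_ *+ N]mulr_natr divfK// gt_eqF.
Qed.

End AlongUltrafilter.
End TerminalConvergence.

(** Weighted Young inequality for a - c = (b - c) - (b - a). *)
Lemma sqr_sub_split (R : realFieldType) (a b c del : R) : 0 < del ->
  (a - c) ^+ 2 <= (1 + del) * (b - c) ^+ 2 + (1 + del^-1) * (b - a) ^+ 2.
Proof.
move=> d0; have h : 0 <= del^-1 * (del * (b - c) + (b - a)) ^+ 2.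
  by rewrite mulr_ge0 ?sqr_ge0// invr_ge0 ltW.
have e : del^-1 * (del * (b - c) + (b - a)) ^+ 2 =
    del * (b - c) ^+ 2 + 2 * (b - c) * (b - a) + del^-1 * (b - a) ^+ 2 by field; lra.
by move: h; rewrite e; move: (del^-1) => k; lra.
Qed.

(** * Lower semicontinuity of the terms of the cost *)

Section CostSemicontinuity.
Variables (R : realType) (N : nat) (l : 'I_N -> R) (T : R).
Hypotheses (hl : forall i, 0 < l i) (T0 : 0 < T).
Local Notation NF := (network_fun R N).
Local Notation CT := (control R N).
Local Notation cyl := (cylinder l T).
Local Notation nrm := (nrm l).
Local Notation contL2 := (contL2 l T).
Implicit Types (rho : R -> NF) (u : CT).

(** The weights 1 + del and 1 + 1 / del keep everything that contains [rhod] in one integral; the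
    only separate summand is the difference of the states, continuous in time. The factor N arises
    because each edge is bounded by the full norm. *)
Lemma state_cost_le rho (rho' rhod : R -> NF) (del : R) : contL2 rho -> contL2 rho' -> 0 < del ->
  (\sum_(i < N) \int[leb]_(t in `]0%R, T[) \int[leb]_(x in `]0%R, l i[)
       ((rho t i x - rhod t i x) ^+ 2)%:E <=
   (1 + del)%:E * (\sum_(i < N) \int[leb]_(t in `]0%R, T[) \int[leb]_(x in `]0%R, l i[)
       ((rho' t i x - rhod t i x) ^+ 2)%:E) +
   ((N%:R * ((1 + del^-1) * \int[leb]_(t in `]0, T[) (nrm (rho' t - rho t) ^+ 2)))%R)%:E)%E.
Proof.
move=> cr cr' d0; have cz := contL2B cr' cr; have [zL _] := cz.
have d1 : 0 < 1 + del by rewrite ltr_pwDr.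
have d2 : 0 <= 1 + del^-1 by rewrite addr_ge0// invr_ge0 ltW.
have in0 (v : NF) i : (0 <= \int[leb]_(x in `]0%R, l i[) ((v i x) ^+ 2)%:E)%E.
  by apply: integral_ge0 => x _; rewrite lee_fin sqr_ge0.
have cn : {within `[0, T], continuous (fun t => (1 + del^-1) * nrm (rho' t - rho t) ^+ 2)}.
  move=> x; apply: cvgM; first exact: cvg_cst.
  by apply: cvgM; exact: (contL2_nrm cz).
set K := (1 + del^-1) * _.
rewrite ge0_sume_distrr; last first.
  by move=> i _; apply: integral_ge0 => t _; exact: (in0 (fun i x => rho' t i x - rhod t i x)).
have -> : (N%:R * K)%:E = (\sum_(i < N) K%:E)%E.
  by rewrite sumEFin sumr_const card_ord mulr_natl.
rewrite -big_split; apply: lee_sum => i _ /=.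
have -> : K%:E = (\int[leb]_(t in `]0%R, T[) ((1 + del^-1) * nrm (rho' t - rho t) ^+ 2)%:E)%E.
  rewrite -(@EFin_Rintegral _ _ R leb _ (measurable_itv _) _ (intble_cont cn)).
  congr EFin; rewrite /K -itvZ//; apply: intble_cont => x.
  by apply: cvgM; exact: (contL2_nrm cz).
apply: (@le_integralDZ_nonmeasurable _ _ R leb `]0, T[ (measurable_itv _)) => //.
- exact: intble_measurable (intble_cont cn).
- by move=> t _; rewrite mulr_ge0// sqr_ge0.
- by move=> t _; exact: (in0 (fun i x => rho t i x - rhod t i x)).
- by move=> t _; exact: (in0 (fun i x => rho' t i x - rhod t i x)).
move=> t; rewrite /= in_itv/= => /andP[t0 tT].
have tI : 0 <= t <= T by rewrite !ltW.
have [mz iz] := zL t tI i.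
pose hx (x : R) := (1 + del^-1) * ((rho' t - rho t) i x) ^+ 2.
have ih : intble leb `]0, l i[ hx by exact: ibZ.
apply: le_trans (@le_integralDZ_nonmeasurable _ _ R leb `]0, l i[ (measurable_itv _)
  _ (fun x => ((rho' t i x - rhod t i x) ^+ 2)%:E) hx _ d1 _ _ _ _ _) _.
- exact: intble_measurable ih.
- by move=> x _; rewrite mulr_ge0// sqr_ge0.
- by move=> x _; rewrite lee_fin sqr_ge0.
- by move=> x _; rewrite lee_fin sqr_ge0.
- by move=> x _; rewrite -EFinM -EFinD lee_fin; exact: sqr_sub_split.
rewrite leeD2l// -(@EFin_Rintegral _ _ R leb _ (measurable_itv _) _ ih) lee_fin.
rewrite /hx itvZ// ler_wpM2l// sqr_nrm; exact: le_edge_dot.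
Qed.

Lemma control_cost_EFin (M : R) u (u' : CT) (alpha : 'I_N -> R) : bounded_control M u' ->
  (forall i, {ae leb2, forall z : R * R, cyl i z -> u' i z = u i z}) ->
  (\sum_(i < N) (alpha i)%:E * \int[leb2]_(z in cyl i) ((u i z) ^+ 2)%:E =
   ((\sum_(i < N) alpha i * \int[leb2]_(z in cyl i) (u' i z ^+ 2))%R)%:E)%E.
Proof.
move=> uM uu'; rewrite -sumEFin; apply: eq_bigr => i _; rewrite EFinM; congr (_ * _)%E.
have [_ i2] := @L2on_bounded _ _ R leb2 (cyl i) (measurable_cylinder l T i)
  (cylinder_lty l T i) (u' i) M (measurable_funTS (uM i).1) (fun z _ => (uM i).2 z).
rewrite (@EFin_Rintegral _ _ R leb2 _ (measurable_cylinder l T i) _ i2).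
apply: (@integral_ae_nonmeasurable _ _ R leb2 _ (measurable_cylinder l T i)).
- by move=> z _; rewrite lee_fin sqr_ge0.
- by move=> z _; rewrite lee_fin sqr_ge0.
- by move: (uu' i); apply: ae_mono => z h /h ->.
Qed.

(** Expand the square of u_n = ub + (u_n - ub): the last square is nonnegative, and the cross term
    is the weak convergence tested with [ub]. *)
Lemma control_cost_lower (F : set_system nat) (un : nat -> CT) (ub : CT) (M : R) (alpha : 'I_N -> R) :
  Filter F -> (forall n, bounded_control M (un n)) -> bounded_control M ub ->
  (forall i, 0 < alpha i) ->
  (forall i g, L2on leb2 (cyl i) g -> forall e : R, 0 < e ->
      \forall n \near F, `|\int[leb2]_(z in cyl i) ((un n i z - ub i z) * g z)| <= e) ->
  forall e : R, 0 < e -> \forall n \near F,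
    \sum_(i < N) alpha i * \int[leb2]_(z in cyl i) (ub i z ^+ 2) <=
    \sum_(i < N) alpha i * \int[leb2]_(z in cyl i) (un n i z ^+ 2) + e.
Proof.
move=> FF uM bM al H e e0.
have mc i := measurable_cylinder l T i.
have L u i : bounded_control M u -> L2on leb2 (cyl i) (u i).
  move=> vM; exact: (@L2on_bounded _ _ R leb2 (cyl i) (mc i) (cylinder_lty l T i) (u i) M
    (measurable_funTS (vM i).1) (fun z _ => (vM i).2 z)).
pose S := \sum_i alpha i; have S0 : 0 <= S by apply: sumr_ge0 => i _; rewrite ltW.
have e'0 : 0 < e / (2 * (S + 1)) by rewrite divr_gt0// mulr_gt0// ltr_pwDr.
apply: filterS (filter_forall FF (fun i => H i _ (L _ i bM) _ e'0)) => n Hn.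
have step i : \int[leb2]_(z in cyl i) (ub i z ^+ 2) <=
    \int[leb2]_(z in cyl i) (un n i z ^+ 2) + e / (S + 1).
  have bL := L _ i bM; have uL := L _ i (uM n).
  have dL := @L2onB _ _ R leb2 (cyl i) (mc i) _ _ uL bL.
  have := Hn i; rewrite ler_norml => /andP[+ _].
  have dE := @Rintegral_sqrDZ _ _ R leb2 (cyl i) (mc i) (fun z => ub i z) (fun z => un n i z - ub i z) 1 bL dL.
  have d0 : 0 <= \int[leb2]_(z in cyl i) ((un n i z - ub i z) ^+ 2).
    by apply: Rintegral_ge0 => z _; exact: sqr_ge0.
  have e1 : \int[leb2]_(z in cyl i) (ub i z + 1 * (un n i z - ub i z)) ^+ 2 =
      \int[leb2]_(z in cyl i) (un n i z ^+ 2).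
    by apply: eq_Rintegral => z _; rewrite mul1r addrC subrK.
  have e2 : \int[leb2]_(z in cyl i) (ub i z * (un n i z - ub i z)) =
      \int[leb2]_(z in cyl i) ((un n i z - ub i z) * ub i z).
    by apply: eq_Rintegral => z _; rewrite mulrC.
  move: dE; rewrite e1 e2 expr1n !mulr1 => ->.
  have -> : e / (2 * (S + 1)) = e / (S + 1) / 2 by rewrite invfM mulrA mulrAC.
  move: d0; move: (\int[leb2]_(z in cyl i) _) (\int[leb2]_(z in cyl i) _)
    (\int[leb2]_(z in cyl i) _) (e / (S + 1)) => a b k q; clear; lra.
apply: (@le_trans _ _ (\sum_(i < N) (alpha i * \int[leb2]_(z in cyl i) (un n i z ^+ 2) + alpha i * (e / (S + 1))))).
  by apply: ler_sum => i _; rewrite -mulrDr ler_wpM2l// ltW.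
rewrite big_split/= lerD2l -mulr_suml -/S mulrCA ger_pMr//.
by rewrite ler_pdivrMr ?ltr_pwDr// mul1r lerDl.
Qed.

(** For v the difference of two terminal states and g the deviation of the limit from the target,
    the cross term is the one that [dot_vanishes] makes small. *)
Lemma terminal_cost_lower (v g : NF) : inL2 l v -> inL2 l g ->
  nrm g ^+ 2 <= nrm (v + g) ^+ 2 + 2 * `|dot_L2 l v g|.
Proof.
move=> vL gL; rewrite !sqr_nrm (dotDl vL gL (inL2D vL gL)) (dotDr vL gL vL) (dotDr vL gL gL).
rewrite [dot_L2 l g v]dotC.
have := dot_ge0 l v; have := ler_norm (- dot_L2 l v g); rewrite normrN.
by move: (dot_L2 l v v) (dot_L2 l v g) (dot_L2 l g g) `|_| => a b c k; lra.
Qed.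

End CostSemicontinuity.

Lemma le_double_sum (R : realFieldType) (a b k : R) : a <= k -> b <= k -> 2 * a + 2 * b <= 4 * k.
Proof. lra. Qed.

(** * Strong convergence of the states *)

Section StateConvergence.
Variables (R : realType) (N : nat) (l D : 'I_N -> R) (T : R).
Hypotheses (hN : (0 < N)%N) (hl : forall i, 0 < l i) (hD : forall i, 0 < D i).
Hypothesis T0 : 0 < T.
Local Notation NF := (network_fun R N).
Local Notation CT := (control R N).
Local Notation inL2 := (inL2 l).
Local Notation nrm := (nrm l).
Local Notation solP := (solP l D).
Local Notation solK := (solK l D).
Local Notation energy := (energy l D).
Local Notation advection := (advection l).
Local Notation mild_solution := (mild_solution l D T).

Lemma advection0 r (a q : NF) : advection (fun _ _ => 0) r a q = 0.
Proof.
rewrite /advection big1// => i _.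
by rewrite (@itv_eq _ _ _ _ (fun=> 0)) => [|x _]; rewrite ?mul0r// /Rintegral integral0.
Qed.

(** The energy estimate without source, with a constant common to all controls bounded by M. *)
Lemma mild_energy (M : R) : exists2 C : R, 0 < C & forall u rho,
  bounded_control M u -> mild_solution u rho ->
  (forall t : R, 0 <= t <= T -> energy (rho t) <= C * energy (rho 0)) /\
  \int[leb]_(r in `]0, T[) (nrm (rho r) ^+ 2) <= C * energy (rho 0).
Proof.
have [C C0 HC] := @energy_estimate R N l D T hN hl hD T0 M.
exists C => // u rho uM mr.
have b0 : bounded_control 0 (fun (_ : 'I_N) (_ : R * R) => 0 : R).
  by move=> i; split => [|z]; [exact: measurable_cst|rewrite normr0].
have [|h1 h2] := HC 0 u _ rho rho 0 uM b0 mr.1 (mild_perturbed mr).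
  move=> t tT; rewrite (@itv_eq _ _ _ _ (fun=> 0)) => [|x _]; last exact: advection0.
  by rewrite /Rintegral integral0 normr0.
by rewrite !mulr0 addr0 in h1 h2.
Qed.

(** The energy estimate is used twice: on each state separately, for the uniform bounds that
    [remainder_vanishes] asks, and on the difference, with the remainder now small. *)
Lemma state_convergence (F : set_system nat) (un : nat -> CT) (ub : CT)
    (rhon : nat -> R -> NF) (rhob : R -> NF) (M : R) : Filter F ->
  (forall n, bounded_control M (un n)) -> bounded_control M ub ->
  (forall n, mild_solution (un n) (rhon n)) -> mild_solution ub rhob ->
  (forall n, nrm (rhon n 0 - rhob 0) = 0) ->
  (forall i g, L2on leb2 (cylinder l T i) g -> forall e : R, 0 < e ->
     \forall n \near F, `|\int[leb2]_(z in cylinder l T i) ((un n i z - ub i z) * g z)| <= e) ->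
  forall e : R, 0 < e -> \forall n \near F,
    (forall t : R, 0 <= t <= T -> energy (rhon n t - rhob t) <= e) /\
    \int[leb]_(t in `]0, T[) (nrm (rhon n t - rhob t) ^+ 2) <= e.
Proof.
move=> FF uM bM mn mb init weak e e0.
have T00 : 0 <= (0 : R) <= T by rewrite lexx ltW.
have [C C0 HC] := mild_energy M.
have [C' C'0 HC'] := @energy_estimate R N l D T hN hl hD T0 M.
have [cb _] := mb; have [bL _] := cb.
have nL n t : 0 <= t <= T -> inL2 (rhon n t) by have [[h _] _] := mn n; exact: h.
set E0 := energy (rhob 0).
have E00 : 0 <= E0 by exact: (energy_ge0 hN hl hD (bL 0 T00)).
have nE n : energy (rhon n 0) = E0 by exact: energy_nrm0 (nL n 0 T00) (bL 0 T00) (init n).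
pose zn n t := rhon n t - rhob t.
have pz n := mild_difference hN hl hD (uM n) bM (mn n) mb.
have CE0 : 0 <= C * E0 by rewrite mulr_ge0// ltW.
have En n t : 0 <= t <= T -> energy (zn n t) <= 4 * (C * E0).
  move=> tT; apply: le_trans (energy_sub hN hl hD (nL n t tT) (bL t tT)) _.
  have [h1 _] := HC _ _ (uM n) (mn n); have [h2 _] := HC _ _ bM mb.
  by apply: le_double_sum; [rewrite -(nE n); exact: h1|exact: h2].
have isq rho : contL2 l T rho -> intble leb `]0, T[ (fun r => nrm (rho r) ^+ 2).
  by move=> cr; apply: intble_cont => x; apply: cvgM; exact: (contL2_nrm cr).
have In n : \int[leb]_(r in `]0, T[) (nrm (zn n r) ^+ 2) <= 4 * (C * E0).
  have [cn _] := mn n.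
  have i1 := isq _ cn; have i2 := isq _ cb.
  apply: (@le_trans _ _ (\int[leb]_(r in `]0, T[) (2 * nrm (rhon n r) ^+ 2 + 2 * nrm (rhob r) ^+ 2))).
    apply: itv_le; [exact: isq (contL2B cn cb)|by apply: ibD; exact: ibZ|].
    move=> r /andP[r0 rT]; have rI : 0 <= r <= T by rewrite !ltW.
    exact: nrm_sub_sqr (nL n r rI) (bL r rI).
  rewrite itvD; [|exact: ibZ|exact: ibZ].
  rewrite !itvZ//; have [_ h1] := HC _ _ (uM n) (mn n); have [_ h2] := HC _ _ bM mb.
  rewrite (nE n) in h1; exact: (le_double_sum h1 h2).
(* The initial energy of the difference vanishes, so a remainder of this size turns the estimate
   into e. *)
have S0 : 0 < e / (2 * C') by rewrite divr_gt0// mulr_gt0.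
have := remainder_vanishes hN hl hD T0 (fun n => bounded_controlB (uM n) bM)
  (edge_weak_limit FF (fun n => bounded_controlB (uM n) bM) weak) uM cb pz
  (mulr_ge0 (ler0n R 4) CE0) En In S0.
move=> /(_ FF); apply: filterS => n Hn.
have [h1 h2] := HC' _ _ _ _ _ _ (uM n) (bounded_controlB (uM n) bM) cb (pz n) Hn.
have z0 : energy (rhon n 0 - rhob 0) = 0.
  have zL := inL2B (nL n 0 T00) (bL 0 T00).
  apply/eqP; rewrite -normr_le0; apply: le_trans (le_dot_nrm zL (solK_inL2 D hl zL)) _.
  by rewrite init mul0r.
have eE : C' * (energy (rhon n 0 - rhob 0) + 2 * (e / (2 * C'))) = e.
  by rewrite z0 add0r; field; rewrite gt_eqF.
by rewrite eE in h1 h2.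
Qed.

End StateConvergence.

Lemma nonneg_minimizing_sequence (R : realType) (S : Type) (A : set S) (J : S -> \bar R) (a : S) :
  A a -> (forall u, A u -> 0 <= J u)%E -> ereal_inf (J @` A) != +oo%E ->
  exists2 I0 : R, ereal_inf (J @` A) = I0%:E /\ 0 <= I0 &
    exists un : nat -> S, forall n, A (un n) /\ (J (un n) <= (I0 + n.+1%:R^-1)%:E)%E.
Proof.
move=> Aa J0 Joo.
have inf0 : (0 <= ereal_inf (J @` A))%E.
  by apply: le_ereal_inf_tmp => _ [u Au <-]; exact: J0.
have fin : ereal_inf (J @` A) \is a fin_num by rewrite ge0_fin_numE// ltey.
exists (fine (ereal_inf (J @` A))); first by rewrite fineK// fine_ge0.
have : forall n : nat, exists u, A u /\ (J u <= (fine (ereal_inf (J @` A)) + n.+1%:R^-1)%:E)%E.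
  move=> n; have n0 : 0 < n.+1%:R^-1 :> R by rewrite invr_gt0.
  have [_ [u Au <-] Ju] := lb_ereal_inf_adherent n0 fin.
  by exists u; split => //; rewrite EFinD fineK// ltW.
by move=> /boolp.choice[un Hun]; exists un.
Qed.

Lemma half_sum_le (R : realFieldType) (a b c k q eta : R) : q <= eta / 2 -> c <= k + eta ->
  a <= b + 2 * q -> 2^-1 * a + 2^-1 * c <= 2^-1 * b + 2^-1 * k + eta.
Proof. lra. Qed.

Lemma cost_arith (R : realFieldType) (I0 a r rb I L eta e del : R) :
  0 <= a -> 0 <= r -> 0 <= L -> eta <= 1 -> eta * (4 + L) <= e -> 0 < del ->
  del * (I0 + 1) <= e / 2 -> 2^-1 * a + r <= I0 + eta -> I <= eta -> rb <= r + eta ->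
  2^-1 * ((1 + del) * a + L * I) + rb <= I0 + e.
Proof.
move=> a0 r0 L0 eta1 etaL d0 dI ar Ieta rrb.
have h1 : L * I <= L * eta by rewrite ler_wpM2l.
have h2 : del * (2^-1 * a) <= del * (I0 + 1) by rewrite ler_wpM2l ?(ltW d0)//; lra.
by move: h1 h2; lra.
Qed.

(** * Existence of an optimal control *)

Section Existence.
Variables (R : realType) (N : nat) (l D : 'I_N -> R) (T : R).
Hypotheses (hN : (0 < N)%N) (hl : forall i, 0 < l i) (hD : forall i, 0 < D i).
Hypothesis T0 : 0 < T.
Local Notation NF := (network_fun R N).
Local Notation CT := (control R N).
Local Notation inL2 := (inL2 l).
Local Notation nrm := (nrm l).
Local Notation cyl := (cylinder l T).
Variables (rhod : R -> NF) (rhoT : NF) (alpha : 'I_N -> R).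
Hypotheses (rhoTL : inL2 rhoT) (al : forall i, 0 < alpha i).
Local Notation cost := (cost l T rhod rhoT alpha).

Definition state_cost (rho : R -> NF) : \bar R :=
  (\sum_(i < N) \int[leb]_(t in `]0%R, T[)
       \int[leb]_(x in `]0%R, l i[) ((rho t i x - rhod t i x) ^+ 2)%:E)%E.

Definition control_cost (u : CT) : R :=
  \sum_(i < N) alpha i * \int[leb2]_(z in cyl i) (u i z ^+ 2).

Lemma state_cost_ge0 rho : (0 <= state_cost rho)%E.
Proof.
by apply: sume_ge0 => i _; apply: integral_ge0 => t _; apply: integral_ge0 => x _;
  rewrite lee_fin sqr_ge0.
Qed.

Lemma control_cost_ge0 u : 0 <= control_cost u.
Proof.
apply: sumr_ge0 => i _; rewrite mulr_ge0 ?(ltW (al i))//.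
by apply: Rintegral_ge0 => z _; exact: sqr_ge0.
Qed.

Lemma cost_ge0 rho u : (0 <= cost rho u)%E.
Proof.
rewrite /Defs.cost; apply: adde_ge0; first apply: adde_ge0.
- by rewrite mule_ge0 ?lee_fin ?invr_ge0//; exact: (state_cost_ge0 rho).
- rewrite mule_ge0 ?lee_fin ?invr_ge0//; apply: sume_ge0 => i _.
  by apply: integral_ge0 => x _; rewrite lee_fin sqr_ge0.
- rewrite mule_ge0 ?lee_fin ?invr_ge0//; apply: sume_ge0 => i _.
  rewrite mule_ge0 ?lee_fin ?(ltW (al i))//.
  by apply: integral_ge0 => x _; rewrite lee_fin sqr_ge0.
Qed.

(** The terminal and control terms are real numbers; only the state term has to stay in the extended
    reals. *)
Lemma costE (M : R) rho u (u' : CT) : contL2 l T rho -> bounded_control M u' ->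
  (forall i, {ae leb2, forall z : R * R, cyl i z -> u' i z = u i z}) ->
  cost rho u = ((2^-1)%:E * state_cost rho +
    (2^-1 * nrm (rho T - rhoT) ^+ 2 + 2^-1 * control_cost u')%:E)%E.
Proof.
move=> [rL _] uM uu'; rewrite /Defs.cost (control_cost_EFin alpha uM uu').
have TT : 0 <= T <= T by rewrite lexx ltW.
have := sqnorm_L2E (inL2B (rL T TT) rhoTL); rewrite /sqnorm_L2 => E.
by rewrite [X in (_ + (2^-1)%:E * X + _)%E](_ : _ = (nrm (rho T - rhoT) ^+ 2)%:E)// -addeA EFinD !EFinM.
Qed.

(** For each e, a single index in the intersection of four sets of the ultrafilter is compared with
    the limit, which gives the bound I0 + e. *)
Lemma cost_lower_semicontinuous (U : set_system nat) (un un' : nat -> CT) (ub ub' : CT)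
    (rhon : nat -> R -> NF) (rhob : R -> NF) (M I0 : R) : UltraFilter U ->
  (forall n, bounded_control M (un' n)) -> bounded_control M ub' ->
  (forall n i, {ae leb2, forall z : R * R, cyl i z -> un' n i z = un n i z}) ->
  (forall i, {ae leb2, forall z : R * R, cyl i z -> ub' i z = ub i z}) ->
  (forall n, mild_solution l D T (un' n) (rhon n)) -> mild_solution l D T ub' rhob ->
  (forall n, nrm (rhon n 0 - rhob 0) = 0) ->
  (forall i g, L2on leb2 (cyl i) g -> forall e : R, 0 < e ->
     \forall n \near U, `|\int[leb2]_(z in cyl i) ((un' n i z - ub' i z) * g z)| <= e) ->
  0 <= I0 -> (forall n, (cost (rhon n) (un n) <= (I0 + 1)%:E)%E) ->
  (forall e : R, 0 < e -> \forall n \near U, (cost (rhon n) (un n) <= (I0 + e)%:E)%E) ->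
  (cost rhob ub <= I0%:E)%E.
Proof.
move=> UU uM bM unE ubE mn mb init weak I00 bounded inf.
have FU : Filter U by exact: filter_filter.
have UP : ProperFilter U by exact: ultra_proper.
have TT : 0 <= T <= T by rewrite lexx ltW.
have [cb _] := mb; have cn n := (mn n).1.
have bL := cb.1 T TT; have nL n := (cn n).1 T TT.
have zL n := inL2B (nL n) bL; have gL := inL2B bL rhoTL.
have conv := state_convergence hN hl hD T0 FU uM bM mn mb init weak.
have nrm_bound n : nrm (rhon n T - rhoT) <= 1 + 2 * (I0 + 1).
  have := bounded n; rewrite (costE (cn n) (uM n) (unE n)) => h.
  apply: le_trans (le_1_sqr _) _; rewrite lerD2l mulrC -ler_pdivrMr// mulrC.
  have c0 := control_cost_ge0 (un' n).
  rewrite -lee_fin; apply: le_trans h; rewrite -[leLHS]add0e; apply: leeD.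
    by rewrite mule_ge0 ?lee_fin ?invr_ge0//; exact: state_cost_ge0.
  by rewrite lee_fin lerDl mulr_ge0 ?invr_ge0.
have zZ n : nrm (rhon n T - rhob T) <= 1 + 2 * (I0 + 1) + nrm (rhob T - rhoT).
  have -> : rhon n T - rhob T = (rhon n T - rhoT) - (rhob T - rhoT).
    by rewrite opprB addrA subrK.
  apply: le_trans (ler_nrmB (inL2B (nL n) rhoTL) gL) _; rewrite lerD2r//.
have zE e : 0 < e -> \forall n \near U, energy l D (rhon n T - rhob T) <= e.
  by move=> e0; apply: filterS (conv e e0) => n [h _]; exact: h.
apply/lee_addgt0Pr => e e0.
have [del d0 dI] : exists2 del : R, 0 < del & del * (I0 + 1) <= e / 2.
  by exists (e / 2 / (I0 + 1)); [rewrite !divr_gt0// ltr_pwDr|rewrite divfK// gt_eqF// ltr_pwDr].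
pose L : R := N%:R * (1 + del^-1).
have L0 : 0 <= L by rewrite mulr_ge0// addr_ge0// invr_ge0 ltW.
(* The losses are 2 eta + L eta / 2 = eta (4 + L) / 2 <= e / 2, besides the e / 2 due to [del]; eta
   <= 1 bounds half the state cost by I0 + 1, the factor of [del]. *)
pose eta := Num.min 1 (e / (4 + L)).
have eta0 : 0 < eta by rewrite lt_min ltr01 divr_gt0// ltr_pwDl.
have eta1 : eta <= 1 by rewrite /eta ge_min lexx.
have etaL : eta * (4 + L) <= e.
  by rewrite -ler_pdivlMr ?ltr_pwDl// /eta ge_min lexx orbT.
have eta2 : 0 < eta / 2 by rewrite divr_gt0.
have /filter_ex[n [[[[_ h1] h2] h3] h4]] := @filterI _ U FU _ _ (@filterI _ U FU _ _ (@filterI _ U FU _ _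
  (conv eta eta0) (dot_vanishes hN hl hD UU zL zZ zE gL eta2))
  (control_cost_lower FU uM bM al weak eta0)) (inf eta eta0).
have An0 := state_cost_ge0 (rhon n).
have r0 : 0 <= 2^-1 * nrm (rhon n T - rhoT) ^+ 2 + 2^-1 * control_cost (un' n).
  by rewrite addr_ge0// mulr_ge0 ?invr_ge0 ?sqr_ge0 ?control_cost_ge0.
have rb : 2^-1 * nrm (rhob T - rhoT) ^+ 2 + 2^-1 * control_cost ub' <=
    2^-1 * nrm (rhon n T - rhoT) ^+ 2 + 2^-1 * control_cost (un' n) + eta.
  have := terminal_cost_lower (zL n) gL; rewrite subrKA; exact: half_sum_le h2 h3.
rewrite (costE cb bM ubE).
move: h4; rewrite (costE (cn n) (uM n) (unE n)).
have := @state_cost_le R N l T rhob (rhon n) rhod del cb (cn n) d0.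
rewrite -/(state_cost rhob) -/(state_cost (rhon n)).
move: An0 r0 rb h1.
set r := 2^-1 * nrm (rhon n T - rhoT) ^+ 2 + _; set r' := 2^-1 * nrm (rhob T - rhoT) ^+ 2 + _.
set I := \int[leb]_(t in _) _.
case: (state_cost (rhon n)) => [a|_ _ _ _ _|//]; last first.
  by rewrite gt0_muley ?lte_fin ?invr_gt0// addye// leye_eq.
rewrite lee_fin => a0 r0 rb Ieta; rewrite -EFinM -EFinD => Ab; rewrite -EFinM -EFinD lee_fin => Ja.
apply: (@le_trans _ _ ((2^-1 * ((1 + del) * a + N%:R * ((1 + del^-1) * I)) + r')%:E)).
  by rewrite [leRHS]EFinD leeD2r// [leRHS]EFinM lee_pmul2l ?lte_fin ?invr_gt0.
rewrite -EFinD lee_fin mulrA -/L.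
exact: (cost_arith a0 r0 L0 eta1 etaL d0 dI Ja Ieta rb).
Qed.

End Existence.

Theorem theorem4p1 (R : realType) (N : nat) (hN : (1 <= N)%N)
  (T : R) (hT : 0 < T)
  (l D : 'I_N -> R) (hl : forall i, 0 < l i) (hD : forall i, 0 < D i)
  (rho0 : network_fun R N) (hrho0 : L2_graph l rho0)
  (G : control R N -> R -> network_fun R N)
  (hG : control_to_state l T D rho0 G)
  (umin umax : control R N)
  (humin : Linfty l T umin) (humax : Linfty l T umax)
  (hu : forall i, {ae leb2, forall z : R * R, z \in cylinder l T i ->
          umin i z <= umax i z})
  (rhod : R -> network_fun R N)
  (hrhod : L2_time (L2_graph l) (sqnorm_L2 l) T rhod)
  (rhoT : network_fun R N) (hrhoT : L2_graph l rhoT)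
  (alpha : 'I_N -> R) (halpha : forall i, 0 < alpha i) :
  exists2 ubar : control R N, admissible l T umin umax ubar &
    cost l T rhod rhoT alpha (G ubar) ubar =
    ereal_inf [set cost l T rhod rhoT alpha (G u) u |
                 u in admissible l T umin umax].
Proof.
have rhoTL : inL2 l rhoT by exact/L2_graphP.
pose J u := cost l T rhod rhoT alpha (G u) u.
have J0 u : admissible l T umin umax u -> (0 <= J u)%E by move=> _; exact: cost_ge0.
have adm_min : admissible l T umin umax umin.
  by split => // i; move: (hu i); apply: ae_mono => z h /h ->; rewrite lexx.
rewrite -/(J @` admissible l T umin umax).
have inf_le u : admissible l T umin umax u -> (ereal_inf (J @` admissible l T umin umax) <= J u)%E.
  by move=> ua; apply: ereal_inf_lbound; exists u.
(* If the infimum is infinite, every admissible control attains it. *)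
have [infoo|infoo] := eqVneq (ereal_inf (J @` admissible l T umin umax)) +oo%E.
  exists umin => //; have := inf_le _ adm_min; rewrite infoo leye_eq => /eqP.
  exact.
have [I0 [infE I00] [un Hun]] := nonneg_minimizing_sequence adm_min J0 infoo.
have [M1 M10 HM1] := Linfty_bounded humin; have [M2 M20 HM2] := Linfty_bounded humax.
pose M := M1 + M2; have M0 : 0 <= M by exact: addr_ge0.
have adm_bound u : admissible l T umin umax u -> forall i,
    {ae leb2, forall z : R * R, z \in cylinder l T i -> `|u i z| <= M}.
  move=> [_ ua] i; have := ae_and (ua i) (ae_and (HM1 i) (HM2 i)).
  apply: ae_mono => z [h [h1 h2]] cz; have /andP[a1 a2] := h cz.
  have := h1 cz; have := h2 cz; rewrite /M !ler_norml => /andP[b1 b2] /andP[b3 b4].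
  by apply/andP; split; lra.
have adm_max : admissible l T umin umax umax.
  by split => // i; move: (hu i); apply: ae_mono => z h /h ->; rewrite lexx.
have tr u (ua : admissible l T umin umax u) i := truncate_ae (adm_bound u ua i).
have trM u (ua : admissible l T umin umax u) := truncate_bounded M0 ua.1.
have una n := (Hun n).1.
(* U refines the filter at infinity, so what holds for all large n holds along U. *)
have [U [UU oU]] := @ultraFilterLemma nat \oo _.
have between n i : {ae leb2, forall z : R * R, cylinder l T i z ->
    truncate l T M umin i z <= truncate l T M (un n) i z <= truncate l T M umax i z}.
  have := ae_and ((una n).2 i) (ae_and (tr _ (una n) i) (ae_and (tr _ adm_min i) (tr _ adm_max i))).
  apply: ae_mono => z [h [h1 [h2 h3]]] cz.
  by rewrite h1// h2// h3//; apply: h; rewrite mem_set.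
have [ub [bM bab weak]] := control_weak_compactness UU (fun n => trM _ (una n)) (trM _ adm_min)
  (trM _ adm_max) between.
have adm_b : admissible l T umin umax ub.
  split; first exact: bounded_Linfty bM.
  move=> i; have := ae_and (bab i) (ae_and (tr _ adm_min i) (tr _ adm_max i)).
  by apply: ae_mono => z [h [h1 h2]] /set_mem cz; have := h cz; rewrite h1// h2.
exists ub => //; apply/eqP; rewrite eq_le inf_le// andbT infE.
have mild u (ua : admissible l T umin umax u) :=
  weak_solution_mild hN hl hD hT M0 ua.1 (adm_bound u ua) (hG u ua.1).
apply: (@cost_lower_semicontinuous R N l D T hN hl hD hT rhod rhoT alpha rhoTL halpha U
  un (fun n => truncate l T M (un n)) ub (truncate l T M ub) (fun n => G (un n)) (G ub) M I0) => //.
- by move=> n; exact: trM.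
- exact: trM.
- by move=> n i; exact: tr.
- by move=> i; exact: tr.
- by move=> n; exact: mild.
- exact: mild.
- move=> n; apply: nrm_ae0 => i.
  have [_ h1 _] := hG _ (una n).1; have [_ h2 _] := hG _ adm_b.1.
  by have := ae_and (h1 i) (h2 i); apply: ae_mono => x [k1 k2] xl; rewrite k1// k2.
(* The limit is bounded by M everywhere, so it equals its truncation on the cylinder. *)
- move=> i g gL e e0; have := weak i g gL e e0; apply: filterS => n.
  congr (`|_| <= _); apply: eq_Rintegral => z /set_mem cz; congr ((_ - _) * _).
  by rewrite truncateE//; exact: (bM i).2.
- move=> n; apply: le_trans (Hun n).2 _; rewrite lee_fin lerD2l invf_le1//.
  by rewrite ler1n.
- move=> e e0; apply: oU; near=> n; apply: le_trans (Hun n).2 _; rewrite lee_fin lerD2l ltW//.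
  by near: n; exact: near_infty_natSinv_lt (PosNum e0).
Unshelve. all: by end_near. Qed.
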